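(* Fix a compact set $B\subset\mathscr R_{\mathrm{Kaw}}$. Let $T_\triangle(X)=\sum_{1\le u<v<w\le n}X_{uv}X_{uw}X_{vw}$ be the number of triangles of $X$. There is a constant $C_B<\infty$ such that, uniformly over $(p,\beta)\in B$ and all sufficiently large $n$ with $k=Np\in\mathbb Z$, \[ \operatorname{Var}_{\mu_\beta^k}(T_\triangle)\le C_Bn^3 . \]
   Context: Parameter region: for $p\in(0,1)$ let $c_p=\frac{\log(p/(1-p))}{2p-1}$ if $p\ne\frac12$ and $c_{1/2}=2$. $\mathscr R_{\mathrm{Kaw}}=\{(p,\beta):0<p<1,\ 0\le\beta<c_p,\ 4\beta p(1-p)<\tfrac12\}$. Model: $\mathcal I=\binom{[n]}{2}$ is the set of $N=n(n-1)/2$ edge-positions; a simple graph on $[n]$ is identified with $X\in\{0,1\}^{\mathcal I}$. $\Omega_k=\{X\in\{0,1\}^{\mathcal I}:\sum_eX_e=k\}$, where $k=Np$ is an integer. $\mathcal H_\beta(X)=\frac{2\beta}{n}\sum_{v=1}^n\binom{\deg_X(v)}{2}$ and $\mu_\beta^k(X)=e^{\mathcal H_\beta(X)}/\sum_{Y\in\Omega_k}e^{\mathcal H_\beta(Y)}$ for $X\in\Omega_k$. *)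

(* Defs.v *)
From mathcomp Require Import all_boot all_order all_algebra.
From mathcomp Require Import all_classical all_reals all_analysis.
Import Order.TTheory GRing.Theory Num.Theory.
Import numFieldNormedType.Exports.

Set Implicit Arguments.
Unset Strict Implicit.
Unset Printing Implicit Defensive.

Local Open Scope classical_set_scope.
Local Open Scope ring_scope.

Section Region.
Variable R : realType.

Definition c_Kaw (p : R) : R :=
  if p == 2^-1 then 2 else ln (p / (1 - p)) / (2 * p - 1).

Definition R_Kaw : set (R * R) :=
  [set pb | [/\ 0 < pb.1 < 1,
                0 <= pb.2 < c_Kaw pb.1 &
                4 * pb.2 * pb.1 * (1 - pb.1) < 2^-1]].

End Region.

(* Edge-positions: unordered pairs of distinct vertices. *)
Definition edge (n : nat) := {e : {set 'I_n} | #|e| == 2%N}.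

Definition graph (n : nat) := {ffun edge n -> bool}.

Section Graphs.
Variable n : nat.
Implicit Type X : graph n.

(* X_{uv}; the default value [false] is only used when u = v. *)
Definition adj X (u v : 'I_n) : bool :=
  if insub [set u; v]%SET is Some e then X e else false.

Definition deg X (v : 'I_n) : nat := (\sum_(e : edge n | v \in val e) X e)%N.

Definition Omega (k : nat) : {set graph n} :=
  [set X : graph n | (\sum_(e : edge n) X e) == k]%SET%N.

Definition triangles X : nat :=
  (\sum_(u < n) \sum_(v < n | u < v) \sum_(w < n | v < w)
     adj X u v * adj X u w * adj X v w)%N.

End Graphs.

Section Measure.
Variables (R : realType) (n k : nat) (beta : R).

Definition Ham (X : graph n) : R :=
  2 * beta / n%:R * \sum_(v < n) ('C(deg X v, 2))%:R.

Definition gibbs (X : graph n) : R :=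
  expR (Ham X) / \sum_(Y in Omega n k) expR (Ham Y).

Definition gibbs_mean (f : graph n -> R) : R := \sum_(X in Omega n k) gibbs X * f X.

Definition gibbs_var (f : graph n -> R) : R :=
  gibbs_mean (fun X => (f X - gibbs_mean f) ^+ 2).

End Measure.

(* Main.v *)
(* Centre the edge variables, Y_e = X_e - p, with degrees D_v = sum_{e at v} Y_e
   and S_uv = D_u + D_v.  On Omega_k the weight is exp (beta/n * sum_v D_v^2) up
   to a constant, and the triangle count is
   tr (Y^3) / 6 + (p/2) * sum_v D_v^2 + const, so it suffices to bound the
   variances of F = sum_v D_v^2 and F = tr (Y^3) by C n^3.

   Swapping the values of two edges with suitable rates gives a reversible
   generator L for which L F = - c F + m + Err with c > 0, because the drift of
   Y_e is - Y_e + (2 beta p (1-p) / n) S_e up to second order.  Reversibility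
   then yields c Var F <= 2 Dir F + E Err^2 / c, and both terms are O(n^3) as soon
   as sum_v D_v^2 = O(n^2), the operator norm of Y is O(sqrt n), and
   E D_v^4 = O(n^2).

   The first two hold outside an event of probability O(e^-n): after comparing
   Omega_k with the product Bernoulli(p) measure, the Kearns-Saul inequality
   E e^{t Y} <= exp (t^2 / (4 c_p)) and beta < c_p give
   E exp (beta'/n * sum_v D_v^2) <= C^n by a discrete Hubbard-Stratonovich
   linearisation, and the norm is controlled by a union bound over a lattice net.
   For the third, moving one edge of the star of v elsewhere compares the
   probabilities of consecutive degrees of v; telescoping yields the factor
   exp (- n D(a/n | p) + beta (a - n p)^2 / n + O(|a - n p| / sqrt n)), where D is the
   relative entropy, and D(w | p) >= c_p (w - p)^2 is the dual form of the
   Kearns-Saul inequality.  The metastable degrees allowed by beta < c_p are thus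
   excluded by the equilibrium weights and not by the dynamics. *)

Require Import Defs.
From mathcomp Require Import all_boot all_order all_algebra all_fingroup.
From mathcomp Require Import all_classical all_reals all_analysis.
From mathcomp Require Import ring lra zify.
Import Order.TTheory GRing.Theory Num.Theory.
Import numFieldNormedType.Exports.

Set Implicit Arguments.
Unset Strict Implicit.
Unset Printing Implicit Defensive.

Local Open Scope classical_set_scope.
Local Open Scope ring_scope.

(** * The Kearns-Saul inequality *)

(** A negative drift of the two functions [f2] and [tr3] alone plays the part of a spectral gap of
    the swap chain. For [tr3] the rate is 3, one unit per factor; for [f2] the field S_e weakens the
    rate 2 to 2 (1 - 2 beta p (1-p) (n-2) / n), which 4 beta p (1-p) < 1/2 keeps above 1.

    The obstacle is the Taylor remainder of the rates. It is quadratic in S_e, so its square brings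
    in sum_e S_e^4 <= 8 n sum_v D_v^4. The bound sum_v D_v^2 = O(n^2) still allows one D_v of order
    n, hence sum_v D_v^4 of order n^4 where n^3 is required; this forces the study of a single
    degree.

    The threshold c_p tolerates no loss of a constant factor. Fixing the number of edges removes the
    rank-one part of the incidence Gram matrix, which would otherwise cost a factor 2, and the
    entropy bound for one degree carries the same constant c_p. Polynomial losses, in contrast, are
    free on an event of probability O(e^-n). *)

Section KearnsSaul.
Variable R : realType.
Implicit Types x y a b d t p : R.

Lemma le_of_derive_ge0 (f f' : R -> R) a b : a <= b ->
  (forall x, is_derive x 1 f (f' x)) ->
  (forall x, a <= x <= b -> 0 <= f' x) -> f a <= f b.
Proof.
move=> ab df f'ge0.
have cf : {within `[a, b], continuous f}.
  apply: continuous_subspaceT => x.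
  exact/differentiable_continuous/derivable1_diffP.
have [c cab e] := MVT_segment ab (fun x _ => df x) cf.
rewrite -subr_ge0 e mulr_ge0 ?subr_ge0// f'ge0//.
Qed.

Definition sinhR x : R := (expR x - expR (- x)) / 2.
Definition coshR x : R := (expR x + expR (- x)) / 2.

Lemma is_derive_sinhR x : is_derive x 1 sinhR (coshR x).
Proof.
rewrite /sinhR /coshR.
apply: is_derive_eq.
rewrite /GRing.scale /=; ring.
Qed.

Lemma is_derive_coshR x : is_derive x 1 coshR (sinhR x).
Proof.
rewrite /sinhR /coshR.
apply: is_derive_eq.
rewrite /GRing.scale /=; ring.
Qed.

Lemma sinhR0 : sinhR 0 = 0. Proof. by rewrite /sinhR oppr0 subrr mul0r. Qed.

Lemma coshR_gt0 x : 0 < coshR x.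
Proof. by rewrite divr_gt0// addr_gt0// expR_gt0. Qed.

Lemma sinhR_ge0 x : 0 <= x -> 0 <= sinhR x.
Proof. by move=> x0; rewrite divr_ge0// subr_ge0 ler_expR; lra. Qed.

Lemma ler_coshR x y : 0 <= x -> x <= y -> coshR x <= coshR y.
Proof.
move=> x0 xy; apply: (le_of_derive_ge0 xy is_derive_coshR) => z /andP[xz _].
exact/sinhR_ge0/(le_trans x0).
Qed.

Lemma sinhR_le_mul_coshR x : 0 <= x -> sinhR x <= x * coshR x.
Proof.
move=> x0; rewrite -subr_ge0.
pose f (z : R) : R := z * coshR z - sinhR z.
have df (z : R) : is_derive z 1 f (z * sinhR z).
  have dc := is_derive_coshR z; have ds := is_derive_sinhR z.
  by apply: is_derive_eq; rewrite /GRing.scale /=; ring.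
have := le_of_derive_ge0 x0 df; rewrite {1}/f sinhR0 mul0r subr0; apply.
by move=> z /andP[z0 _]; rewrite mulr_ge0// sinhR_ge0.
Qed.

Lemma mul_sinhR_le x y : 0 <= x -> x <= y -> y * sinhR x <= x * sinhR y.
Proof.
move=> x0 xy; rewrite -subr_ge0.
pose f (z : R) : R := x * sinhR z - z * sinhR x.
have df (z : R) : is_derive z 1 f (x * coshR z - sinhR x).
  have ds := is_derive_sinhR z.
  by apply: is_derive_eq; rewrite /GRing.scale /=; ring.
have := le_of_derive_ge0 xy df; rewrite {1}/f subrr; apply.
move=> z /andP[xz _]; rewrite subr_ge0 (le_trans (sinhR_le_mul_coshR x0))//.
by rewrite ler_wpM2l// ler_coshR.
Qed.

(** By the product-to-sum formulas the two sides differ by half of (y - x) sinh (y + x) - (y + x)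
    sinh (y - x), so the monotonicity of sinh z / z decides. In effect tanh z / z is
    nonincreasing. *)
Lemma tanhR_div_noninc x y : 0 <= x -> x <= y ->
  x * coshR x * sinhR y <= y * coshR y * sinhR x.
Proof.
move=> x0 xy; have d0 : 0 <= y - x by lra.
have /(mul_sinhR_le d0) : y - x <= y + x by lra.
rewrite /sinhR /coshR !opprD !opprK !expRD.
set a := expR x; set b := expR y; set a' := expR (- x); set b' := expR (- y).
nra.
Qed.

(** [A] makes the derivative of cosh z exp (- A z^2) vanish at [y0]. Since tanh z / z is
    nonincreasing, this derivative is nonnegative before [y0] and nonpositive after it. *)
Lemma coshR_gauss_le y0 y (A := sinhR y0 / (2 * y0 * coshR y0)) :
  0 < y0 -> 0 <= y ->
  coshR y * expR (- (A * y ^+ 2)) <= coshR y0 * expR (- (A * y0 ^+ 2)).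
Proof.
move=> y00 y0'.
have c0 : coshR y0 != 0 by rewrite gt_eqF// coshR_gt0.
pose g (z : R) : R := coshR z * expR (- (A * z ^+ 2)).
have dg (z : R) : is_derive z 1 g
    ((sinhR z - 2 * A * z * coshR z) * expR (- (A * z ^+ 2))).
  have dc := is_derive_coshR z.
  by apply: is_derive_eq; rewrite /GRing.scale /=; ring.
have hA z : sinhR z - 2 * A * z * coshR z =
    (y0 * coshR y0 * sinhR z - z * coshR z * sinhR y0) / (y0 * coshR y0).
  by rewrite /A; field; rewrite c0 gt_eqF.
have p0 : 0 < y0 * coshR y0 by rewrite mulr_gt0// coshR_gt0.
have [yy0|yy0] := leP y y0.
  apply: (le_of_derive_ge0 yy0 dg) => z /andP[yz zy0].
  rewrite mulr_ge0 ?expR_ge0// hA divr_ge0 ?(ltW p0)// subr_ge0.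
  exact/tanhR_div_noninc/zy0/(le_trans y0').
rewrite -lerN2; pose h (z : R) : R := - g z.
have dh (z : R) : is_derive z 1 h
    (- ((sinhR z - 2 * A * z * coshR z) * expR (- (A * z ^+ 2)))).
  by have := dg z => ?; apply: is_derive_eq.
apply: (le_of_derive_ge0 (ltW yy0) dh) => z /andP[yz zy0].
rewrite -mulNr mulr_ge0 ?expR_ge0// hA oppr_ge0 pmulr_lle0 ?invr_gt0// subr_le0.
exact: (tanhR_div_noninc (ltW y00)).
Qed.

Lemma coshR_le_gauss y : 0 <= y -> coshR y <= expR (y ^+ 2 / 2).
Proof.
move=> y0; have e0 := expR_gt0 (- (y ^+ 2 / 2)).
rewrite -(ler_pM2r e0) -expRD subrr expR0.
pose g (z : R) : R := - (coshR z * expR (- (z ^+ 2 / 2))).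
have dg (z : R) : is_derive z 1 g ((z * coshR z - sinhR z) * expR (- (z ^+ 2 / 2))).
  have dc := is_derive_coshR z.
  by apply: is_derive_eq; rewrite /GRing.scale /=; field.
have : g 0 <= g y.
  apply: (le_of_derive_ge0 y0 dg) => z /andP[z0 _].
  by rewrite mulr_ge0 ?expR_ge0// subr_ge0 sinhR_le_mul_coshR.
rewrite /g lerN2 expr0n /= mul0r oppr0 expR0 mulr1 /coshR oppr0 expR0.
by move=> /le_trans; apply; lra.
Qed.

Lemma coshRN y : coshR (- y) = coshR y.
Proof. by rewrite /coshR opprK addrC. Qed.

Lemma sinhRN y : sinhR (- y) = - sinhR y.
Proof. by rewrite /sinhR opprK; field. Qed.

Lemma coshR_norm y : coshR `|y| = coshR y.
Proof. by case: (ger0P y) => // _; rewrite coshRN. Qed.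

Lemma bernoulli_half_log p (y0 := ln (p / (1 - p)) / 2) : 0 < p < 1 ->
  p = expR y0 / (2 * coshR y0) /\ 1 - p = expR (- y0) / (2 * coshR y0).
Proof.
move=> /andP[p0 p1]; have q0 : 0 < 1 - p by lra.
have e0 := expR_gt0 y0.
have e2 : expR y0 ^+ 2 = p / (1 - p).
  by rewrite expr2 -expRD /y0 -splitr lnK// posrE divr_gt0.
rewrite /coshR expRN; set s := expR y0 in e0 e2 *.
have {}e2 : s ^+ 2 * (1 - p) = p by rewrite e2 divfK// gt_eqF.
have pE : p = s ^+ 2 / (1 + s ^+ 2).
  apply/eqP; rewrite eq_sym -subr_eq0.
  suff -> : s ^+ 2 / (1 + s ^+ 2) - p = (s ^+ 2 * (1 - p) - p) / (1 + s ^+ 2).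
    by rewrite e2 subrr mul0r.
  by field; rewrite gt_eqF// addr_gt0// exprn_gt0.
have d0 : 1 + s ^+ 2 != 0 by rewrite gt_eqF// addr_gt0// exprn_gt0.
have d1 : 2 * ((s + s^-1) / 2) = (1 + s ^+ 2) / s by field; rewrite gt_eqF.
by rewrite d1 {1 2}pE; split; field; rewrite d0 gt_eqF.
Qed.

(** Here [y0] is the half log-odds, so 2 p - 1 = tanh y0 and c_p = 2 y0 / tanh y0, the reciprocal of
    the exponent [A] of [coshR_gauss_le]. *)
Lemma c_KawE p (y0 := ln (p / (1 - p)) / 2) : 0 < p < 1 -> p != 2^-1 ->
  y0 != 0 /\ c_Kaw p = 2 * y0 * coshR y0 / sinhR y0.
Proof.
move=> p01 ph; have [pE qE] := bernoulli_half_log p01.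
rewrite -/y0 in pE qE.
have c0 := coshR_gt0 y0.
have y00 : y0 != 0.
  apply: contra ph => /eqP yE; rewrite pE yE /coshR oppr0 expR0.
  by apply/eqP; field.
split=> //; rewrite /c_Kaw (negbTE ph).
have -> : ln (p / (1 - p)) = 2 * y0 by rewrite /y0; field.
have -> : 2 * p - 1 = sinhR y0 / coshR y0.
  have -> : 2 * p - 1 = p - (1 - p) by ring.
  by rewrite qE pE /sinhR; field; rewrite gt_eqF.
by rewrite invfM invrK; ring.
Qed.

Lemma sinhR_gt0 x : 0 < x -> 0 < sinhR x.
Proof. by move=> x0; rewrite divr_gt0// subr_gt0 ltr_expR; lra. Qed.

Lemma tanhR_coef_norm y : y != 0 ->
  2 * `|y| * coshR `|y| / sinhR `|y| = 2 * y * coshR y / sinhR y.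
Proof.
move=> y0; rewrite coshR_norm; case: (ger0P y) => // _.
by rewrite sinhRN invrN; ring.
Qed.

Lemma c_Kaw_ge2 p : 0 < p < 1 -> 2 <= c_Kaw p.
Proof.
move=> p01; have [->|ph] := eqVneq p 2^-1; first by rewrite /c_Kaw eqxx.
have [y00 ->] := c_KawE p01 ph.
rewrite -tanhR_coef_norm//.
have n0 : 0 < `|ln (p / (1 - p)) / 2| by rewrite normr_gt0.
rewrite ler_pdivlMr ?sinhR_gt0// -mulrA ler_pM2l//.
exact/sinhR_le_mul_coshR/ltW.
Qed.

(** Tilting by [y0] turns the left side into exp (t/2 - p t) cosh y / cosh y0 with y = t/2 + y0. By
    [coshR_gauss_le] the ratio is at most exp ((y^2 - y0^2) / c_p), and the terms linear in t cancel
    because c_p (2 p - 1) = 2 y0. *)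
Lemma kearns_saul p t : 0 < p < 1 ->
  p * expR ((1 - p) * t) + (1 - p) * expR (- p * t) <=
  expR (t ^+ 2 / (4 * c_Kaw p)).
Proof.
move=> p01; have [pE qE] := bernoulli_half_log p01.
set y0 := ln (p / (1 - p)) / 2 in pE qE.
set y := t / 2 + y0.
have c0 := coshR_gt0 y0.
have -> : p * expR ((1 - p) * t) + (1 - p) * expR (- p * t) =
    expR (t / 2 - p * t) * (coshR y / coshR y0).
  have -> : (1 - p) * t = (t / 2 - p * t) + t / 2 by field.
  have -> : - p * t = (t / 2 - p * t) - t / 2 by field.
  rewrite [in X in X * expR (_ + _)]pE [in X in _ + X * expR _]qE.
  rewrite /coshR /y opprD !expRD; field.
  by rewrite gt_eqF// addr_gt0// expR_gt0.
(* At p = 1/2 the tilt [y0] is 0 and [A] would read 0/0; [coshR_le_gauss] is the comparison with its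
   limit 1/2. *)
have [ph|ph] := eqVneq p 2^-1.
  have y00 : y0 = 0.
    rewrite /y0 ph; have -> : (2^-1 / (1 - 2^-1) : R) = 1 by field.
    by rewrite ln1 mul0r.
  have -> : t / 2 - p * t = 0 by rewrite ph; field.
  rewrite expR0 mul1r /c_Kaw ph eqxx /y y00 addr0.
  rewrite {2}/coshR oppr0 expR0 -coshR_norm.
  have -> : ((1 + 1) / 2 : R) = 1 by field.
  rewrite divr1; apply: (le_trans (coshR_le_gauss _)) => //.
  by rewrite ler_expR real_normK ?num_real//; lra.
have [y00 cE] := c_KawE p01 ph; rewrite -/y0 in y00 cE.
have n0 : 0 < `|y0| by rewrite normr_gt0.
have := coshR_gauss_le n0 (normr_ge0 y).
have <- : (c_Kaw p)^-1 = sinhR `|y0| / (2 * `|y0| * coshR `|y0|).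
  by rewrite cE -tanhR_coef_norm// invf_div.
rewrite !coshR_norm !real_normK ?num_real// => /= le1.
have ck0 : 0 < c_Kaw p by rewrite (lt_le_trans _ (c_Kaw_ge2 p01)).
have {}le1 : coshR y / coshR y0 <=
    expR ((c_Kaw p)^-1 * y ^+ 2 - (c_Kaw p)^-1 * y0 ^+ 2).
  rewrite ler_pdivrMr//.
  have := ler_wpM2r (expR_ge0 ((c_Kaw p)^-1 * y ^+ 2)) le1.
  rewrite -mulrA -expRD addNr expR0 mulr1 => /le_trans; apply.
  by rewrite -mulrA -expRD mulrC addrC.
apply: (le_trans (ler_wpM2l (expR_ge0 _) le1)).
rewrite -expRD ler_expR le_eqVlt; apply/orP; left; apply/eqP.
have pc : p = (1 + 2 * y0 / c_Kaw p) / 2.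
  have -> : 2 * y0 / c_Kaw p = 2 * p - 1.
    have s0 : sinhR y0 != 0.
      by apply: contraTneq ck0 => s0; rewrite cE s0 invr0 mulr0 ltxx.
    have -> : 2 * p - 1 = sinhR y0 / coshR y0.
      have -> : 2 * p - 1 = p - (1 - p) by ring.
      by rewrite qE pE /sinhR; field; rewrite gt_eqF.
    by rewrite cE; field; rewrite y00 s0 gt_eqF.
  by field.
rewrite [X in X * t]pc /y; field; rewrite gt_eqF//.
Qed.

End KearnsSaul.

(** * Uniform margins on a compact subset of the region *)

Section UniformRegion.
Variable R : realType.

(* At [p = 1/2] this is [c_Kaw_ge2], so the limit of the quotient is not needed. *)
Lemma c_Kaw_lsc (p L : R) : 0 < p < 1 -> L < c_Kaw p ->
  \forall q \near p, 0 < q < 1 /\ L < c_Kaw q.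
Proof.
move=> /andP[p0 p1] Lp.
have p01 : \forall q \near p, 0 < q < 1.
  near=> q; apply/andP; split; near: q; [exact: lt_nbhsr|exact: lt_nbhsl].
have [ph|ph] := eqVneq p 2^-1.
  move: Lp; rewrite {1}ph /c_Kaw eqxx => L2.
  near=> q; have q01 : 0 < q < 1 by near: q.
  by split=> //; rewrite (lt_le_trans L2)// c_Kaw_ge2.
pose g (q : R) := ln (q / (1 - q)) / (2 * q - 1).
have gp : L < g p by move: Lp; rewrite /c_Kaw (negbTE ph).
have cg : {for p, continuous g}.
  have d0 : 1 - p != 0 by rewrite gt_eqF// subr_gt0.
  apply: cvgM.
    apply: (@cvg_comp _ _ _ (fun q : R => q / (1 - q)) (@ln R)); last first.
      by apply: continuous_ln; rewrite divr_gt0// subr_gt0.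
    apply: cvgM; first exact: cvg_id.
    apply: cvgV => //; apply: cvgB; [exact: cvg_cst|exact: cvg_id].
  apply: cvgV.
    by apply: contra ph => /eqP h; apply/eqP; lra.
  apply: cvgB; last exact: cvg_cst.
  by apply: cvgM; [exact: cvg_cst|exact: cvg_id].
have Lg : \forall q \near p, L < g q.
  by apply: (cvgr_gt _ cg).
have qh : \forall q \near p, q != 2^-1.
  move: ph; rewrite neq_lt => /orP[ph|ph]; near=> q; rewrite neq_lt; apply/orP.
    by left; near: q; exact: lt_nbhsl.
  by right; near: q; exact: lt_nbhsr.
near=> q; split; first by near: q.
have qh' : q != 2^-1 by near: q.
by rewrite /c_Kaw (negbTE qh'); near: q.
Unshelve. all: by end_near. Qed.

(** Each margin persists near every point of [B], so the near-covering form of compactness, taken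
    along the filter [\oo], yields one m for all of [B]; then 1/(m+1) serves as [eta]. *)
Lemma compact_R_Kaw_uniform (B : set (R * R)) :
  compact B -> B `<=` R_Kaw (R := R) ->
  exists2 eta : R, 0 < eta & forall p beta, B (p, beta) ->
    [/\ eta <= p, eta <= 1 - p & beta + eta <= c_Kaw p].
Proof.
move=> cB BR.
pose P (m : nat) (x : R * R) : Prop :=
  [/\ m.+1%:R^-1 <= x.1, m.+1%:R^-1 <= 1 - x.1 & x.2 + m.+1%:R^-1 <= c_Kaw x.1].
have [|m _ mP] := (compact_near_coveringP B).1 cB nat \oo P _; last first.
  exists m.+1%:R^-1; first by rewrite invr_gt0 ltr0Sn.
  by move=> p beta Bpb; have [] := mP m (leqnn m) _ Bpb.
move=> [p beta] /BR [/= /andP[p0 p1] /andP[b0 bc] _].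
(* A quarter of the gap: [beta] may grow by [eta], the margin 1/(m+1) < [eta] comes on top, and the
   total stays below beta + 2 eta < c_q for q near p. *)
pose eta := Num.min (Num.min (p / 2) ((1 - p) / 2)) ((c_Kaw p - beta) / 4).
have eta0 : 0 < eta by rewrite !lt_min; lra.
have [e1 [e2 e3]] : eta <= p / 2 /\ eta <= (1 - p) / 2 /\
    eta <= (c_Kaw p - beta) / 4.
  by rewrite /eta !ge_min !lexx ?orbT.
have nearp : \forall q \near p,
    [/\ eta <= q, eta <= 1 - q & beta + 2 * eta < c_Kaw q].
  have p01 : 0 < p < 1 by rewrite p0.
  have L : beta + 2 * eta < c_Kaw p by lra.
  near=> q; split.
  - by apply: ltW; near: q; apply: lt_nbhsr; lra.
  - suff : q < 1 - eta by lra.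
    by near: q; apply: lt_nbhsl; lra.
  - suff [] : 0 < q < 1 /\ beta + 2 * eta < c_Kaw q by [].
    by near: q; exact: c_Kaw_lsc.
have nearb : \forall b \near beta, b < beta + eta.
  by apply: lt_nbhsl; lra.
have nearm : \forall m \near \oo, (m.+1%:R : R)^-1 < eta.
  exact: near_infty_natSinv_lt (PosNum eta0).
pose A1 : set (R * R) := [set x : R * R | [/\ eta <= x.1, eta <= 1 - x.1 &
    beta + 2 * eta < c_Kaw x.1] /\ x.2 < beta + eta].
have nA1 : nbhs (p, beta) A1.
  exists ([set q | [/\ eta <= q, eta <= 1 - q &
    beta + 2 * eta < c_Kaw q]], [set b | b < beta + eta]) => //.
exists (A1, [set m : nat | (m.+1%:R : R)^-1 < eta]) => //.
move=> [[q b] m] /= [[[h1 h2 h3] /= h4] h5].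
have {}h5 : (m.+1%:R : R)^-1 < eta := h5.
rewrite /= in h1 h2 h3 h4; rewrite /P /=; split.
- exact: le_trans (ltW h5) h1.
- exact: le_trans (ltW h5) h2.
apply: le_trans (ltW h3); apply: le_trans (ltW (ltrD h4 h5)) _.
by rewrite -addrA -mulr2n mulr_natl.
Unshelve. all: by end_near. Qed.

End UniformRegion.

(** * Edge-vertex incidence *)

Section EdgeIncidence.
Variables (R : realType) (n : nat).
Implicit Types (e f : edge n) (u v w : 'I_n).

Definition chi e v : R := (v \in val e)%:R.
(** Adjacency matrix of the graph whose only edge is [e]; the combination with coefficients [Y X e]
    is the centred adjacency matrix [ym]. *)
Definition M e u v : R := ((u != v) && (val e == [set u; v]%SET))%:R.

Lemma edge_endpoints e : exists u v, u != v /\ val e = [set u; v]%SET.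
Proof. by have /cards2P[u [v [uv ->]]] := valP e; exists u, v. Qed.

Lemma set2_eq (T : finType) (a b x y : T) : a != b ->
  ([set a; b]%SET == [set x; y]%SET) =
  ((x == a) && (y == b)) || ((x == b) && (y == a)).
Proof.
move=> ab; apply/eqP/idP => [h|]; last first.
  by case/orP=> /andP[/eqP-> /eqP->] //; rewrite finset.setUC.
have ha : a \in [set x; y]%SET by rewrite -h !inE eqxx.
have hb : b \in [set x; y]%SET by rewrite -h !inE eqxx orbT.
move: ha hb ab {h}; rewrite !inE.
by case/orP=> /eqP -> /orP[] /eqP ->; rewrite ?eqxx ?orbT.
Qed.

Lemma card_edge : #|{: edge n}| = 'C(n, 2).
Proof.
rewrite card_sig -[in RHS](card_ord n) -card_draws; apply: eq_card => A.
by rewrite !inE.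
Qed.

Lemma chi_ge0 e v : 0 <= chi e v. Proof. exact: ler0n. Qed.

Lemma chi_sq e v : chi e v ^+ 2 = chi e v.
Proof. by rewrite /chi; case: (_ \in _); rewrite ?expr1n ?expr0n. Qed.

Lemma M_ge0 e u v : 0 <= M e u v. Proof. exact: ler0n. Qed.

Lemma MC e u v : M e u v = M e v u.
Proof. by rewrite /M eq_sym (finset.setUC [set u]%SET). Qed.

Lemma M_diag e u : M e u u = 0. Proof. by rewrite /M eqxx. Qed.

Lemma sum_chi e : \sum_v chi e v = 2.
Proof.
transitivity (#|val e|%:R : R); last by rewrite (eqP (valP e)).
rewrite -sum1_card natr_sum [in RHS]big_mkcond /=; apply: eq_bigr => v _.
by rewrite /chi; case: (v \in _).
Qed.

Lemma sum_M_edge u v : \sum_e M e u v = (u != v)%:R.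
Proof.
have [<-|uv] := eqVneq u v; first by rewrite big1// => e _; rewrite M_diag.
have E : #|[set u; v]%SET| == 2 by rewrite cards2 uv.
rewrite (bigD1 (Sub [set u; v]%SET E : edge n))//= big1 ?addr0.
  by rewrite /M uv SubK eqxx.
move=> e; rewrite -val_eqE /= /M uv => /negbTE -> //.
Qed.

Lemma sum_M_row e u : \sum_v M e u v = chi e u.
Proof.
have [a [b [ab eE]]] := edge_endpoints e.
rewrite /chi eE !inE; under eq_bigr do rewrite /M eE set2_eq//.
have [->|ua] := eqVneq u a.
  rewrite (bigD1 b)//= eqxx ab big1 ?addr0//.
  by move=> v /negbTE vb; rewrite vb (negbTE ab) andbF.
have [->|ub] := eqVneq u b.
  rewrite (bigD1 a)//= eqxx eq_sym ab big1 ?addr0//.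
  by move=> v /negbTE va; rewrite va andbF.
by rewrite big1// => v _; rewrite andbF.
Qed.

Lemma chi_mul e u v : u != v -> chi e u * chi e v = M e u v.
Proof.
move=> uv; have [a [b [ab eE]]] := edge_endpoints e.
rewrite /chi /M eE !inE set2_eq// uv /= -natrM mulnb; congr _%:R.
move: uv ab; have [->|ua] := eqVneq u a.
  by rewrite eq_sym => /negbTE -> /negbTE ->; rewrite /= orbF.
have [->|ub] := eqVneq u b; last by [].
by rewrite eq_sym => /negbTE ->; rewrite orbF.
Qed.

Lemma sum_chi_edge u : \sum_e chi e u = n%:R - 1.
Proof.
have : \sum_v \sum_e M e u v = n%:R - 1.
  under eq_bigr do rewrite sum_M_edge.
  rewrite (bigD1 u)//= eqxx add0r.
  under eq_bigr => v vu do rewrite eq_sym vu.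
  rewrite sumr_const cardC1 card_ord -subn1 natrB//.
  by case: (n) u => // -[].
by rewrite exchange_big /=; under eq_bigr do rewrite sum_M_row.
Qed.

Lemma sum_chi_chi u v : \sum_e chi e u * chi e v =
  if u == v then n%:R - 1 else 1.
Proof.
have [->|uv] := eqVneq u v.
  by under eq_bigr do rewrite -expr2 chi_sq; rewrite sum_chi_edge.
by under eq_bigr do rewrite chi_mul//; rewrite sum_M_edge uv.
Qed.

(** The Gram matrix of the incidence vectors is (n - 2) I plus the all-ones matrix. On functions
    with zero sum only (n - 2) I survives, whence the factor n - 2 in [sum_Se_sq]. *)
Lemma sum_chi_lin_mul (g h : 'I_n -> R) :
  \sum_e (\sum_v chi e v * g v) * (\sum_v chi e v * h v) =
  (n%:R - 2) * (\sum_v g v * h v) + (\sum_v g v) * (\sum_v h v).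
Proof.
under eq_bigr => e _.
  rewrite mulr_suml; under eq_bigr do rewrite mulr_sumr.
  over.
rewrite exchange_big /=.
under eq_bigr => u _ do rewrite exchange_big /=.
transitivity (\sum_u \sum_v (if u == v then n%:R - 1 else 1) * (g u * h v)).
  apply: eq_bigr => u _; apply: eq_bigr => v _; rewrite -sum_chi_chi mulr_suml.
  by apply: eq_bigr => e _; ring.
rewrite mulr_sumr mulr_suml -big_split /=; apply: eq_bigr => u _.
rewrite (bigD1 u)//= eqxx [\sum_v h v](bigD1 u)//= mulrDr addrA; congr (_ + _).
  by ring.
rewrite mulr_sumr; apply: eq_bigr => v vu.
by rewrite eq_sym (negbTE vu) mul1r.
Qed.

Lemma sum_chi_lin (g : 'I_n -> R) :
  \sum_e (\sum_v chi e v * g v) = (n%:R - 1) * \sum_v g v.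
Proof.
rewrite exchange_big mulr_sumr; apply: eq_bigr => v _.
by rewrite -mulr_suml sum_chi_edge.
Qed.

End EdgeIncidence.
Arguments chi {R n}.
Arguments M {R n}.

(** * Edge swaps *)

Lemma natr_bin2 (R : realType) (d : nat) :
  ('C(d, 2)%:R : R) = (d%:R ^+ 2 - d%:R) / 2.
Proof.
case: d => [|d]; first by rewrite bin0n /= expr0n /= subrr mul0r.
have := mul_bin_diag d.+1 1; rewrite bin1 /= => /(congr1 (fun m => m%:R : R)).
by rewrite !natrM -[d.+1%:R]natr1 => h; lra.
Qed.

Section SwapDynamics.
Variables (R : realType) (n : nat) (p beta : R).
Implicit Types (X : graph n) (e f g : edge n) (u v : 'I_n).

Local Notation N := (#|{: edge n}|%:R : R).

Definition Y X e : R := (X e)%:R - p.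
Definition Dv X v : R := \sum_e chi e v * Y X e.
Definition Se X e : R := \sum_v chi e v * Dv X v.
Definition f2 X : R := \sum_v Dv X v ^+ 2.

Lemma Y_sq X e : Y X e ^+ 2 = (1 - 2 * p) * Y X e + p * (1 - p).
Proof. by rewrite /Y; case: (X e) => /=; ring. Qed.

(** Defined for all ordered pairs, equal edges included, so that sums over moves are unrestricted
    and every swap is an involution. *)
Definition swap e f X : graph n := [ffun g => X (tperm e f g)].

Lemma swapK e f : involutive (swap e f).
Proof. by move=> X; apply/ffunP => g; rewrite !ffunE tpermK. Qed.

Lemma Y_swap e f X g : Y (swap e f X) g = Y X (tperm e f g).
Proof. by rewrite /Y ffunE. Qed.

Definition delta e f X : R := Y X e - Y X f.

Lemma delta_swap e f X : delta e f (swap e f X) = - delta e f X.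
Proof. by rewrite /delta !Y_swap tpermL tpermR [RHS]opprB. Qed.

Lemma sum_swap (q : edge n -> R) e f X :
  \sum_g q g * Y (swap e f X) g =
  \sum_g q g * Y X g - delta e f X * (q e - q f).
Proof.
under eq_bigr do rewrite Y_swap; rewrite /delta.
have [<-|ef] := eqVneq e f.
  by under eq_bigr do rewrite tperm1 perm1; rewrite !subrr mul0r subr0.
rewrite (bigD1 e)//= (bigD1 f) ?(eq_sym f)//= tpermL tpermR.
rewrite [in RHS](bigD1 e)//= [in RHS](bigD1 f) ?(eq_sym f)//=.
rewrite (eq_bigr (fun g => q g * Y X g)); first by ring.
by move=> g /andP[ge gf]; rewrite tpermD// eq_sym.
Qed.

Lemma Dv_swap e f X v :
  Dv (swap e f X) v = Dv X v - delta e f X * (chi e v - chi f v).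
Proof. exact: sum_swap. Qed.

(** The number of endpoints shared by [e] and [f]. *)
Definition overlap e f : R := \sum_v chi e v * chi f v.

Lemma overlapC e f : overlap e f = overlap f e.
Proof. by apply: eq_bigr => v _; rewrite mulrC. Qed.

Lemma overlap_ge0 e f : 0 <= overlap e f.
Proof. by apply: sumr_ge0 => v _; rewrite mulr_ge0 ?chi_ge0. Qed.

Lemma overlap_diag e : overlap e e = 2.
Proof. by rewrite -(sum_chi R e); apply: eq_bigr => v _; rewrite -expr2 chi_sq. Qed.

Lemma overlap_le2 e f : overlap e f <= 2.
Proof.
rewrite -(sum_chi R e); apply: ler_sum => v _; rewrite ler_piMr ?chi_ge0//.
by rewrite /chi lern1 leq_b1.
Qed.

Lemma Se_swap e f X g : Se (swap e f X) g =
  Se X g - delta e f X * (overlap g e - overlap g f).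
Proof.
rewrite /Se /overlap -sumrB mulr_sumr -sumrB; apply: eq_bigr => v _.
by rewrite Dv_swap; ring.
Qed.

Lemma f2_swap e f X : f2 (swap e f X) =
  f2 X - 2 * delta e f X * (Se X e - Se X f)
  + delta e f X ^+ 2 * (4 - 2 * overlap e f).
Proof.
have -> : 4 - 2 * overlap e f = overlap e e + overlap f f - 2 * overlap e f.
  by rewrite !overlap_diag; ring.
rewrite /f2 /Se /overlap -sumrB -big_split /= !mulr_sumr -!sumrB mulr_sumr.
rewrite -big_split /=.
by apply: eq_bigr => v _; rewrite Dv_swap; ring.
Qed.

(* On [Omega n k] the Gibbs weight up to a constant factor, by [HamE]. *)
Definition weight X : R := expR (beta / n%:R * f2 X).

(* The term in [Se X e + Se X f] is swap invariant, so it does not affect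
   reversibility; its coefficient makes the first-order drift of [Y X e] linear
   in [Se X e] (see [LY_drift]). *)
Definition zeta e f X : R :=
  - delta e f X * (Se X e - Se X f) + (1 - 2 * p) * (Se X e + Se X f).

Definition rate e f X : R := expR (beta / n%:R * zeta e f X).

Lemma rate_ge0 e f X : 0 <= rate e f X. Proof. exact: expR_ge0. Qed.

(** Detailed balance. The exponent of the rate contains half of the first-order change of [f2],
    whose sign the swap reverses; the second-order part 4 - 2 overlap is matched because
    [Se X e - Se X f] itself changes by 2 delta (2 - overlap). *)
Lemma weight_rate_swap e f X :
  weight (swap e f X) * rate e f (swap e f X) = weight X * rate e f X.
Proof.
rewrite /weight /rate -!expRD -!mulrDr; congr (expR (_ * _)).
rewrite /zeta f2_swap delta_swap !Se_swap !overlap_diag (overlapC f e).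
by ring.
Qed.

Lemma deltaC e f X : delta f e X = - delta e f X.
Proof. by rewrite /delta [RHS]opprB. Qed.

Lemma zetaC e f X : zeta f e X = zeta e f X.
Proof. by rewrite /zeta deltaC; ring. Qed.

Lemma rateC e f X : rate f e X = rate e f X.
Proof. by rewrite /rate zetaC. Qed.

Section FixedEdges.
Variable k : nat.
Hypothesis kE : k%:R = 'C(n, 2)%:R * p.

Lemma natr_card_edge : N * p = k%:R.
Proof. by rewrite card_edge kE. Qed.

Lemma swap_Omega e f X : (swap e f X \in Omega n k) = (X \in Omega n k).
Proof.
rewrite !inE; congr (_ == _); under eq_bigr do rewrite ffunE.
by rewrite [RHS](reindex_perm (tperm e f)).
Qed.

Lemma sum_edge_const (c : R) : \sum_(e : edge n) c = N * c.
Proof. by rewrite sumr_const mulr_natl. Qed.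

Lemma sum_Y X : X \in Omega n k -> \sum_e Y X e = 0.
Proof.
rewrite inE => /eqP h; rewrite sumrB -natr_sum h sum_edge_const.
by rewrite natr_card_edge subrr.
Qed.

Lemma sum_Dv X : X \in Omega n k -> \sum_v Dv X v = 0.
Proof.
move=> XO; rewrite exchange_big /=.
under eq_bigr do rewrite -mulr_suml sum_chi.
by rewrite -mulr_sumr sum_Y// mulr0.
Qed.

Lemma sum_Y_Se X : \sum_e Y X e * Se X e = f2 X.
Proof.
under eq_bigr do rewrite mulr_sumr; rewrite exchange_big; apply: eq_bigr => v _.
by rewrite expr2 {2}/Dv mulr_suml; apply: eq_bigr => e _; ring.
Qed.

Lemma sum_Se X : X \in Omega n k -> \sum_e Se X e = 0.
Proof. by move=> XO; rewrite sum_chi_lin sum_Dv// mulr0. Qed.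

Lemma sum_Se_sq X : X \in Omega n k ->
  \sum_e Se X e ^+ 2 = (n%:R - 2) * f2 X.
Proof.
move=> XO; under eq_bigr do rewrite expr2.
by rewrite sum_chi_lin_mul sum_Dv// mulr0 addr0.
Qed.

Lemma sum_Y_sq X : X \in Omega n k -> \sum_e Y X e ^+ 2 = N * (p * (1 - p)).
Proof.
move=> XO; under eq_bigr do rewrite Y_sq.
by rewrite big_split /= -mulr_sumr sum_Y// mulr0 add0r sum_edge_const.
Qed.

(** Since deg v = D_v + p (n - 1) and the D_v sum to 0 on [Omega n k], every term linear in the
    degrees is constant there. *)
Lemma HamE X : (0 < n)%N -> X \in Omega n k -> Ham beta X = beta / n%:R * f2 X +
  beta / n%:R * (n%:R * (p * (n%:R - 1)) ^+ 2 - 2 * k%:R).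
Proof.
move=> n0 XO.
have dE v : (deg X v)%:R = Dv X v + p * (n%:R - 1).
  rewrite /deg natr_sum /Dv -(sum_chi_edge R v) mulr_sumr -big_split big_mkcond /=.
  by apply: eq_bigr => e _; rewrite /Y /chi; case: (v \in _) => /=; ring.
set c := p * (n%:R - 1) in dE *.
have sc (a : R) : \sum_(v < n) a = n%:R * a by rewrite sumr_const card_ord mulr_natl.
rewrite /Ham; under eq_bigr do rewrite natr_bin2 dE.
have sk : (2 * k%:R = n%:R * c :> R) by rewrite kE natr_bin2 /c; field.
have sd : \sum_(v < n) (Dv X v + c) = n%:R * c.
  by rewrite big_split /= sum_Dv// add0r sc.
rewrite sk -mulr_suml !sumrB sd.
have -> : \sum_(v < n) (Dv X v + c) ^+ 2 = f2 X + n%:R * c ^+ 2.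
  transitivity (\sum_(v < n) (Dv X v ^+ 2 + (2 * c * Dv X v + c ^+ 2))).
    by apply: eq_bigr => v _; ring.
  by rewrite !big_split /= -mulr_sumr sum_Dv// mulr0 add0r sc.
by field; rewrite pnatr_eq0 -lt0n.
Qed.

End FixedEdges.
End SwapDynamics.

(** * The reversible generator and its variance inequality *)

Section Generator.
Variables (R : realType) (n k : nat) (p beta : R).
Implicit Types (X : graph n) (e f g : edge n) (u v : 'I_n).

Local Notation N := (#|{: edge n}|%:R : R).

Lemma card_Omega : #|Omega n k| = 'C(#|{: edge n}|, k).
Proof.
pose s X : {set edge n} := [set e | X e]%SET.
have sK : cancel s (fun A : {set edge n} => [ffun e => e \in A]).
  by move=> X; apply/ffunP => e; rewrite ffunE inE.
have As (A : {set edge n}) : s [ffun e => e \in A] = A.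
  by apply/finset.setP => e; rewrite inE ffunE.
rewrite -card_draws -(card_imset _ (can_inj sK)); apply: eq_card => A.
have cE X : (\sum_(e : edge n) X e)%N = #|s X|.
  rewrite -sum1_card [in RHS]big_mkcond /=; apply: eq_bigr => e _.
  by rewrite inE; case: (X e).
rewrite inE; apply/imsetP/idP => [[X + ->]|Ak]; first by rewrite inE cE.
by exists [ffun e => e \in A]; rewrite ?As// inE cE As.
Qed.

Local Notation weight := (weight p beta).
Local Notation rate := (rate p beta).
Local Notation Mean := (@gibbs_mean R n k beta).
Local Notation Var := (@gibbs_var R n k beta).

Hypothesis kE : k%:R = 'C(n, 2)%:R * p.
Hypothesis n0 : (0 < n)%N.
Hypothesis p01 : 0 < p < 1.

Lemma Omega_nonempty : exists X, X \in Omega n k.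
Proof.
apply/set0Pn; rewrite -card_gt0 card_Omega bin_gt0 card_edge -(ler_nat R) kE.
by rewrite ler_piMr//; case/andP: p01 => _ /ltW.
Qed.

Definition partition_fn : R := \sum_(X in Omega n k) weight X.

Lemma partition_fn_gt0 : 0 < partition_fn.
Proof.
have [X XO] := Omega_nonempty.
rewrite /partition_fn (bigD1 X)//= ltr_pwDl ?expR_gt0//.
by apply: sumr_ge0 => Z _; exact: expR_ge0.
Qed.

Lemma gibbsE X : X \in Omega n k -> gibbs k beta X = weight X / partition_fn.
Proof.
move=> XO; rewrite /gibbs (HamE beta kE)// expRD -/(weight X).
set C := expR _.
have -> : \sum_(Z in Omega n k) expR (Ham beta Z) = partition_fn * C.
  rewrite mulr_suml; apply: eq_bigr => Z ZO.
  by rewrite (HamE beta kE)// expRD.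
by rewrite invfM [_ / C]mulrC mulrA mulfK// gt_eqF// expR_gt0.
Qed.

Lemma MeanE (h : graph n -> R) :
  Mean h = (\sum_(X in Omega n k) weight X * h X) / partition_fn.
Proof.
by rewrite /gibbs_mean mulr_suml; apply: eq_bigr => X XO; rewrite gibbsE// mulrAC.
Qed.

Lemma gibbs_ge0 X : 0 <= gibbs k beta X.
Proof. by rewrite divr_ge0 ?expR_ge0// sumr_ge0// => Z _; exact: expR_ge0. Qed.

Lemma eq_Mean (h g : graph n -> R) :
  {in Omega n k, h =1 g} -> Mean h = Mean g.
Proof. by move=> hg; apply: eq_bigr => X XO; rewrite hg. Qed.

Lemma ler_Mean (h g : graph n -> R) :
  (forall X, X \in Omega n k -> h X <= g X) -> Mean h <= Mean g.
Proof. by move=> hg; apply: ler_sum => X XO; rewrite ler_wpM2l ?gibbs_ge0 ?hg. Qed.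

Lemma Mean_ge0 (h : graph n -> R) :
  (forall X, X \in Omega n k -> 0 <= h X) -> 0 <= Mean h.
Proof. by move=> h0; apply: sumr_ge0 => X XO; rewrite mulr_ge0 ?gibbs_ge0 ?h0. Qed.

Lemma MeanD (h g : graph n -> R) : Mean (fun X => h X + g X) = Mean h + Mean g.
Proof. by rewrite -big_split; apply: eq_bigr => X _; rewrite mulrDr. Qed.

Lemma MeanZ c (h : graph n -> R) : Mean (fun X => c * h X) = c * Mean h.
Proof. by rewrite mulr_sumr; apply: eq_bigr => X _; rewrite mulrCA. Qed.

Lemma Mean_sum (I : finType) (h : I -> graph n -> R) :
  Mean (fun X => \sum_i h i X) = \sum_i Mean (h i).
Proof. by rewrite exchange_big; apply: eq_bigr => X _; rewrite mulr_sumr. Qed.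

Lemma Mean_cst c : Mean (fun=> c) = c.
Proof.
rewrite MeanE -mulr_suml -/partition_fn mulrAC divff ?mul1r//.
by rewrite gt_eqF// partition_fn_gt0.
Qed.

Lemma gibbs_var_ge0 F : 0 <= Var F.
Proof. by apply: Mean_ge0 => X _; exact: sqr_ge0. Qed.

Lemma gibbs_var_le_sq F c : Var F <= Mean (fun X => (F X - c) ^+ 2).
Proof.
have -> : Mean (fun X => (F X - c) ^+ 2) = Var F + (Mean F - c) ^+ 2; last first.
  by rewrite lerDl sqr_ge0.
rewrite /gibbs_var; set m := Mean F.
transitivity (Mean (fun X => (F X - m) ^+ 2 + ((m - c) ^+ 2 +
    ((2 * (m - c)) * F X + - (2 * (m - c) * m))))).
  by apply: eq_Mean => X _; ring.
by rewrite !MeanD MeanZ !Mean_cst -/m; ring.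
Qed.

Lemma gibbs_varD F G c d : 
  Var (fun X => c * F X + d * G X) <= 2 * c ^+ 2 * Var F + 2 * d ^+ 2 * Var G.
Proof.
apply: (le_trans (gibbs_var_le_sq _ (c * Mean F + d * Mean G))).
rewrite /gibbs_var; move: (Mean F) (Mean G) => m m'.
rewrite -!MeanZ -MeanD; apply: ler_Mean => X _; rewrite -subr_ge0.
suff -> : 2 * c ^+ 2 * (F X - m) ^+ 2 + 2 * d ^+ 2 * (G X - m') ^+ 2 -
  (c * F X + d * G X - (c * m + d * m')) ^+ 2 =
  (c * (F X - m) - d * (G X - m')) ^+ 2 by exact: sqr_ge0.
by ring.
Qed.

Lemma eq_gibbs_var F G c :
  (forall X, X \in Omega n k -> F X = G X + c) -> Var F = Var G.
Proof.
move=> FG; have mE : Mean F = Mean G + c.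
  by rewrite (eq_Mean FG) MeanD Mean_cst.
by apply: eq_Mean => X XO; rewrite FG// mE; ring.
Qed.

(** Both orders of a pair of edges are summed, so (2 N)^-1 gives each unordered pair the rate
    [rate / N]; at beta = 0 every [Y X e] then relaxes at rate 1 on [Omega n k]. *)
Definition generator (F : graph n -> R) X : R :=
  (2 * N)^-1 * \sum_e \sum_f rate e f X * (F (swap e f X) - F X).

Definition dirichlet (F : graph n -> R) : R :=
  (4 * N)^-1 * \sum_e \sum_f Mean (fun X => rate e f X * (F (swap e f X) - F X) ^+ 2).

Lemma Mean_swap e f (h : graph n -> R) :
  Mean (fun X => rate e f X * h (swap e f X)) = Mean (fun X => rate e f X * h X).
Proof.
rewrite !MeanE; congr (_ / _).
rewrite (reindex_inj (can_inj (swapK e f))) /=.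
apply: eq_big => X; first by rewrite swap_Omega.
by rewrite swap_Omega swapK => XO; rewrite !mulrA weight_rate_swap.
Qed.

(** By detailed balance each term can be averaged with its image under the swap, where the increment
    changes sign; what remains is minus half of a square. *)
Lemma Mean_generator (F : graph n -> R) c :
  Mean (fun X => (F X - c) * generator F X) = - dirichlet F.
Proof.
rewrite /generator /dirichlet.
transitivity (Mean (fun X => (2 * N)^-1 *
    \sum_e \sum_f rate e f X * ((F X - c) * (F (swap e f X) - F X)))).
  apply: eq_Mean => X _; rewrite mulrCA; congr (_ * _).
  rewrite mulr_sumr; apply: eq_bigr => e _; rewrite mulr_sumr.
  by apply: eq_bigr => f _; ring.
rewrite MeanZ Mean_sum.
have -> : (4 * N)^-1 = (2 * N)^-1 / 2 :> R.
  have h4 : (4 : R)^-1 = 2^-1 * 2^-1 by field.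
  by rewrite !invfM h4 -!mulrA [2^-1 * N^-1]mulrC.
rewrite -mulrA -mulrN; congr (_ * _).
rewrite mulr_sumr -sumrN; apply: eq_bigr => e _.
rewrite Mean_sum mulr_sumr -sumrN; apply: eq_bigr => f _.
set h := fun X => (F X - c) * (F (swap e f X) - F X).
have h2 := Mean_swap e f h.
have -> : Mean (fun X => rate e f X * (F (swap e f X) - F X) ^+ 2) =
   Mean (fun X => - (rate e f X * h (swap e f X)) - (rate e f X * h X)).
  by apply: eq_Mean => X _; rewrite /h swapK; ring.
have MN (g : graph n -> R) : Mean (fun X => - g X) = - Mean g.
  by rewrite -mulN1r -MeanZ; apply: eq_Mean => X _; rewrite mulN1r.
by rewrite MeanD !MN h2; field.
Qed.

(** The drift equation is tested against F - E F. Young's inequality on the cross term with [Err]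
    costs half of c Var F, which is moved back to the left side. *)
Lemma gibbs_var_le_dirichlet (F Err : graph n -> R) c m : 0 < c ->
  (forall X, X \in Omega n k -> generator F X = - c * F X + m + Err X) ->
  Var F <= 2 / c * dirichlet F + c ^- 2 * Mean (fun X => Err X ^+ 2).
Proof.
move=> c0 FE; set mu := Mean F.
have D := Mean_generator F mu.
have {D}: c * Var F - dirichlet F <= c / 2 * Var F + (2 * c)^-1 * Mean (fun X => Err X ^+ 2).
  rewrite -D -!MeanZ -!MeanD.
  have -> : Mean (fun X => c * (F X - mu) ^+ 2 + (F X - mu) * generator F X) =
      Mean (fun X => (F X - mu) * Err X).
    (* The constant part of the drift is orthogonal to the centred function, so [m] disappears. *)
    have E0 : Mean (fun X => (m - c * mu) * (F X - mu)) = 0.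
      by rewrite MeanZ MeanD Mean_cst subrr mulr0.
    rewrite -[RHS]addr0 -E0 -MeanD.
    by apply: eq_Mean => X XO; rewrite FE//; ring.
  apply: ler_Mean => X _; rewrite -subr_ge0.
  suff -> : c / 2 * (F X - mu) ^+ 2 + (2 * c)^-1 * Err X ^+ 2 - (F X - mu) * Err X =
     (2 * c)^-1 * (c * (F X - mu) - Err X) ^+ 2.
    by rewrite mulr_ge0 ?sqr_ge0// invr_ge0 mulr_ge0// ltW.
  by field; rewrite gt_eqF.
set V := Var F; set W := Mean _ => h.
have {}h : c / 2 * V <= dirichlet F + (2 * c)^-1 * W by lra.
have c2 : 0 < c / 2 by rewrite divr_gt0.
rewrite -(ler_pM2l c2); apply: (le_trans h).
rewrite le_eqVlt; apply/orP; left; apply/eqP; field.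
by rewrite gt_eqF.
Qed.

End Generator.

(** * Drift of the swap dynamics *)

Ltac nonneg := repeat first
  [ exact: sqr_ge0 | exact: expR_ge0 | exact: normr_ge0 | exact: ler0n
  | assumption | apply: ltW; assumption | apply: exprn_ge0 | apply: addr_ge0
  | apply: mulr_ge0 | rewrite invr_ge0 ]; try lra.

(** Lagrange's identity: the defect is half of a double sum of squares. *)
Lemma cauchy_schwarz (R : realType) (I : finType) (a b : I -> R) :
  (\sum_i a i * b i) ^+ 2 <= (\sum_i a i ^+ 2) * (\sum_i b i ^+ 2).
Proof.
have mulss (c d : I -> R) : (\sum_i c i) * (\sum_i d i) = \sum_i \sum_j c i * d j.
  by rewrite mulr_suml; apply: eq_bigr => i _; rewrite mulr_sumr.
rewrite -subr_ge0.
have -> : (\sum_i a i ^+ 2) * (\sum_i b i ^+ 2) - (\sum_i a i * b i) ^+ 2 =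
    2^-1 * \sum_i \sum_j (a i * b j - a j * b i) ^+ 2.
  rewrite -[LHS](mulKf (_ : (2 : R) != 0)) ?pnatr_eq0//; congr (_ * _).
  rewrite mulrBr -[2]/(1 + 1) mulrDl mul1r expr2 !mulss [X in _ + X - _]exchange_big.
  rewrite mulr_sumr -big_split -sumrB; apply: eq_bigr => i _ /=.
  by rewrite mulr_sumr -big_split -sumrB; apply: eq_bigr => j _ /=; ring.
rewrite mulr_ge0// ?invr_ge0//; apply: sumr_ge0 => i _; apply: sumr_ge0 => j _.
exact: sqr_ge0.
Qed.

Lemma sqr_weighted_sum_le (R : realType) (I : finType) (m a : I -> R) :
  (forall i, 0 <= m i) ->
  (\sum_i m i * a i) ^+ 2 <= (\sum_i m i) * (\sum_i m i * a i ^+ 2).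
Proof.
move=> m0.
have -> : \sum_i m i * a i = \sum_i Num.sqrt (m i) * (Num.sqrt (m i) * a i).
  by apply: eq_bigr => i _; rewrite mulrA -expr2 sqr_sqrtr.
apply: le_trans (cauchy_schwarz _ _) _.
rewrite le_eqVlt; apply/orP; left; apply/eqP; congr (_ * _).
  by apply: eq_bigr => i _; rewrite sqr_sqrtr.
by apply: eq_bigr => i _; rewrite exprMn sqr_sqrtr.
Qed.

Lemma sqr_sum3_le (R : realType) (a b c : R) :
  (a + b + c) ^+ 2 <= 3 * (a ^+ 2 + b ^+ 2 + c ^+ 2).
Proof. by have := sqr_ge0 (a - b); have := sqr_ge0 (a - c); have := sqr_ge0 (b - c); nra. Qed.

Section ExpBounds.
Variable R : realType.
Implicit Types z : R.

Lemma normr_expR_sub1_le z : `|expR z - 1| <= `|z| * expR `|z|.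
Proof.
have h1 := expR_ge1Dx z; have h2 := expR_ge1Dx (- z).
have e0 := expR_gt0 z.
have {}h2 : (1 - z) * expR z <= 1.
  by rewrite -[leRHS](expRxMexpNx_1 z) mulrC ler_wpM2l// ltW.
case: (ger0P z) => z0.
  by rewrite ger0_norm; nra.
have e1 : 1 <= expR (- z) by rewrite -expR0 ler_expR; lra.
rewrite ler0_norm; nra.
Qed.

Lemma normr_expR_sub1D_le z : `|expR z - 1 - z| <= z ^+ 2 * expR `|z|.
Proof.
have h1 := expR_ge1Dx z; have h2 := expR_ge1Dx (- z).
have {}h2 : (1 - z) * expR z <= 1.
  by rewrite -[leRHS](expRxMexpNx_1 z) mulrC ler_wpM2l// ltW// expR_gt0.
rewrite ger0_norm; last by lra.
have h : z * (expR z - 1) <= `|z| * (`|z| * expR `|z|).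
  apply: (le_trans (ler_norm _)); rewrite normrM ler_wpM2l//.
  exact: normr_expR_sub1_le.
have : z ^+ 2 = `|z| * `|z| by rewrite -expr2 real_normK// num_real.
move=> ->; nra.
Qed.

End ExpBounds.

Section Drift.
Variables (R : realType) (n k : nat) (p beta b0 : R).
Implicit Types (X : graph n) (e f g : edge n) (u v : 'I_n).

Local Notation N := (#|{: edge n}|%:R : R).
Local Notation rate := (rate p beta).
Local Notation Y := (Y p).
Local Notation Dv := (Dv p).
Local Notation Se := (Se p).
Local Notation f2 := (f2 p).
Local Notation delta := (delta p).
Local Notation zeta := (zeta p).
Local Notation generator := (generator p beta).

Hypothesis kE : k%:R = 'C(n, 2)%:R * p.
Hypothesis n1 : (1 < n)%N.
Hypothesis p01 : 0 < p < 1.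
Hypothesis beta01 : 0 <= beta <= b0.

Lemma N_eq : N = n%:R * (n%:R - 1) / 2.
Proof. by rewrite card_edge natr_bin2; ring. Qed.

Lemma nR_ge2 : (2 : R) <= n%:R. Proof. by rewrite ler_nat. Qed.

Lemma N_ge : n%:R ^+ 2 / 4 <= N.
Proof. have := nR_ge2; rewrite N_eq; nra. Qed.

Lemma N_le : N <= n%:R ^+ 2 / 2.
Proof. have := nR_ge2; rewrite N_eq; nra. Qed.

Lemma N_gt0 : 0 < N.
Proof. by have := nR_ge2; rewrite N_eq => h; rewrite divr_gt0// mulr_gt0; lra. Qed.

(** The generator applied to the coordinate [Y X e]; the orders (e, f) and (f, e) contribute
    equally, which turns (2 N)^-1 into N^-1. *)
Definition LY e X : R := N^-1 * \sum_f rate e f X * (Y X f - Y X e).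

Definition Rm e X : R :=
  N^-1 * \sum_f (rate e f X - 1 - beta / n%:R * zeta e f X) * (Y X f - Y X e).

Lemma LY_drift e X : X \in Omega n k -> LY e X = - Y X e +
  beta / n%:R * (2 * (p * (1 - p)) * Se X e + 2 * Y X e * f2 X / N) + Rm e X.
Proof.
move=> XO; have N0 : N != 0 by rewrite gt_eqF// N_gt0.
rewrite /LY /Rm.
have s1 : \sum_f (Y X f - Y X e) = - N * Y X e.
  by rewrite sumrB (sum_Y kE XO) sum_edge_const sub0r mulNr.
(* After Y^2 = (1 - 2 p) Y + p (1 - p), the second term of [zeta] cancels the products Y_e S_e and
   Y_f S_f carrying the factor 1 - 2 p. Of the rest, all that is linear in Y_f or S_f sums to zero
   over f. *)
have s2 : \sum_f zeta e f X * (Y X f - Y X e) =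
    N * (2 * (p * (1 - p)) * Se X e) + 2 * Y X e * f2 X.
  transitivity (\sum_f (2 * (p * (1 - p)) * Se X e + ((- Y X e * Se X e * (-2)
     + (1 - 2 * p) * Se X e + (1 - 2 * p) * Se X e - 2 * Y X e * Se X e - 2 * Y X e * Se X e) * Y X f
     + (- (2 * (p * (1 - p)) + (1 - 2 * p) * Y X e + (1 - 2 * p) * Y X e)) * Se X f
     + 2 * Y X e * (Y X f * Se X f)))).
    apply: eq_bigr => f _; rewrite /zeta /delta.
    have he := Y_sq p X e; have hf := Y_sq p X f.
    transitivity ((Y X e ^+ 2 + Y X f ^+ 2 - 2 * Y X e * Y X f) * (Se X e - Se X f)
        - (1 - 2 * p) * (Y X e - Y X f) * (Se X e + Se X f)); first by ring.
    by rewrite he hf; ring.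
  rewrite big_split /= sum_edge_const; congr (_ + _).
  rewrite !big_split /= -!mulr_sumr (sum_Y kE XO) (sum_Se kE XO) sum_Y_Se.
  by ring.
have -> : \sum_f rate e f X * (Y X f - Y X e) = \sum_f (Y X f - Y X e) +
   beta / n%:R * (\sum_f zeta e f X * (Y X f - Y X e)) +
   \sum_f (rate e f X - 1 - beta / n%:R * zeta e f X) * (Y X f - Y X e).
  rewrite mulr_sumr -!big_split /=; apply: eq_bigr => f _; ring.
rewrite s1 s2; field; rewrite N0 pnatr_eq0 -lt0n ltnW//.
Qed.

(** Symmetrising in e and f turns the first-order part of the generator, for a function with
    gradient proportional to [q], into a sum over single edges. It serves [f2] with q = [Se] and
    [tr3] with q = [C2]. *)
Lemma sum_rate_delta (q : edge n -> R) X :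
  (2 * N)^-1 * (\sum_e \sum_f rate e f X * (- delta e f X * (q e - q f))) =
  \sum_e q e * LY e X.
Proof.
have N0 := N_gt0.
have -> : \sum_e \sum_f rate e f X * (- delta e f X * (q e - q f)) =
   \sum_e \sum_f rate e f X * (- delta e f X * q e) +
   \sum_f \sum_e rate e f X * (delta e f X * q f).
  rewrite [X in _ + X]exchange_big -big_split; apply: eq_bigr => e _ /=.
  by rewrite -big_split; apply: eq_bigr => f _ /=; ring.
have -> : \sum_f \sum_e rate e f X * (delta e f X * q f) =
   \sum_e \sum_f rate e f X * (- delta e f X * q e).
  by apply: eq_bigr => f _; apply: eq_bigr => e _; rewrite rateC deltaC; ring.
set S := \sum_e \sum_f _.
have -> : (2 * N)^-1 * (S + S) = N^-1 * S by field; rewrite gt_eqF.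
rewrite mulr_sumr.
apply: eq_bigr => e _; rewrite /LY [RHS]mulrCA; congr (_ * _).
by rewrite mulr_sumr; apply: eq_bigr => f _; rewrite /delta; ring.
Qed.

Lemma normr_Y_le1 X e : `|Y X e| <= 1.
Proof.
by case/andP: p01 => p0 p1; rewrite /Y ler_norml; case: (X e) => /=; lra.
Qed.

Lemma normr_delta_le1 e f X : `|delta e f X| <= 1.
Proof.
rewrite /delta /Y; have -> : (X e)%:R - p - ((X f)%:R - p) = (X e)%:R - (X f)%:R :> R by ring.
by rewrite ler_norml; case: (X e); case: (X f) => /=; lra.
Qed.

Lemma delta_sq_le1 e f X : delta e f X ^+ 2 <= 1.
Proof. by rewrite -real_normK ?num_real// expr_le1// normr_delta_le1. Qed.

Lemma normr_Dv_le X v : `|Dv X v| <= n%:R.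
Proof.
apply: (le_trans (ler_norm_sum _ _ _)).
apply: (@le_trans _ _ (\sum_e chi e v)).
  apply: ler_sum => e _; rewrite normrM ger0_norm ?chi_ge0//.
  by rewrite ler_piMr ?chi_ge0// normr_Y_le1.
by rewrite sum_chi_edge; lra.
Qed.

Lemma normr_Se_le X e : `|Se X e| <= 2 * n%:R.
Proof.
apply: (le_trans (ler_norm_sum _ _ _)).
rewrite -(sum_chi R e) mulr_suml; apply: ler_sum => v _.
by rewrite normrM ger0_norm ?chi_ge0// ler_wpM2l ?chi_ge0// normr_Dv_le.
Qed.

Lemma normr_zeta_le e f X : `|zeta e f X| <= 2 * (`|Se X e| + `|Se X f|).
Proof.
rewrite /zeta; have d1 := normr_delta_le1 e f X.
have q1 : `|1 - 2 * p| <= 1 by case/andP: p01 => p0 p1; rewrite ler_norml; lra.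
apply: (le_trans (ler_normD _ _)); rewrite !normrM normrN.
have h1 := ler_normB (Se X e) (Se X f); have h2 := ler_normD (Se X e) (Se X f).
have t1 := ler_pM (normr_ge0 _) (normr_ge0 _) d1 h1.
have t2 := ler_pM (normr_ge0 _) (normr_ge0 _) q1 h2.
by lra.
Qed.

(** A uniform bound for the rates, since |zeta| <= 8 n. *)
Definition Ab : R := expR (8 * b0).

Lemma Ab_ge1 : 1 <= Ab.
Proof. by rewrite -expR0 ler_expR; case/andP: beta01; lra. Qed.

Lemma normr_rate_arg_le e f X : `|beta / n%:R * zeta e f X| <= 8 * b0.
Proof.
case/andP: beta01 => b1 b2; have n0 := nR_ge2.
have nn0 : (0 : R) < n%:R by lra.
rewrite normrM ger0_norm ?divr_ge0// mulrAC ler_pdivrMr//.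
have := normr_zeta_le e f X; have := normr_Se_le X e; have := normr_Se_le X f.
move=> h1 h2 h3; apply: (@le_trans _ _ (b0 * (8 * n%:R))); last by lra.
by apply: ler_pM => //; lra.
Qed.

Lemma rate_le e f X : rate e f X <= Ab.
Proof.
by rewrite ler_expR; apply: le_trans (ler_norm _) _; exact: normr_rate_arg_le.
Qed.

Lemma normr_rate_sub1_le e f X :
  `|rate e f X - 1| <= 2 * b0 * Ab / n%:R * (`|Se X e| + `|Se X f|).
Proof.
case/andP: beta01 => b1 b2.
apply: (le_trans (normr_expR_sub1_le _)).
have h1 : expR `|beta / n%:R * zeta e f X| <= Ab.
  by rewrite ler_expR normr_rate_arg_le.
apply: (le_trans (ler_wpM2l (normr_ge0 _) h1)).
rewrite normrM ger0_norm ?divr_ge0//.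
have -> : 2 * b0 * Ab / n%:R * (`|Se X e| + `|Se X f|) =
  b0 / n%:R * (2 * (`|Se X e| + `|Se X f|)) * Ab by ring.
apply: ler_wpM2r; first exact: expR_ge0.
apply: ler_pM => //; [by rewrite divr_ge0|by rewrite ler_wpM2r ?invr_ge0|].
exact: normr_zeta_le.
Qed.

Definition Kr : R := 8 * b0 ^+ 2 * Ab.

Lemma Kr_ge0 : 0 <= Kr.
Proof. by apply: mulr_ge0; [apply: mulr_ge0; rewrite ?sqr_ge0|exact: expR_ge0]. Qed.

(** The second-order Taylor bound gives S_e^2 plus the mean of S_f^2 over f, and this mean is (n -
    2) f2 / N <= 4 f2 / n. *)
Lemma normr_Rm_le e X : X \in Omega n k ->
  `|Rm e X| <= Kr / n%:R ^+ 2 * (Se X e ^+ 2 + 4 * f2 X / n%:R).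
Proof.
move=> XO; case/andP: beta01 => b1 b2; have n2 := nR_ge2.
have nn0 : (0 : R) < n%:R by lra.
have N0 := N_gt0.
rewrite normrM ger0_norm ?invr_ge0 ?(ltW N0)//.
rewrite -(ler_pM2l N0) mulrA divff ?gt_eqF// mul1r.
apply: (le_trans (ler_norm_sum _ _ _)).
apply: (@le_trans _ _ (\sum_f Kr / n%:R ^+ 2 * (Se X e ^+ 2 + Se X f ^+ 2))).
  apply: ler_sum => f _; rewrite normrM.
  have d1 : `|Y X f - Y X e| <= 1 := normr_delta_le1 f e X.
  apply: (le_trans (ler_wpM2l (normr_ge0 _) d1)); rewrite mulr1.
  apply: (le_trans (normr_expR_sub1D_le _)).
  have h1 : expR `|beta / n%:R * zeta e f X| <= Ab.
    by rewrite ler_expR normr_rate_arg_le.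
  apply: (le_trans (ler_wpM2l (sqr_ge0 _) h1)).
  have z2 : zeta e f X ^+ 2 <= 8 * (Se X e ^+ 2 + Se X f ^+ 2).
    have hz := normr_zeta_le e f X.
    rewrite -[leLHS]real_normK ?num_real//.
    apply: (@le_trans _ _ ((2 * (`|Se X e| + `|Se X f|)) ^+ 2)).
      by rewrite lerXn2r ?nnegrE ?mulr_ge0 ?addr_ge0.
    rewrite -(real_normK (num_real (Se X e))) -(real_normK (num_real (Se X f))).
    by have := sqr_ge0 (`|Se X e| - `|Se X f|); nra.
  have -> : Kr / n%:R ^+ 2 * (Se X e ^+ 2 + Se X f ^+ 2) =
    (b0 / n%:R) ^+ 2 * (8 * (Se X e ^+ 2 + Se X f ^+ 2)) * Ab.
    by rewrite /Kr; field; rewrite gt_eqF.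
  rewrite exprMn; apply: ler_wpM2r; first exact: expR_ge0.
  apply: ler_pM; rewrite ?sqr_ge0//.
  by rewrite lerXn2r ?nnegrE ?divr_ge0// ?(le_trans b1)// ler_wpM2r ?invr_ge0.
rewrite -mulr_sumr mulrCA; apply: ler_wpM2l.
  by rewrite divr_ge0 ?sqr_ge0// Kr_ge0.
rewrite big_split /= sum_edge_const (sum_Se_sq kE XO) mulrDr lerD2l.
have f0 : 0 <= f2 X by apply: sumr_ge0 => v _; exact: sqr_ge0.
have hN := N_ge.
have -> : N * (4 * f2 X / n%:R) = (4 * N / n%:R) * f2 X by ring.
apply: ler_wpM2r => //; rewrite ler_pdivlMr//; nra.
Qed.

End Drift.

(** * Drift of the sum of squared degrees *)

Section DegreeSquares.
Variables (R : realType) (n k : nat) (p beta b0 K : R).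
Implicit Types (X : graph n) (e f g : edge n) (u v : 'I_n).

Local Notation N := (#|{: edge n}|%:R : R).
Local Notation rate := (rate p beta).
Local Notation Y := (Y p).
Local Notation Dv := (Dv p).
Local Notation Se := (Se p).
Local Notation f2 := (f2 p).
Local Notation delta := (delta p).
Local Notation zeta := (zeta p).
Local Notation generator := (generator p beta).
Local Notation Rm := (Rm p beta).
Local Notation LY := (LY p beta).
Local Notation Ab := (Ab b0).
Local Notation Kr := (Kr b0).
Local Notation nR := (n%:R : R).

Hypothesis kE : k%:R = 'C(n, 2)%:R * p.
Hypothesis n1 : (1 < n)%N.
Hypothesis p01 : 0 < p < 1.
Hypothesis beta01 : 0 <= beta <= b0.
Hypothesis K0 : 0 <= K.

Definition D4 X : R := \sum_v Dv X v ^+ 4.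

Lemma D4_ge0 X : 0 <= D4 X.
Proof. by apply: sumr_ge0 => v _; rewrite exprn_even_ge0. Qed.

Lemma f2_ge0 X : 0 <= f2 X.
Proof. by apply: sumr_ge0 => v _; rewrite sqr_ge0. Qed.

Lemma sum_Se_pow4_le X : \sum_e Se X e ^+ 4 <= 8 * nR * D4 X.
Proof.
have h e : Se X e ^+ 4 <= 8 * \sum_v chi e v * Dv X v ^+ 4.
  have h1 := sqr_weighted_sum_le (fun v => Dv X v) (fun v => chi_ge0 R e v).
  have h2 := sqr_weighted_sum_le (fun v => Dv X v ^+ 2) (fun v => chi_ge0 R e v).
  rewrite sum_chi in h1 h2; rewrite -[4%N]/(2 * 2)%N exprM.
  have : (Se X e ^+ 2) ^+ 2 <= (2 * \sum_v chi e v * Dv X v ^+ 2) ^+ 2.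
    by rewrite lerXn2r ?nnegrE ?sqr_ge0// (le_trans _ h1)// sqr_ge0.
  move/le_trans; apply; rewrite exprMn.
  have -> : \sum_v chi e v * Dv X v ^+ 4 = \sum_v chi e v * (Dv X v ^+ 2) ^+ 2.
    by apply: eq_bigr => v _; rewrite -exprM.
  by lra.
apply: (le_trans (ler_sum _ (fun e _ => h e))).
rewrite -mulr_sumr -mulrA ler_wpM2l// exchange_big mulr_sumr.
apply: ler_sum => v _; rewrite -mulr_suml sum_chi_edge ler_wpM2r//.
  by rewrite exprn_even_ge0.
by lra.
Qed.

(** The source of [D4]: the remainder is quadratic in the field, so its square is quartic. *)
Lemma sum_Rm_sq_le X : X \in Omega n k -> f2 X <= K * nR ^+ 2 ->
  \sum_e Rm e X ^+ 2 <= 16 * Kr ^+ 2 * (D4 X / nR ^+ 3 + K ^+ 2).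
Proof.
move=> XO fK; have n2 := nR_ge2 R n1; have n0 : 0 < nR by lra.
have h e : Rm e X ^+ 2 <= 2 * Kr ^+ 2 / nR ^+ 4 * (Se X e ^+ 4 + 16 * K ^+ 2 * nR ^+ 2).
  have h1 := normr_Rm_le kE n1 p01 beta01 e XO.
  rewrite -[leLHS]real_normK ?num_real//.
  have h2 : `|Rm e X| <= Kr / nR ^+ 2 * (Se X e ^+ 2 + 4 * K * nR).
    apply: (le_trans h1); apply: ler_wpM2l; first by rewrite divr_ge0 ?sqr_ge0 ?Kr_ge0.
    by rewrite lerD2l ler_pdivrMr//; lra.
  apply: (@le_trans _ _ ((Kr / nR ^+ 2 * (Se X e ^+ 2 + 4 * K * nR)) ^+ 2)).
    by rewrite lerXn2r ?nnegrE// (le_trans _ h2).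
  have -> : (Kr / nR ^+ 2 * (Se X e ^+ 2 + 4 * K * nR)) ^+ 2 =
     Kr ^+ 2 / nR ^+ 4 * (Se X e ^+ 2 + 4 * K * nR) ^+ 2.
    by field; rewrite gt_eqF.
  have -> : Se X e ^+ 4 = (Se X e ^+ 2) ^+ 2 by rewrite -exprM.
  set a := Se X e ^+ 2.
  have -> : 2 * Kr ^+ 2 / nR ^+ 4 * (a ^+ 2 + 16 * K ^+ 2 * nR ^+ 2) =
    Kr ^+ 2 / nR ^+ 4 * (2 * (a ^+ 2 + 16 * K ^+ 2 * nR ^+ 2)) by ring.
  apply: ler_wpM2l; first by rewrite divr_ge0 ?sqr_ge0// exprn_ge0// ltW.
  by have := sqr_ge0 (a - 4 * K * nR); nra.
apply: (le_trans (ler_sum _ (fun e _ => h e))).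
rewrite -mulr_sumr big_split /= sum_edge_const.
have h4 := sum_Se_pow4_le X.
have hN := N_le R n1.
have -> : 16 * Kr ^+ 2 * (D4 X / nR ^+ 3 + K ^+ 2) =
   2 * Kr ^+ 2 / nR ^+ 4 * (8 * nR * D4 X + nR ^+ 2 / 2 * (16 * K ^+ 2 * nR ^+ 2)).
  by field; rewrite gt_eqF.
apply: ler_wpM2l.
  apply: divr_ge0; first by rewrite mulr_ge0 ?sqr_ge0.
  by rewrite exprn_ge0 ?ltW.
apply: lerD => //; apply: ler_wpM2r => //.
by rewrite !mulr_ge0 ?sqr_ge0.
Qed.

Lemma sum_delta_sq X : X \in Omega n k ->
  \sum_e \sum_f delta e f X ^+ 2 = 2 * N ^+ 2 * (p * (1 - p)).
Proof.
move=> XO.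
transitivity (\sum_e (N * (Y X e ^+ 2) + (N * (p * (1 - p)) + (- 2 * \sum_f Y X f) * Y X e))).
  apply: eq_bigr => e _.
  rewrite -(sum_Y_sq kE XO) -sum_edge_const mulr_sumr mulr_suml -!big_split /=.
  by apply: eq_bigr => f _; rewrite /delta; ring.
rewrite !big_split /= -!mulr_sumr (sum_Y_sq kE XO) sum_edge_const (sum_Y kE XO).
by ring.
Qed.

Lemma sum_overlap_le : \sum_(e : edge n) \sum_(f : edge n) overlap R e f <= nR ^+ 3.
Proof.
have n2 := nR_ge2 R n1.
have -> : \sum_(e : edge n) \sum_(f : edge n) overlap R e f = nR * (nR - 1) ^+ 2.
  rewrite /overlap; under eq_bigr do rewrite exchange_big; rewrite exchange_big /=.
  rewrite (eq_bigr (fun=> (nR - 1) ^+ 2)).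
    by rewrite sumr_const card_ord mulr_natl.
  move=> v _; under eq_bigr do rewrite -mulr_sumr sum_chi_edge.
  by rewrite -mulr_suml sum_chi_edge.
nra.
Qed.

Lemma generator_f2 X : X \in Omega n k -> generator f2 X =
  2 * (\sum_e Se X e * LY e X) + (2 * N)^-1 *
    \sum_e \sum_f rate e f X * (delta e f X ^+ 2 * (4 - 2 * overlap R e f)).
Proof.
move=> XO; rewrite -(sum_rate_delta _ _ n1 (Se X)) mulrCA -mulrDr; congr (_ * _).
rewrite mulr_sumr -big_split; apply: eq_bigr => e _ /=.
rewrite mulr_sumr -big_split; apply: eq_bigr => f _ /=.
by rewrite f2_swap; ring.
Qed.

(** The drift - Y_e contributes the rate 2; the field term subtracts 4 beta p (1-p) / n times sum_e
    S_e^2 = (n - 2) f2. *)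
Definition c_f2 : R := 2 * (1 - 2 * beta * (p * (1 - p)) * (nR - 2) / nR).

Definition err_f2 X : R := generator f2 X + c_f2 * f2 X - 4 * N * (p * (1 - p)).

Lemma err_f2E X : X \in Omega n k -> err_f2 X =
  4 * beta * f2 X ^+ 2 / (nR * N) + 2 * (\sum_e Se X e * Rm e X) +
  (2 * N)^-1 * \sum_e \sum_f
     delta e f X ^+ 2 * (rate e f X * (4 - 2 * overlap R e f) - 4).
Proof.
move=> XO; have N0 := N_gt0 R n1; have n2 := nR_ge2 R n1.
rewrite /err_f2 (generator_f2 XO).
have -> : \sum_e Se X e * LY e X = - f2 X + beta / nR * (2 * (p * (1 - p)) * (nR - 2) * f2 X
    + 2 * f2 X ^+ 2 / N) + \sum_e Se X e * Rm e X.
  transitivity (\sum_e ((-1 + beta / nR * (2 * f2 X / N)) * (Y X e * Se X e) +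
     (beta / nR * (2 * (p * (1 - p)))) * Se X e ^+ 2 + Se X e * Rm e X)).
    by apply: eq_bigr => e _; rewrite (LY_drift beta kE n1 e XO); ring.
  rewrite !big_split /= -!mulr_sumr sum_Y_Se (sum_Se_sq kE XO); ring.
have -> : \sum_e \sum_f delta e f X ^+ 2 * (rate e f X * (4 - 2 * overlap R e f) - 4) =
    \sum_e \sum_f rate e f X * (delta e f X ^+ 2 * (4 - 2 * overlap R e f))
    - 4 * \sum_e \sum_f delta e f X ^+ 2.
  rewrite mulr_sumr -sumrB; apply: eq_bigr => e _.
  by rewrite mulr_sumr -sumrB; apply: eq_bigr => f _; ring.
rewrite (sum_delta_sq XO) /c_f2; field.
by rewrite !gt_eqF//; lra.
Qed.

(** Stated for a general weight [q] so that it covers q = [Se] here and q = [C2] for the cubic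
    trace; both have square sums O(n^3) on the good event. *)
Lemma sum_Se_Rm_sq_le (q : edge n -> R) Q X : X \in Omega n k ->
  f2 X <= K * nR ^+ 2 -> 0 <= Q -> \sum_e q e ^+ 2 <= Q * nR ^+ 3 ->
  (\sum_e q e * Rm e X) ^+ 2 <= 16 * Q * Kr ^+ 2 * (1 + K ^+ 2) * (nR ^+ 3 + D4 X).
Proof.
move=> XO fK Q0 qQ; have n2 := nR_ge2 R n1; have n0 : 0 < nR by lra.
apply: (le_trans (cauchy_schwarz _ _)).
have h := sum_Rm_sq_le XO fK.
have s0 (q' : edge n -> R) : 0 <= \sum_e q' e ^+ 2 by apply: sumr_ge0 => e _; exact: sqr_ge0.
apply: (le_trans (ler_pM (s0 _) (s0 _) qQ h)).
have -> : Q * nR ^+ 3 * (16 * Kr ^+ 2 * (D4 X / nR ^+ 3 + K ^+ 2)) =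
   16 * Q * Kr ^+ 2 * (D4 X + K ^+ 2 * nR ^+ 3) by field; rewrite gt_eqF.
rewrite -[leRHS]mulrA; apply: ler_wpM2l.
  by apply: mulr_ge0; rewrite ?sqr_ge0 ?mulr_ge0.
have d0 := D4_ge0 X; have n3 : 0 <= nR ^+ 3 by rewrite exprn_ge0// ltW.
have := sqr_ge0 K; nra.
Qed.

(** With its mean value 4 subtracted, the quadratic variation has two errors. The deviation of the
    rates from 1 contributes (1/n) sum_e |S_e|, which is O(n^(3/2)) by Cauchy-Schwarz; the overlaps
    sum to at most n^3 and, divided by N, contribute O(n). *)
Lemma err_f2_exchange_le X : X \in Omega n k -> f2 X <= K * nR ^+ 2 ->
  ((2 * N)^-1 * \sum_e \sum_f
     delta e f X ^+ 2 * (rate e f X * (4 - 2 * overlap R e f) - 4)) ^+ 2 <=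
  (64 * b0 ^+ 2 * Ab ^+ 2 * K + 32 * Ab ^+ 2) * nR ^+ 3.
Proof.
move=> XO fK; have n2 := nR_ge2 R n1; have n0 : 0 < nR by lra.
have N0 := N_gt0 R n1; have A1 := Ab_ge1 beta01.
have [b1 b2] := andP beta01.
set T := _ * _.
have Tle : `|T| <= 8 * b0 * Ab / nR * (\sum_e `|Se X e|) + 4 * Ab * nR.
  rewrite /T normrM ger0_norm ?invr_ge0 ?mulr_ge0 ?(ltW N0)// [leLHS]mulrC ler_pdivrMr ?mulr_gt0//.
  apply: (le_trans (ler_norm_sum _ _ _)).
  apply: (@le_trans _ _ (\sum_e \sum_f (8 * b0 * Ab / nR * `|Se X e| +
     8 * b0 * Ab / nR * `|Se X f| + 2 * Ab * overlap R e f))).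
    apply: ler_sum => e _; apply: (le_trans (ler_norm_sum _ _ _)).
    apply: ler_sum => f _; rewrite normrM ger0_norm ?sqr_ge0//.
    apply: (@le_trans _ _ `|rate e f X * (4 - 2 * overlap R e f) - 4|).
      by rewrite ler_piMl// delta_sq_le1.
    have -> : rate e f X * (4 - 2 * overlap R e f) - 4 =
      4 * (rate e f X - 1) - 2 * (overlap R e f * rate e f X) by ring.
    apply: (le_trans (ler_normB _ _)); apply: lerD.
      rewrite normrM ger0_norm//.
      by have := normr_rate_sub1_le n1 p01 beta01 e f X; lra.
    rewrite ger0_norm ?mulr_ge0 ?overlap_ge0 ?rate_ge0//.
    have := ler_wpM2l (overlap_ge0 R e f) (rate_le n1 p01 beta01 e f X); lra.
  under eq_bigr do rewrite !big_split /= sum_edge_const -!mulr_sumr.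
  rewrite !big_split /= sum_edge_const -!mulr_sumr.
  have -> : (8 * b0 * Ab / nR * (\sum_e `|Se X e|) + 4 * Ab * nR) * (2 * N) =
    N * (8 * b0 * Ab / nR * \sum_e `|Se X e|) + N * (8 * b0 * Ab / nR * \sum_e `|Se X e|)
    + 2 * Ab * (4 * nR * N) by ring.
  apply: lerD; first by rewrite mulr_sumr mulr_sumr.
  apply: ler_wpM2l; first by rewrite mulr_ge0//; lra.
  apply: (le_trans sum_overlap_le).
  have := N_ge R n1; nra.
have s1 : (\sum_e `|Se X e|) ^+ 2 <= nR ^+ 5 * K / 2.
  have := cauchy_schwarz (fun e => `|Se X e|) (fun=> 1).
  under eq_bigr do rewrite mulr1; move/le_trans; apply.
  rewrite expr1n sum_edge_const mulr1.
  under eq_bigr do rewrite real_normK ?num_real//.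
  rewrite (sum_Se_sq kE XO).
  have f0 := f2_ge0 X.
  have h1 : (nR - 2) * f2 X <= nR * (K * nR ^+ 2) by apply: ler_pM => //; lra.
  have -> : nR ^+ 5 * K / 2 = nR * (K * nR ^+ 2) * (nR ^+ 2 / 2) by ring.
  by apply: ler_pM => //; rewrite ?N_le// ?mulr_ge0//; lra.
rewrite -[leLHS]real_normK ?num_real//.
apply: (@le_trans _ _ ((8 * b0 * Ab / nR * (\sum_e `|Se X e|) + 4 * Ab * nR) ^+ 2)).
  by rewrite lerXn2r ?nnegrE// (le_trans _ Tle).
set a := 8 * b0 * Ab / nR * _; set b := 4 * Ab * nR.
apply: (@le_trans _ _ (2 * a ^+ 2 + 2 * b ^+ 2)).
  by have := sqr_ge0 (a - b); nra.
rewrite [leRHS]mulrDl; apply: lerD.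
  rewrite /a exprMn.
  have -> : 64 * b0 ^+ 2 * Ab ^+ 2 * K * nR ^+ 3 =
     2 * ((8 * b0 * Ab / nR) ^+ 2 * (nR ^+ 5 * K / 2)) by field; rewrite gt_eqF.
  by rewrite !ler_wpM2l// sqr_ge0.
have -> : 2 * b ^+ 2 = 32 * Ab ^+ 2 * nR ^+ 2 by rewrite /b; ring.
apply: ler_wpM2l; first by rewrite mulr_ge0// sqr_ge0.
by rewrite ler_weXn2l//; lra.
Qed.

Definition C_f2 : R := 3 * (256 * b0 ^+ 2 * K ^+ 4 + 64 * K * Kr ^+ 2 * (1 + K ^+ 2) +
  (64 * b0 ^+ 2 * Ab ^+ 2 * K + 32 * Ab ^+ 2)).

Lemma err_f2_sq_le X : X \in Omega n k -> f2 X <= K * nR ^+ 2 ->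
  err_f2 X ^+ 2 <= C_f2 * (nR ^+ 3 + D4 X).
Proof.
move=> XO fK; have n2 := nR_ge2 R n1; have n0 : 0 < nR by lra.
have N0 := N_gt0 R n1; have [b1 b2] := andP beta01.
rewrite (err_f2E XO); apply: (le_trans (sqr_sum3_le _ _ _)).
rewrite /C_f2 -[leRHS]mulrA ler_pM2l// [leRHS]mulrDl [in leRHS]mulrDl.
have d0 := D4_ge0 X; have n3 : 0 <= nR ^+ 3 by rewrite exprn_ge0// ltW.
have f0 := f2_ge0 X.
apply: lerD; last first.
  apply: (le_trans (err_f2_exchange_le XO fK)); apply: ler_wpM2l; last by lra.
  by nonneg.
apply: lerD.
  have h1 : 4 * beta * f2 X ^+ 2 / (nR * N) <= 16 * b0 * K ^+ 2 * nR.
    rewrite ler_pdivrMr ?mulr_gt0//.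
    apply: (@le_trans _ _ (4 * b0 * (K * nR ^+ 2) ^+ 2)).
      by apply: ler_pM; rewrite ?mulr_ge0 ?sqr_ge0 ?ler_pM2l// lerXn2r ?nnegrE// (le_trans f0).
    have -> : 4 * b0 * (K * nR ^+ 2) ^+ 2 = 16 * b0 * K ^+ 2 * nR * (nR * (nR ^+ 2 / 4)) by field.
    apply: ler_wpM2l; first by nonneg.
    by rewrite ler_pM2l// N_ge.
  apply: (@le_trans _ _ ((16 * b0 * K ^+ 2 * nR) ^+ 2)).
    have q0 : 0 <= 4 * beta * f2 X ^+ 2 / (nR * N).
      by nonneg.
    by rewrite lerXn2r ?nnegrE// (le_trans q0).
  have -> : (16 * b0 * K ^+ 2 * nR) ^+ 2 = 256 * b0 ^+ 2 * K ^+ 4 * nR ^+ 2 by ring.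
  apply: ler_wpM2l; first by nonneg.
  have : nR ^+ 2 <= nR ^+ 3 by rewrite ler_weXn2l//; lra.
  by lra.
rewrite exprMn.
have sq : \sum_e Se X e ^+ 2 <= K * nR ^+ 3.
  rewrite (sum_Se_sq kE XO); have -> : K * nR ^+ 3 = nR * (K * nR ^+ 2) by ring.
  by apply: ler_pM => //; lra.
have := sum_Se_Rm_sq_le XO fK K0 sq; lra.
Qed.

Lemma f2_le_cube X : f2 X <= nR ^+ 3.
Proof.
apply: (@le_trans _ _ (\sum_(v < n) nR ^+ 2)).
  apply: ler_sum => v _; rewrite -[leLHS]real_normK ?num_real//.
  by rewrite lerXn2r ?nnegrE// normr_Dv_le.
by rewrite sumr_const card_ord -[_ *+ n]mulr_natl -exprS.
Qed.

(** A polynomial bound valid for every graph, for use on the bad event. *)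
Lemma normr_generator_le (F : graph n -> R) L X : (forall Z, `|F Z| <= L) ->
  `|generator F X| <= Ab * L * nR ^+ 2.
Proof.
move=> FL; have N0 := N_gt0 R n1; have A1 := Ab_ge1 beta01.
have L0 : 0 <= L := le_trans (normr_ge0 _) (FL X).
rewrite /generator normrM ger0_norm ?invr_ge0 ?mulr_ge0 ?(ltW N0)//.
rewrite [leLHS]mulrC ler_pdivrMr ?mulr_gt0//.
apply: (le_trans (ler_norm_sum _ _ _)).
apply: (@le_trans _ _ (\sum_(e : edge n) \sum_(f : edge n) (Ab * (2 * L)))).
  apply: ler_sum => e _; apply: (le_trans (ler_norm_sum _ _ _)).
  apply: ler_sum => f _; rewrite normrM ger0_norm ?rate_ge0//.
  apply: ler_pM; rewrite ?rate_ge0 ?rate_le//.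
  apply: (le_trans (ler_normB _ _)).
  by have := FL X; have := FL (swap e f X); lra.
rewrite !sum_edge_const.
have -> : N * (N * (Ab * (2 * L))) = Ab * L * N * (2 * N) by ring.
apply: ler_wpM2r; first by nonneg.
apply: ler_wpM2l; first by nonneg.
by have := N_le R n1; have := sqr_ge0 nR; lra.
Qed.

End DegreeSquares.

(** * Triangles as a cubic trace *)

Section TrilinearTrace.
Variables (R : realType) (n : nat).
Implicit Types (A B C : 'I_n -> 'I_n -> R).

(** The trace of the matrix product A B C. *)
Definition tri A B C : R := \sum_u \sum_v \sum_w A u v * B v w * C w u.

Lemma tri_cyc A B C : tri A B C = tri B C A.
Proof.
rewrite /tri [RHS](eq_bigr _ (fun u _ => exchange_big _ _ _ _ _ _)) /=.
rewrite [RHS]exchange_big; apply: eq_bigr => u _; apply: eq_bigr => v _.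
by apply: eq_bigr => w _; ring.
Qed.

Lemma eq_tri A A' B B' C C' : A =2 A' -> B =2 B' -> C =2 C' ->
  tri A B C = tri A' B' C'.
Proof.
move=> hA hB hC; apply: eq_bigr => u _; apply: eq_bigr => v _.
by apply: eq_bigr => w _; rewrite hA hB hC.
Qed.

Lemma triD A A' B C : tri (fun u v => A u v + A' u v) B C = tri A B C + tri A' B C.
Proof.
rewrite /tri -big_split; apply: eq_bigr => u _; rewrite -big_split.
apply: eq_bigr => v _; rewrite -big_split; apply: eq_bigr => w _ /=; ring.
Qed.

Lemma triZ c A B C : tri (fun u v => c * A u v) B C = c * tri A B C.
Proof.
rewrite /tri mulr_sumr; apply: eq_bigr => u _; rewrite mulr_sumr.
apply: eq_bigr => v _; rewrite mulr_sumr; apply: eq_bigr => w _; ring.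
Qed.

Lemma tri_sumr (I : finType) A B (C : I -> 'I_n -> 'I_n -> R) :
  tri A B (fun u v => \sum_i C i u v) = \sum_i tri A B (C i).
Proof.
rewrite /tri [RHS]exchange_big; apply: eq_bigr => u _; rewrite [RHS]exchange_big.
apply: eq_bigr => v _; rewrite [RHS]exchange_big; apply: eq_bigr => w _.
by rewrite mulr_sumr.
Qed.

Lemma tri_cube A B c (S := fun u v => A u v + c * B u v) :
  tri S S S = tri A A A + 3 * c * tri A A B + 3 * c ^+ 2 * tri A B B + c ^+ 3 * tri B B B.
Proof.
have lin Z Z' : tri S Z Z' = tri A Z Z' + c * tri B Z Z' by rewrite triD triZ.
have lin2 Z Z' : tri Z S Z' = tri Z A Z' + c * tri Z B Z'.
  by rewrite (tri_cyc Z S) lin -(tri_cyc Z A) -(tri_cyc Z B).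
have lin3 Z Z' : tri Z Z' S = tri Z Z' A + c * tri Z Z' B.
  by rewrite -(tri_cyc S) lin (tri_cyc A) (tri_cyc B).
rewrite lin !lin2 !lin3.
rewrite (tri_cyc B A A) (tri_cyc A B A) (tri_cyc B A A) (tri_cyc B B A) (tri_cyc B A B).
by ring.
Qed.

End TrilinearTrace.

Section Triangles.
Variables (R : realType) (n k : nat) (p beta b0 K : R).
Implicit Types (X : graph n) (e f g : edge n) (u v w : 'I_n).

Local Notation N := (#|{: edge n}|%:R : R).
Local Notation rate := (rate p beta).
Local Notation Y := (Y p).
Local Notation Dv := (Dv p).
Local Notation Se := (Se p).
Local Notation f2 := (f2 p).
Local Notation delta := (delta p).
Local Notation generator := (generator p beta).
Local Notation Rm := (Rm p beta).
Local Notation LY := (LY p beta).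
Local Notation Ab := (Ab b0).
Local Notation Kr := (Kr b0).
Local Notation nR := (n%:R : R).
Local Notation D4 := (D4 p).
Local Notation M := (@M R n).

Hypothesis kE : k%:R = 'C(n, 2)%:R * p.
Hypothesis n1 : (1 < n)%N.
Hypothesis p01 : 0 < p < 1.
Hypothesis beta01 : 0 <= beta <= b0.
Hypothesis K0 : 0 <= K.

Definition ym X u v : R := \sum_e M e u v * Y X e.
Definition Jm u v : R := (u != v)%:R.

Lemma edge_of_pair u v : u != v ->
  exists2 e : edge n, val e = [set u; v]%SET &
    forall Z : edge n -> R, \sum_g M g u v * Z g = Z e.
Proof.
move=> uv; have E : #|[set u; v]%SET| == 2 by rewrite cards2 uv.
exists (Sub [set u; v]%SET E); first by rewrite SubK.
move=> Z; rewrite (bigD1 (Sub [set u; v]%SET E : edge n))//= big1 ?addr0.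
  by rewrite /M uv SubK eqxx mul1r.
by move=> e; rewrite -val_eqE /= /M uv => /negbTE ->; rewrite mul0r.
Qed.

Lemma ymC X u v : ym X u v = ym X v u.
Proof. by apply: eq_bigr => e _; rewrite MC. Qed.

Lemma ym_diag X u : ym X u u = 0.
Proof. by apply: big1 => e _; rewrite M_diag mul0r. Qed.

Lemma sum_ym_row X u : \sum_v ym X u v = Dv X u.
Proof.
rewrite exchange_big; apply: eq_bigr => e _.
by rewrite -mulr_suml sum_M_row.
Qed.

Lemma ym_sq X u v : ym X u v ^+ 2 = (1 - 2 * p) * ym X u v + p * (1 - p) * Jm u v.
Proof.
rewrite /Jm; have [<-|uv] := eqVneq u v; first by rewrite ym_diag expr0n /=; ring.
by have [e _ eE] := edge_of_pair uv; rewrite /ym eE Y_sq /=; ring.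
Qed.

Lemma normr_ym_le1 X u v : `|ym X u v| <= 1.
Proof.
have [<-|uv] := eqVneq u v; first by rewrite ym_diag normr0.
by have [e _ eE] := edge_of_pair uv; rewrite /ym eE normr_Y_le1.
Qed.

Lemma ym_swap e f X u v :
  ym (swap e f X) u v = ym X u v + - delta e f X * (M e u v - M f u v).
Proof. by rewrite /ym sum_swap mulNr. Qed.

Definition tr3 X : R := tri (ym X) (ym X) (ym X).
(** One third of the gradient of tr Y^3 along [e]: twice the entry of Y^2 at the endpoints of
    [e]. *)
Definition C2 X e : R := tri (ym X) (ym X) (M e).
(** The second-order coefficient tr (Y (M_e - M_f)^2) of a swap; it vanishes unless [e] and [f]
    share a vertex. *)
Definition kappa X e f : R :=
  tri (ym X) (fun u v => M e u v - M f u v) (fun u v => M e u v - M f u v).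

(** The square of a one-edge matrix is diagonal, hence invisible to matrices with zero diagonal such
    as [ym]. *)
Lemma M_mul0 e u v w : u != v -> M e v w * M e w u = 0.
Proof.
rewrite /M => uv; case: (boolP (v != w)) => [vw|]; last by rewrite mul0r.
have [eE|] := eqVneq (val e) [set v; w]%SET; last by rewrite mul0r.
have -> : (val e == [set w; u]%SET) = false.
  by rewrite eE set2_eq// eq_sym (negbTE vw) (negbTE uv) andbF.
by rewrite andbF mulr0.
Qed.

Lemma tri_M_M A e : (forall u, A u u = 0) -> tri A (M e) (M e) = 0.
Proof.
move=> A0; apply: big1 => u _; apply: big1 => v _; apply: big1 => w _.
have [<-|uv] := eqVneq u v; first by rewrite A0 !mul0r.
by rewrite -mulrA M_mul0// mulr0.
Qed.

Lemma triB_mid (A B B' C : 'I_n -> 'I_n -> R) :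
  tri A (fun u v => B u v - B' u v) C = tri A B C - tri A B' C.
Proof.
rewrite /tri -sumrB; apply: eq_bigr => u _; rewrite -sumrB.
apply: eq_bigr => v _; rewrite -sumrB; apply: eq_bigr => w _ /=; ring.
Qed.

Lemma triB_last (A B C C' : 'I_n -> 'I_n -> R) :
  tri A B (fun u v => C u v - C' u v) = tri A B C - tri A B C'.
Proof.
rewrite /tri -sumrB; apply: eq_bigr => u _; rewrite -sumrB.
apply: eq_bigr => v _; rewrite -sumrB; apply: eq_bigr => w _ /=; ring.
Qed.

Lemma kappaE X e f :
  kappa X e f = - (tri (ym X) (M e) (M f) + tri (ym X) (M f) (M e)).
Proof.
rewrite /kappa triB_mid !triB_last !tri_M_M; try exact: ym_diag.
by ring.
Qed.

Lemma tr3_swap e f X : tr3 (swap e f X) =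
  tr3 X + - (3 * delta e f X) * (C2 X e - C2 X f) + 3 * delta e f X ^+ 2 * kappa X e f.
Proof.
pose Kf u v := M e u v - M f u v.
rewrite /tr3 (eq_tri (ym_swap e f X) (ym_swap e f X) (ym_swap e f X)) tri_cube.
rewrite -/(kappa X e f) triB_last -/(C2 X e) -/(C2 X f).
have -> : tri Kf Kf Kf = 0.
  (* Two edges contain no triangle, so the cubic term of the expansion is zero. *)
  have md g u : M g u u = 0 by rewrite M_diag.
  have KE : Kf =2 (fun u v => M e u v + -1 * M f u v).
    by move=> u v; rewrite mulN1r.
  rewrite (eq_tri KE KE KE) tri_cube (tri_cyc (M e) (M e)) (tri_cyc (M e) (M f)).
  by rewrite !(tri_M_M _ (md _)); ring.
by ring.
Qed.

Lemma sum_M_mul e f :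
  \sum_u \sum_v \sum_w M e v w * M f w u = overlap R e f.
Proof.
rewrite exchange_big /=; under eq_bigr do rewrite exchange_big /=.
rewrite exchange_big /=; apply: eq_bigr => w _.
rewrite -(sum_M_row R e w) -(sum_M_row R f w) mulr_suml; apply: eq_bigr => v _.
by rewrite mulr_sumr; apply: eq_bigr => u _; rewrite MC.
Qed.

Lemma normr_tri_M_le X e f : `|tri (ym X) (M e) (M f)| <= overlap R e f.
Proof.
rewrite -sum_M_mul; apply: (le_trans (ler_norm_sum _ _ _)); apply: ler_sum => u _.
apply: (le_trans (ler_norm_sum _ _ _)); apply: ler_sum => v _.
apply: (le_trans (ler_norm_sum _ _ _)); apply: ler_sum => w _.
rewrite -mulrA normrM [X in _ * X]ger0_norm ?mulr_ge0 ?M_ge0//.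
by rewrite ler_piMl ?mulr_ge0 ?M_ge0 ?normr_ym_le1.
Qed.

Lemma normr_kappa_le X e f : `|kappa X e f| <= 2 * overlap R e f.
Proof.
rewrite kappaE normrN; apply: (le_trans (ler_normD _ _)).
have := normr_tri_M_le X e f; have := normr_tri_M_le X f e.
by rewrite (overlapC R f e); lra.
Qed.

Lemma generator_tr3 X : generator tr3 X = 3 * (\sum_e C2 X e * LY e X) +
  (2 * N)^-1 * \sum_e \sum_f rate e f X * (3 * delta e f X ^+ 2 * kappa X e f).
Proof.
rewrite -(sum_rate_delta _ _ n1 (C2 X)) mulrCA -mulrDr; congr (_ * _).
rewrite mulr_sumr -big_split; apply: eq_bigr => e _ /=.
rewrite mulr_sumr -big_split; apply: eq_bigr => f _ /=.
by rewrite tr3_swap; ring.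
Qed.

Lemma sum_C2 X (q : edge n -> R) :
  \sum_e C2 X e * q e = tri (ym X) (ym X) (fun u v => \sum_e M e u v * q e).
Proof.
rewrite tri_sumr; apply: eq_bigr => e _.
rewrite /C2 /tri mulr_suml; apply: eq_bigr => u _; rewrite mulr_suml.
apply: eq_bigr => v _; rewrite mulr_suml; apply: eq_bigr => w _; ring.
Qed.

Lemma sum_C2_Y X : \sum_e C2 X e * Y X e = tr3 X.
Proof. by rewrite sum_C2. Qed.

Lemma sum_M_Se X u v : \sum_e M e u v * Se X e = Jm u v * (Dv X u + Dv X v).
Proof.
rewrite /Jm; have [<-|uv] := eqVneq u v.
  by rewrite mul0r big1// => e _; rewrite M_diag mul0r.
have [e eE ->] := edge_of_pair uv; rewrite /= mul1r /Se (bigD1 u)//=.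
rewrite (bigD1 v) ?(eq_sym v)//= big1 ?addr0.
  by rewrite /chi eE !inE !eqxx orbT !mul1r.
move=> w /andP[wu wv].
by rewrite /chi eE !inE (negbTE wu) (negbTE wv) mul0r.
Qed.

Definition bil X (x z : 'I_n -> R) : R := \sum_u x u * \sum_v ym X u v * z v.

Lemma sum_Jm_row (F : 'I_n -> R) u : \sum_w F w * Jm w u = \sum_w F w - F u.
Proof.
rewrite (bigD1 u)//= [in RHS](bigD1 u)//= /Jm eqxx mulr0 add0r addrC addrK.
by apply: eq_bigr => w wu; rewrite wu mulr1.
Qed.

(** Against the matrix with entries D_u + D_w, the trace of Y^2 gives twice D^T Y D, as the row sums
    of Y are the D_v. The diagonal has to be removed: (Y^2)_uu is affine in D_u by [ym_sq], and its
    constant part vanishes because the D_u sum to 0. *)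
Lemma sum_C2_Se X : X \in Omega n k -> \sum_e C2 X e * Se X e =
  2 * bil X (Dv X) (Dv X) - 2 * (1 - 2 * p) * f2 X.
Proof.
move=> XO; rewrite sum_C2.
transitivity (\sum_u \sum_v (ym X u v * (Dv X v * Dv X u) +
    (ym X u v * \sum_w ym X v w * Dv X w) - 2 * Dv X u * ym X u v ^+ 2)).
  apply: eq_bigr => u _; apply: eq_bigr => v _.
  transitivity (\sum_w (ym X u v * ym X v w * (Dv X w + Dv X u)) * Jm w u).
    by apply: eq_bigr => w _; rewrite sum_M_Se; ring.
  rewrite sum_Jm_row (ymC X v u).
  have -> : \sum_w ym X u v * ym X v w * (Dv X w + Dv X u) =
      ym X u v * (Dv X v * Dv X u) + ym X u v * \sum_w ym X v w * Dv X w.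
    transitivity (\sum_w (ym X u v * Dv X u * ym X v w +
        ym X u v * (ym X v w * Dv X w))); first by apply: eq_bigr => w _; ring.
    by rewrite big_split /= -!mulr_sumr sum_ym_row; ring.
  by ring.
have -> : \sum_u \sum_v (ym X u v * (Dv X v * Dv X u) +
    (ym X u v * \sum_w ym X v w * Dv X w) - 2 * Dv X u * ym X u v ^+ 2) =
    bil X (Dv X) (Dv X) + bil X (Dv X) (Dv X)
    - 2 * \sum_u Dv X u * \sum_v ym X u v ^+ 2.
  under eq_bigr do rewrite sumrB big_split /=.
  rewrite sumrB big_split /=; congr (_ + _ - _).
  - apply: eq_bigr => u _; rewrite mulr_sumr; apply: eq_bigr => v _; ring.
  - rewrite exchange_big; apply: eq_bigr => u _ /=; rewrite -mulr_suml; congr (_ * _).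
    by rewrite -sum_ym_row; apply: eq_bigr => v _; rewrite ymC.
  - rewrite [RHS]mulr_sumr; apply: eq_bigr => u _.
    by rewrite mulrA [RHS]mulr_sumr.
have sq u : \sum_v ym X u v ^+ 2 = (1 - 2 * p) * Dv X u + p * (1 - p) * (nR - 1).
  under eq_bigr do rewrite ym_sq.
  rewrite big_split /= -!mulr_sumr sum_ym_row; congr (_ + _ * _).
  rewrite (bigD1 u)//= /Jm eqxx add0r; under eq_bigr => v vu do rewrite eq_sym vu.
  rewrite sumr_const cardC1 card_ord -subn1 natrB//.
  by rewrite ltnW.
under [X in _ - 2 * X]eq_bigr do rewrite sq mulrDr.
rewrite big_split /= -mulr_suml (sum_Dv kE XO) mul0r addr0.
have -> : \sum_u Dv X u * ((1 - 2 * p) * Dv X u) = (1 - 2 * p) * f2 X.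
  by rewrite mulr_sumr; apply: eq_bigr => u _; ring.
by ring.
Qed.

(** Each of the three factors of tr Y^3 relaxes at rate 1. The whole field contribution goes into
    the error, since the operator norm makes it O(n^(3/2)). *)
Definition err_tr3 X : R := generator tr3 X + 3 * tr3 X.

Lemma err_tr3E X : X \in Omega n k -> err_tr3 X =
  3 * beta / nR * (4 * (p * (1 - p)) * bil X (Dv X) (Dv X)
     - 4 * (p * (1 - p)) * (1 - 2 * p) * f2 X + 2 * f2 X / N * tr3 X)
  + 3 * (\sum_e C2 X e * Rm e X) +
  (2 * N)^-1 * \sum_e \sum_f rate e f X * (3 * delta e f X ^+ 2 * kappa X e f).
Proof.
move=> XO; rewrite /err_tr3 generator_tr3.
have -> : \sum_e C2 X e * LY e X = - tr3 X + beta / nR * (2 * (p * (1 - p)) *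
    (\sum_e C2 X e * Se X e) + 2 * f2 X / N * tr3 X) + \sum_e C2 X e * Rm e X.
  transitivity (\sum_e ((-1 + beta / nR * (2 * f2 X / N)) * (C2 X e * Y X e) +
     (beta / nR * (2 * (p * (1 - p)))) * (C2 X e * Se X e) + C2 X e * Rm e X)).
    by apply: eq_bigr => e _; rewrite (LY_drift beta kE n1 e XO); ring.
  rewrite !big_split /= -!mulr_sumr sum_C2_Y; ring.
by rewrite (sum_C2_Se XO); ring.
Qed.

End Triangles.

(** * Bounds for the cubic trace under an operator-norm condition *)

Section TriangleBounds.
Variables (R : realType) (n k : nat) (p beta b0 K : R).
Implicit Types (X : graph n) (e f g : edge n) (u v w : 'I_n).

Local Notation N := (#|{: edge n}|%:R : R).
Local Notation rate := (rate p beta).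
Local Notation Y := (Y p).
Local Notation Dv := (Dv p).
Local Notation Se := (Se p).
Local Notation f2 := (f2 p).
Local Notation delta := (delta p).
Local Notation generator := (generator p beta).
Local Notation Rm := (Rm p beta).
Local Notation Ab := (Ab b0).
Local Notation Kr := (Kr b0).
Local Notation nR := (n%:R : R).
Local Notation D4 := (D4 p).
Local Notation M := (@M R n).
Local Notation ym := (ym p).
Local Notation tr3 := (tr3 p).
Local Notation C2 := (C2 p).
Local Notation kappa := (kappa p).
Local Notation bil := (bil p).
Local Notation err_tr3 := (err_tr3 p beta).

Hypothesis kE : k%:R = 'C(n, 2)%:R * p.
Hypothesis n1 : (1 < n)%N.
Hypothesis p01 : 0 < p < 1.
Hypothesis beta01 : 0 <= beta <= b0.
Hypothesis K0 : 0 <= K.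

(** The squared operator norm of the centred adjacency matrix is at most K n, phrased through the
    bilinear form, to which the net argument applies directly. *)
Definition opnorm_le X : Prop := forall x z : 'I_n -> R,
  bil X x z ^+ 2 <= K * nR * (\sum_u x u ^+ 2) * (\sum_u z u ^+ 2).

Lemma opnorm_le_apply X (z : 'I_n -> R) : opnorm_le X ->
  \sum_u (\sum_v ym X u v * z v) ^+ 2 <= K * nR * \sum_u z u ^+ 2.
Proof.
move=> op; set x := fun u => \sum_v ym X u v * z v.
have s0 (a : 'I_n -> R) : 0 <= \sum_u a u ^+ 2 by apply: sumr_ge0 => u _; exact: sqr_ge0.
have := op x z; have -> : bil X x z = \sum_u x u ^+ 2.
  by apply: eq_bigr => u _; rewrite expr2.
have [->|x0] := eqVneq (\sum_u x u ^+ 2) 0; first by move=> _; rewrite !mulr_ge0.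
have x1 : 0 < \sum_u x u ^+ 2 by rewrite lt_neqAle eq_sym x0 s0.
by rewrite expr2 [X in _ <= X]mulrAC ler_pM2r.
Qed.

(** Up to the factor 2 this is the squared Frobenius norm of Y^2, bounded column by column: each
    column of Y has squared norm at most n, and applying Y multiplies this by at most K n. *)
Lemma sum_C2_sq_le X : opnorm_le X -> \sum_e C2 X e ^+ 2 <= 2 * K * nR ^+ 3.
Proof.
move=> op; have n2 := nR_ge2 R n1; have n0 : 0 < nR by lra.
pose P u w := \sum_v ym X u v * ym X v w.
have C2E e : C2 X e = \sum_(i : 'I_n * 'I_n) M e i.2 i.1 * P i.1 i.2.
  rewrite -(pair_bigA _ (fun u w => M e w u * P u w)) /=.
  apply: eq_bigr => u _; rewrite exchange_big; apply: eq_bigr => w _ /=.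
  by rewrite /P mulr_sumr; apply: eq_bigr => v _; ring.
have h e : C2 X e ^+ 2 <= 2 * \sum_(i : 'I_n * 'I_n) M e i.2 i.1 * P i.1 i.2 ^+ 2.
  rewrite C2E; apply: (le_trans (sqr_weighted_sum_le _ _)).
    by move=> i; exact: M_ge0.
  apply: ler_wpM2r; first by apply: sumr_ge0 => i _; rewrite mulr_ge0 ?M_ge0 ?sqr_ge0.
  rewrite -(pair_bigA _ (fun u w => M e w u)) /= exchange_big /=.
  by under eq_bigr do rewrite sum_M_row; rewrite sum_chi.
apply: (le_trans (ler_sum _ (fun e _ => h e))).
rewrite -mulr_sumr -[in leRHS]mulrA ler_wpM2l// exchange_big /=.
apply: (@le_trans _ _ (\sum_(i : 'I_n * 'I_n) P i.1 i.2 ^+ 2)).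
  apply: ler_sum => i _; rewrite -mulr_suml sum_M_edge ler_piMl ?sqr_ge0//.
  by rewrite lern1 leq_b1.
rewrite -(pair_bigA _ (fun u w => P u w ^+ 2)) /= exchange_big /=.
apply: (@le_trans _ _ (\sum_(w < n) K * nR * nR)).
  apply: ler_sum => w _; apply: (le_trans (opnorm_le_apply (fun v => ym X v w) op)).
  apply: ler_wpM2l; first by nonneg.
  apply: (@le_trans _ _ (\sum_(u < n) 1)).
    apply: ler_sum => u _; rewrite -real_normK ?num_real// expr_le1//.
    exact: normr_ym_le1.
  by rewrite sumr_const card_ord.
rewrite sumr_const card_ord -[_ *+ n]mulr_natl.
by rewrite le_eqVlt; apply/orP; left; apply/eqP; ring.
Qed.

Lemma tr3_sq_le X : X \in Omega n k -> opnorm_le X -> tr3 X ^+ 2 <= K * nR ^+ 5.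
Proof.
move=> XO op; have n2 := nR_ge2 R n1; have n0 : 0 < nR by lra.
rewrite -sum_C2_Y; apply: (le_trans (cauchy_schwarz _ _)).
have -> : K * nR ^+ 5 = (2 * K * nR ^+ 3) * (nR ^+ 2 / 2) by field.
have s0 (q : edge n -> R) : 0 <= \sum_e q e ^+ 2 by apply: sumr_ge0 => e _; exact: sqr_ge0.
apply: ler_pM => //; first exact: sum_C2_sq_le.
rewrite (sum_Y_sq kE XO); apply: le_trans (N_le R n1).
by case/andP: p01 => p0 p1; rewrite ler_piMr//; nra.
Qed.

(** Before the prefactor 1/n, each of the three terms is O(n^(5/2)): D^T Y D by the operator norm,
    [f2] by hypothesis, and f2 tr3 / N because tr3 is O(n^(5/2)). The square with prefactor is
    therefore O(n^3). *)
Lemma err_tr3_field_le X : X \in Omega n k -> f2 X <= K * nR ^+ 2 -> opnorm_le X ->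
  (3 * beta / nR * (4 * (p * (1 - p)) * bil X (Dv X) (Dv X)
     - 4 * (p * (1 - p)) * (1 - 2 * p) * f2 X + 2 * f2 X / N * tr3 X)) ^+ 2 <=
  27 * b0 ^+ 2 * (K ^+ 2 + 65 * K ^+ 3) * nR ^+ 3.
Proof.
move=> XO fK op; have n2 := nR_ge2 R n1; have n0 : 0 < nR by lra.
have N0 := N_gt0 R n1; have [b1 b2] := andP beta01; have [p0 p1] := andP p01.
have f0 := f2_ge0 p X.
have h1 : (3 * beta / nR) ^+ 2 <= 9 * b0 ^+ 2 / nR ^+ 2.
  have -> : 9 * b0 ^+ 2 / nR ^+ 2 = (3 * b0 / nR) ^+ 2 by field; rewrite gt_eqF.
  rewrite lerXn2r ?nnegrE; [by []|by nonneg|by nonneg|].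
  by rewrite ler_wpM2r ?invr_ge0 ?(ltW n0)//; lra.
rewrite exprMn.
have -> : 27 * b0 ^+ 2 * (K ^+ 2 + 65 * K ^+ 3) * nR ^+ 3 =
   9 * b0 ^+ 2 / nR ^+ 2 * (3 * ((K ^+ 3 + K ^+ 2 + 64 * K ^+ 3) * nR ^+ 5)).
  by field; rewrite gt_eqF.
apply: ler_pM => //; rewrite ?sqr_ge0//.
apply: (le_trans (sqr_sum3_le _ _ _)); rewrite ler_pM2l//.
have q0 : 0 <= 4 * (p * (1 - p)) by nra.
have q1 : 4 * (p * (1 - p)) <= 1 by have := sqr_ge0 (1 - 2 * p); nra.
have ff : f2 X ^+ 2 <= K ^+ 2 * nR ^+ 4.
  have -> : K ^+ 2 * nR ^+ 4 = (K * nR ^+ 2) ^+ 2 by ring.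
  by rewrite lerXn2r ?nnegrE// (le_trans f0).
have n45 : nR ^+ 4 <= nR ^+ 5 by rewrite ler_weXn2l//; lra.
rewrite [leRHS]mulrDl [in leRHS]mulrDl; apply: lerD; first apply: lerD.
- have := op (Dv X) (Dv X); rewrite -/(f2 X) => hb.
  apply: (@le_trans _ _ (bil X (Dv X) (Dv X) ^+ 2)).
    by rewrite exprMn ler_piMl ?sqr_ge0// expr_le1.
  apply: (le_trans hb).
  have -> : K * nR * f2 X * f2 X = K * nR * f2 X ^+ 2 by ring.
  have -> : K ^+ 3 * nR ^+ 5 = K * nR * (K ^+ 2 * nR ^+ 4) by ring.
  by apply: ler_wpM2l => //; nonneg.
- rewrite sqrrN exprMn.
  apply: (@le_trans _ _ (f2 X ^+ 2)).
    rewrite ler_piMl ?sqr_ge0// -[leLHS]real_normK ?num_real// expr_le1//.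
    have c1 : `|4 * (p * (1 - p))| <= 1 by rewrite ger0_norm.
    have c2 : `|1 - 2 * p| <= 1 by rewrite ler_norml; apply/andP; split; lra.
    by rewrite normrM mulr_ile1.
  by apply: (le_trans ff); rewrite ler_wpM2l ?sqr_ge0.
- rewrite exprMn; have -> : 64 * K ^+ 3 * nR ^+ 5 = (8 * K) ^+ 2 * (K * nR ^+ 5) by ring.
  apply: ler_pM; rewrite ?sqr_ge0 ?tr3_sq_le//.
  rewrite lerXn2r ?nnegrE; [by []|by nonneg|by nonneg|].
  by rewrite ler_pdivrMr//; have := ler_wpM2l K0 (N_ge R n1); lra.
Qed.

Lemma err_tr3_exchange_le X :
  ((2 * N)^-1 * \sum_e \sum_f rate e f X * (3 * delta e f X ^+ 2 * kappa X e f)) ^+ 2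
  <= 144 * Ab ^+ 2 * nR ^+ 3.
Proof.
have n2 := nR_ge2 R n1; have n0 : 0 < nR by lra.
have N0 := N_gt0 R n1; have A1 := Ab_ge1 beta01; have A0 : 0 <= Ab by lra.
set T := _ * _.
have Tle : `|T| <= 12 * Ab * nR.
  rewrite /T normrM ger0_norm ?invr_ge0 ?mulr_ge0 ?(ltW N0)// [leLHS]mulrC.
  rewrite ler_pdivrMr ?mulr_gt0//; apply: (le_trans (ler_norm_sum _ _ _)).
  apply: (@le_trans _ _ (\sum_(e : edge n) \sum_(f : edge n) 6 * Ab * overlap R e f)).
    apply: ler_sum => e _; apply: (le_trans (ler_norm_sum _ _ _)).
    apply: ler_sum => f _; rewrite normrM ger0_norm ?rate_ge0//.
    have -> : 6 * Ab * overlap R e f = Ab * (3 * (2 * overlap R e f)) by ring.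
    apply: ler_pM; rewrite ?rate_ge0 ?(rate_le n1 p01 beta01)//.
    rewrite -mulrA normrM [X in X * _]ger0_norm// ler_pM2l// normrM.
    rewrite [X in X * _]ger0_norm ?sqr_ge0//.
    apply: le_trans (normr_kappa_le p01 X e f).
    by rewrite ler_piMl// delta_sq_le1.
  under eq_bigr do rewrite -mulr_sumr; rewrite -mulr_sumr.
  have -> : 12 * Ab * nR * (2 * N) = 6 * Ab * (4 * nR * N) by ring.
  apply: ler_wpM2l; first by nonneg.
  apply: (le_trans (sum_overlap_le R n1)).
  by have := N_ge R n1; nra.
rewrite -[leLHS]real_normK ?num_real//.
apply: (@le_trans _ _ ((12 * Ab * nR) ^+ 2)).
  by rewrite lerXn2r ?nnegrE// (le_trans _ Tle).
have -> : (12 * Ab * nR) ^+ 2 = 144 * Ab ^+ 2 * nR ^+ 2 by ring.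
apply: ler_wpM2l; first by nonneg.
by rewrite ler_weXn2l//; lra.
Qed.

Definition C_tr3 : R := 3 * (27 * b0 ^+ 2 * (K ^+ 2 + 65 * K ^+ 3) +
   288 * K * Kr ^+ 2 * (1 + K ^+ 2) + 144 * Ab ^+ 2).

Lemma err_tr3_sq_le X : X \in Omega n k -> f2 X <= K * nR ^+ 2 -> opnorm_le X ->
  err_tr3 X ^+ 2 <= C_tr3 * (nR ^+ 3 + D4 X).
Proof.
move=> XO fK op; have n2 := nR_ge2 R n1; have n0 : 0 < nR by lra.
rewrite (err_tr3E beta kE n1 XO); apply: (le_trans (sqr_sum3_le _ _ _)).
rewrite /C_tr3 -[leRHS]mulrA ler_pM2l// [leRHS]mulrDl [in leRHS]mulrDl.
have d0 := D4_ge0 p X; have n3 : 0 <= nR ^+ 3 by rewrite exprn_ge0// ltW.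
apply: lerD; first apply: lerD.
- apply: (le_trans (err_tr3_field_le XO fK op)); apply: ler_wpM2l; last by lra.
  by nonneg.
- rewrite exprMn.
  have k20 : 0 <= 2 * K by rewrite mulr_ge0.
  by have := sum_Se_Rm_sq_le kE n1 p01 beta01 K0 XO fK k20 (sum_C2_sq_le op); lra.
- apply: (le_trans (err_tr3_exchange_le X)); apply: ler_wpM2l; last by lra.
  by nonneg.
Qed.

Lemma normr_tr3_le X : `|tr3 X| <= nR ^+ 3.
Proof.
apply: (@le_trans _ _ (\sum_(u < n) \sum_(v < n) \sum_(w < n) 1)).
  apply: (le_trans (ler_norm_sum _ _ _)); apply: ler_sum => u _.
  apply: (le_trans (ler_norm_sum _ _ _)); apply: ler_sum => v _.
  apply: (le_trans (ler_norm_sum _ _ _)); apply: ler_sum => w _.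
  rewrite !normrM !mulr_ile1 ?mulr_ge0//; exact: normr_ym_le1.
rewrite !sumr_const !card_ord -!mulrnA.
by rewrite -natrX !expnS expn0 muln1 mulnA.
Qed.

Lemma normr_C2_le X e : `|C2 X e| <= 2 * nR.
Proof.
apply: (@le_trans _ _ (\sum_(u < n) \sum_(v < n) \sum_(w < n) M e w u)).
  apply: (le_trans (ler_norm_sum _ _ _)); apply: ler_sum => u _.
  apply: (le_trans (ler_norm_sum _ _ _)); apply: ler_sum => v _.
  apply: (le_trans (ler_norm_sum _ _ _)); apply: ler_sum => w _.
  rewrite normrM [X in _ * X]ger0_norm ?M_ge0// ler_piMl ?M_ge0//.
  by rewrite normrM mulr_ile1//; exact: normr_ym_le1.
under eq_bigr do rewrite sumr_const card_ord.
rewrite sumrMnl exchange_big /=; under eq_bigr do rewrite sum_M_row.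
by rewrite sum_chi -[_ *+ n]mulr_natr.
Qed.

Lemma sum_C2_sq_crude X : \sum_e C2 X e ^+ 2 <= 2 * nR ^+ 4.
Proof.
apply: (@le_trans _ _ (\sum_(e : edge n) (2 * nR) ^+ 2)).
  apply: ler_sum => e _; rewrite -real_normK ?num_real//.
  by rewrite lerXn2r ?nnegrE ?mulr_ge0// normr_C2_le.
rewrite sum_edge_const; have := N_le R n1; have := sqr_ge0 nR; nra.
Qed.

Lemma f2_swap_sq_le X e f : (f2 (swap e f X) - f2 X) ^+ 2 <=
  (16 * Se X e ^+ 2) + (16 * Se X f ^+ 2) + 32.
Proof.
rewrite f2_swap; have d1 := delta_sq_le1 p e f X.
have d0 := sqr_ge0 (delta e f X).
have o0 := overlap_ge0 R e f; have o2 := overlap_le2 R e f.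
set d := delta e f X in d0 d1 *; set s := Se X e - Se X f.
have -> : f2 X - 2 * d * s + d ^+ 2 * (4 - 2 * overlap R e f) - f2 X =
  - (2 * d * s) + d ^+ 2 * (4 - 2 * overlap R e f) by ring.
set o := 4 - _.
have oo : 0 <= o <= 4 by rewrite /o; lra.
apply: (@le_trans _ _ (2 * (4 * (d ^+ 2 * s ^+ 2)) + 2 * (d ^+ 2 * o) ^+ 2)).
  by have := sqr_ge0 (2 * d * s + d ^+ 2 * o); nra.
apply: lerD.
  have : d ^+ 2 * s ^+ 2 <= s ^+ 2 by rewrite ler_piMl ?sqr_ge0.
  by rewrite /s; have := sqr_ge0 (Se X e + Se X f); nra.
have : d ^+ 2 * o <= 4 by case/andP: oo => oo1 oo2; nra.
have : 0 <= d ^+ 2 * o by rewrite mulr_ge0//; lra.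
nra.
Qed.

Lemma tr3_swap_sq_le X e f : (tr3 (swap e f X) - tr3 X) ^+ 2 <=
  (36 * C2 X e ^+ 2) + (36 * C2 X f ^+ 2) + 288.
Proof.
rewrite tr3_swap; have d1 := delta_sq_le1 p e f X.
have d0 := sqr_ge0 (delta e f X).
have o2 := overlap_le2 R e f; have k2 := normr_kappa_le p01 X e f.
set d := delta e f X in d0 d1 *; set s := C2 X e - C2 X f.
set kap := kappa X e f in k2 *.
have -> : tr3 X + - (3 * d) * s + 3 * d ^+ 2 * kap - tr3 X =
  - (3 * d * s) + 3 * (d ^+ 2 * kap) by ring.
apply: (@le_trans _ _ (2 * (9 * (d ^+ 2 * s ^+ 2)) + 18 * (d ^+ 2 * kap) ^+ 2)).
  by have := sqr_ge0 (3 * d * s + 3 * (d ^+ 2 * kap)); nra.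
apply: lerD.
  have : d ^+ 2 * s ^+ 2 <= s ^+ 2 by rewrite ler_piMl ?sqr_ge0.
  by rewrite /s; have := sqr_ge0 (C2 X e + C2 X f); nra.
have : `|d ^+ 2 * kap| <= 4.
  rewrite normrM ger0_norm//; have := normr_ge0 kap; nra.
by rewrite ler_norml => /andP[h1 h2]; nra.
Qed.

(** With a squared increment bounded by separate contributions of the two edges, the double sum
    collapses to the mean of one sum over edges. *)
Lemma dirichlet_le (F : graph n -> R) (q : graph n -> edge n -> R) (c : R) :
  (forall X e f, (F (swap e f X) - F X) ^+ 2 <= q X e + q X f + c) ->
  dirichlet k p beta F <=
  Ab / 2 * gibbs_mean k beta (fun X => \sum_e q X e) + Ab * N / 4 * c.
Proof.
move=> Fq; have N0 := N_gt0 R n1; have A1 := Ab_ge1 beta01; have A0 : 0 <= Ab by lra.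
have n0 : (0 < n)%N by rewrite ltnW.
rewrite /dirichlet.
have -> : Ab / 2 * gibbs_mean k beta (fun X => \sum_e q X e) + Ab * N / 4 * c =
   (4 * N)^-1 * gibbs_mean k beta (fun X => \sum_(e : edge n) \sum_(f : edge n) Ab * (q X e + q X f + c)).
  transitivity ((4 * N)^-1 * gibbs_mean k beta (fun X => 2 * Ab * N * (\sum_e q X e) + Ab * N ^+ 2 * c)).
    rewrite MeanD MeanZ (Mean_cst beta kE n0 p01); field; rewrite gt_eqF//.
  congr (_ * gibbs_mean _ _ _); apply: funext => X.
  under [RHS]eq_bigr do rewrite -mulr_sumr !big_split /= !sum_edge_const.
  rewrite -mulr_sumr !big_split /= !sum_edge_const -mulr_sumr; ring.
apply: ler_wpM2l; first by rewrite invr_ge0 mulr_ge0// ltW.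
rewrite Mean_sum; apply: ler_sum => e _; rewrite Mean_sum; apply: ler_sum => f _.
apply: ler_Mean => X XO; apply: ler_pM; rewrite ?rate_ge0 ?sqr_ge0//.
exact: (rate_le n1 p01 beta01).
Qed.

End TriangleBounds.

(** * From the triangle count to the centred traces *)

Section TriangleCount.
Variables (R : realType) (n k : nat) (p : R).
Implicit Types (X : graph n) (e : edge n) (u v w : 'I_n).

Hypothesis kE : k%:R = 'C(n, 2)%:R * p.
Hypothesis n1 : (1 < n)%N.

Local Notation J := (@Jm R n).
Local Notation nR := (n%:R : R).

Lemma adjE X u v : (adj X u v)%:R = ym p X u v + p * J u v.
Proof.
rewrite /J /adj; have [<-|uv] := eqVneq u v.
  rewrite ym_diag mulr0 addr0; case: insubP => //= e.
  by rewrite finset.setUid cards1.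
have [e eE ZE] := edge_of_pair R uv; rewrite /ym (ZE (Y p X)).
by rewrite -eE valK /Y /=; ring.
Qed.

Lemma adjC X u v : adj X u v = adj X v u.
Proof. by rewrite /adj finset.setUC. Qed.

Lemma adj_diag X u : adj X u u = false.
Proof. by rewrite /adj; case: insubP => //= e; rewrite finset.setUid cards1. Qed.

Lemma sum_triples_sym (g : 'I_n -> 'I_n -> 'I_n -> R) :
  (forall u v w, g u v w = g v u w) -> (forall u v w, g u v w = g u w v) ->
  (forall u v, g u u v = 0) ->
  \sum_u \sum_v \sum_w g u v w =
  6 * \sum_(u < n) \sum_(v < n | (u < v)%N) \sum_(w < n | (v < w)%N) g u v w.
Proof.
move=> g12 g23 g0.
pose I u v w : R := ((u < v)%N && (v < w)%N)%:R.
pose T := \sum_(u < n) \sum_(v < n) \sum_(w < n) I u v w * g u v w.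
have TE : \sum_(u < n) \sum_(v < n | (u < v)%N) \sum_(w < n | (v < w)%N) g u v w = T.
  apply: eq_bigr => u _; rewrite big_mkcond; apply: eq_bigr => v _.
  rewrite /I; case: (u < v)%N => /=; last by rewrite big1// => w _; rewrite mul0r.
  rewrite big_mkcond; apply: eq_bigr => w _.
  by case: (v < w)%N; rewrite ?mul1r ?mul0r.
rewrite TE.
(* A triple of distinct vertices is increasing in exactly one of its six orders; all other triples
   contribute zero. *)
have gs u v w : g u v w = I u v w * g u v w + I v u w * g u v w + I u w v * g u v w
   + I v w u * g u v w + I w u v * g u v w + I w v u * g u v w.
  rewrite /I.
  have gA u' v' : g u' v' v' = 0 by rewrite g12 g23.
  have gB u' v' : g u' v' u' = 0 by rewrite g23.
  have [uv|uv|/val_inj uv] := ltngtP u v; have [vw|vw|/val_inj vw] := ltngtP v w;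
  have [uw|uw|/val_inj uw] := ltngtP u w; rewrite /= ?mul1r ?mul0r ?addr0 ?add0r//;
  subst; rewrite ?g0 ?gA ?gB ?mul0r ?addr0 ?mul1r//; lia.
have p1 : \sum_u \sum_v \sum_w I v u w * g u v w = T.
  rewrite exchange_big; apply: eq_bigr => v _; apply: eq_bigr => u _.
  by apply: eq_bigr => w _; rewrite g12.
have p2 : \sum_u \sum_v \sum_w I u w v * g u v w = T.
  apply: eq_bigr => u _; rewrite exchange_big; apply: eq_bigr => w _.
  by apply: eq_bigr => v _; rewrite g23.
have p3 : \sum_u \sum_v \sum_w I v w u * g u v w = T.
  rewrite exchange_big; apply: eq_bigr => v _; rewrite exchange_big.
  by apply: eq_bigr => w _; apply: eq_bigr => u _; rewrite g12 g23.
have p4 : \sum_u \sum_v \sum_w I w u v * g u v w = T.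
  rewrite (eq_bigr _ (fun u _ => exchange_big _ _ _ _ _ _)) exchange_big /=.
  by apply: eq_bigr => w _; apply: eq_bigr => u _; apply: eq_bigr => v _; rewrite g23 g12.
have p5 : \sum_u \sum_v \sum_w I w v u * g u v w = T.
  rewrite (eq_bigr _ (fun u _ => exchange_big _ _ _ _ _ _)) exchange_big /=.
  apply: eq_bigr => w _; rewrite exchange_big; apply: eq_bigr => v _.
  by apply: eq_bigr => u _; rewrite g12 g23 g12.
under eq_bigr => u _ do under eq_bigr => v _ do
  (rewrite (eq_bigr _ (fun w _ => gs u v w)) !big_split /=).
under eq_bigr => u _ do rewrite !big_split /=.
by rewrite !big_split /= p1 p2 p3 p4 p5 -/T; ring.
Qed.

(** Expansion of tr (Y + p (J - I))^3 / 6, with J the all-ones matrix. The part quadratic in Y is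
    [f2] up to the sum of the squared entries of Y, constant on [Omega n k]; the linear part
    vanishes with sum_v D_v. *)
Lemma trianglesE X : X \in Omega n k -> (triangles X)%:R =
  6^-1 * tr3 p X + p / 2 * f2 p X +
  6^-1 * (p ^+ 3 * tri J J J - 3 * p * (p * (1 - p) * (nR * (nR - 1)))).
Proof.
move=> XO.
pose a u v : R := (adj X u v)%:R.
have aC u v : a u v = a v u by rewrite /a adjC.
have aE : a =2 (fun u v => ym p X u v + p * J u v) by move=> u v; exact: adjE.
have J0 u : \sum_w J w u = nR - 1.
  have := sum_Jm_row (fun _ : 'I_n => (1 : R)) u; under eq_bigr do rewrite mul1r.
  by move=> ->; rewrite sumr_const card_ord.
have sumy : \sum_u \sum_v ym p X u v = 0.
  by under eq_bigr do rewrite sum_ym_row; rewrite (sum_Dv kE XO).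
have h6 : tri a a a = 6 * (triangles X)%:R.
  rewrite /tri (sum_triples_sym (g := fun u v w => a u v * a v w * a w u)).
  - rewrite /triangles natr_sum; congr (_ * _); apply: eq_bigr => u _.
    rewrite natr_sum; apply: eq_bigr => v _; rewrite natr_sum; apply: eq_bigr => w _.
    by rewrite !natrM /a (adjC X w u); ring.
  - by move=> u v w; rewrite (aC u v) (aC v w) (aC w u); ring.
  - by move=> u v w; rewrite (aC u v) (aC v w) (aC w u); ring.
  - by move=> u v; rewrite /a adj_diag !mul0r.
have t1 : tri (ym p X) (ym p X) J = f2 p X - p * (1 - p) * (nR * (nR - 1)).
  transitivity (\sum_v \sum_u (ym p X v u * \sum_w ym p X v w - ym p X u v ^+ 2)).
    rewrite /tri exchange_big; apply: eq_bigr => v _; apply: eq_bigr => u _ /=.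
    rewrite sum_Jm_row -mulr_sumr (ymC p X u v); congr (_ - _).
  under eq_bigr => v _.
    rewrite sumrB -mulr_suml sum_ym_row -expr2.
    under [X in _ - X]eq_bigr do rewrite ym_sq.
    rewrite big_split /= -!mulr_sumr J0; over.
  rewrite sumrB big_split /= -mulr_sumr; congr (_ - _).
  rewrite exchange_big /= sumy mulr0 add0r sumr_const card_ord -[LHS]mulr_natl.
  by ring.
have t2 : tri (ym p X) J J = 0.
  transitivity (\sum_u \sum_v (ym p X u v * (nR - 2))).
    apply: eq_bigr => u _; apply: eq_bigr => v _; rewrite /= sum_Jm_row.
    rewrite -mulr_sumr.
    have -> : \sum_w J v w = nR - 1.
      by rewrite -(J0 v); apply: eq_bigr => w _; rewrite /J eq_sym.
    rewrite /J; have [<-|vu] := eqVneq v u; first by rewrite ym_diag !mul0r subrr.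
    by rewrite /=; ring.
  by under eq_bigr do rewrite -mulr_suml; rewrite -mulr_suml sumy mul0r.
have := h6; rewrite (eq_tri aE aE aE) tri_cube t1 t2 -/(tr3 p X) => h.
apply: (mulfI (_ : (6 : R) != 0)) => //; by rewrite -h; field.
Qed.

End TriangleCount.

(** * Comparison with the product measure *)

Section Binomial.
Variable R : realType.

Definition binom_pmf (N : nat) (p : R) (j : nat) : R :=
  'C(N, j)%:R * p ^+ j * (1 - p) ^+ (N - j).

Lemma sum_binom_pmf N p : \sum_(j < N.+1) binom_pmf N p j = 1.
Proof.
rewrite -[RHS](expr1n _ N) -[1 in RHS](subrK p) exprDn; apply: eq_bigr => j _.
by rewrite /binom_pmf -[RHS]mulr_natl; ring.
Qed.

Lemma binom_pmf_ge0 N p j : 0 < p < 1 -> 0 <= binom_pmf N p j.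
Proof. by case/andP=> p0 p1; rewrite !mulr_ge0// exprn_ge0//; lra. Qed.

Lemma binom_pmfS N p j : (j < N)%N ->
  binom_pmf N p j.+1 * (j.+1%:R * (1 - p)) = binom_pmf N p j * ((N - j)%:R * p).
Proof.
move=> jN; rewrite /binom_pmf.
have := mul_bin_left N j => /(congr1 (fun m => m%:R : R)).
rewrite !natrM => h.
have -> : (1 - p) ^+ (N - j) = (1 - p) ^+ (N - j.+1) * (1 - p).
  by rewrite -exprSr subnSK.
rewrite exprS; set a := 'C(N, j.+1)%:R in h *; set b := 'C(N, j)%:R in h *.
transitivity ((j.+1%:R * a) * (p * p ^+ j * (1 - p) ^+ (N - j.+1) * (1 - p))); first by ring.
by rewrite h; ring.
Qed.

(** As N p = k is an integer, the ratios of consecutive masses show that k is a mode, and the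
    largest of N + 1 masses is at least their average. *)
Lemma binom_pmf_mode N p k : 0 < p < 1 -> k%:R = N%:R * p ->
  N.+1%:R^-1 <= binom_pmf N p k.
Proof.
move=> p01 kE; have [p0 p1] := andP p01.
have kN : (k <= N)%N by rewrite -(ler_nat R) kE ler_piMr// ltW.
have b0 := binom_pmf_ge0 N _ p01.
have up j : (j < k)%N -> binom_pmf N p j <= binom_pmf N p j.+1.
  move=> jk; have jN := leq_trans jk kN; have e := binom_pmfS p jN.
  have h : (j.+1%:R : R) <= k%:R by rewrite ler_nat.
  rewrite natrB ?(ltnW jN)// in e; rewrite -natr1 in h e *.
  have c0 : 0 < (j%:R + 1) * (1 - p).
    by have j0 := ler0n R j; rewrite mulr_gt0//; lra.
  rewrite -(ler_pM2r c0) e; apply: ler_wpM2l; first exact: b0.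
  by rewrite kE in h; lra.
have dn j : (k <= j)%N -> (j < N)%N -> binom_pmf N p j.+1 <= binom_pmf N p j.
  move=> kj jN; have e := binom_pmfS p jN.
  have h : (k%:R : R) <= j%:R by rewrite ler_nat.
  rewrite natrB ?(ltnW jN)// in e; rewrite -natr1 in e *.
  have c0 : 0 < (j%:R + 1) * (1 - p).
    by have j0 := ler0n R j; rewrite mulr_gt0//; lra.
  rewrite -(ler_pM2r c0) e; apply: ler_wpM2l; first exact: b0.
  by rewrite kE in h; lra.
have le_mode j : (j <= N)%N -> binom_pmf N p j <= binom_pmf N p k.
  move=> jN; case: (leqP j k) => jk.
    have : forall d, (d <= k)%N -> binom_pmf N p (k - d) <= binom_pmf N p k.
      elim=> [|d IH] dk; first by rewrite subn0.
      apply: le_trans (IH (ltnW dk)); rewrite -[(k - d)%N](_ : (k - d.+1).+1 = _).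
        by apply: up; lia.
      by lia.
    by move=> /(_ (k - j)%N (leq_subr _ _)); rewrite subKn.
  have : forall d, (k + d <= N)%N -> binom_pmf N p (k + d) <= binom_pmf N p k.
    elim=> [|d IH] dk; first by rewrite addn0.
    rewrite addnS; apply: le_trans (IH (ltnW _)); last by rewrite addnS in dk.
    by apply: dn; lia.
  by move=> /(_ (j - k)%N); rewrite subnKC ?(ltnW jk)//; apply.
have h : \sum_(j < N.+1) binom_pmf N p j <= \sum_(j < N.+1) binom_pmf N p k.
  by apply: ler_sum => j _; apply: le_mode; rewrite -ltnS.
rewrite sum_binom_pmf sumr_const card_ord -[leRHS]mulr_natr in h.
by rewrite -[leLHS]mul1r ler_pdivrMr ?ltr0Sn.
Qed.

End Binomial.

Section ProductMeasure.
Variables (R : realType) (n k : nat) (p beta c : R).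
Implicit Types (X : graph n) (e : edge n) (u v w : 'I_n).

Local Notation Nn := (#|{: edge n}|).
Local Notation N := (#|{: edge n}|%:R : R).
Local Notation Y := (Y p).
Local Notation Dv := (Dv p).
Local Notation f2 := (f2 p).
Local Notation nR := (n%:R : R).

Hypothesis kE : k%:R = 'C(n, 2)%:R * p.
Hypothesis n1 : (1 < n)%N.
Hypothesis p01 : 0 < p < 1.
Hypothesis beta0 : 0 <= beta.
Hypothesis c0 : 0 < c.
Hypothesis subgauss : forall t : R,
  p * expR ((1 - p) * t) + (1 - p) * expR (- p * t) <= expR (t ^+ 2 / (4 * c)).

Definition pw X : R := \prod_e (if X e then p else 1 - p).

Lemma pw_ge0 X : 0 <= pw X.
Proof. by apply: prodr_ge0 => e _; case/andP: p01 => p0 p1; case: (X e); lra. Qed.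

Lemma sum_pw_expR_le (q : edge n -> R) :
  \sum_X pw X * expR (\sum_e q e * Y X e) <= expR ((4 * c)^-1 * \sum_e q e ^+ 2).
Proof.
pose F e (b : bool) : R := (if b then p else 1 - p) * expR (q e * (b%:R - p)).
have -> : \sum_X pw X * expR (\sum_e q e * Y X e) = \prod_e \sum_b F e b.
  rewrite bigA_distr_bigA; apply: eq_bigr => X _.
  by rewrite expR_sum -big_split.
rewrite mulr_sumr expR_sum; apply: ler_prod => e _; apply/andP; split.
  apply: sumr_ge0 => b _; apply: mulr_ge0; last exact: expR_ge0.
  by case/andP: p01 => p0 p1; case: b; lra.
rewrite big_bool /F /=; have := subgauss (q e).
have -> : (1 - p) * q e = q e * (1 - p) by ring.
have -> : - p * q e = q e * (0 - p) by ring.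
have -> : q e ^+ 2 / (4 * c) = (4 * c)^-1 * q e ^+ 2 by ring.
by [].
Qed.

Lemma pw_Omega X : X \in Omega n k -> pw X = p ^+ k * (1 - p) ^+ (Nn - k).
Proof.
rewrite inE => /eqP h; rewrite /pw (bigID (fun e => X e)) /=.
have ck : #|[pred e | X e]| = k.
  rewrite -h -sum1_card big_mkcond; apply: eq_bigr => e _.
  by rewrite inE; case: (X e).
congr (_ * _).
  by rewrite (eq_bigr (fun=> p)) ?prodr_const ?ck// => e ->.
rewrite (eq_bigr (fun=> 1 - p)) ?prodr_const; last by move=> e /negbTE ->.
congr (_ ^+ _); rewrite -ck -(cardC [pred e | X e]) addKn; apply: eq_card => e.
by rewrite !inE.
Qed.

Lemma sum_Omega_le_pw (h : graph n -> R) : (forall X, 0 <= h X) ->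
  \sum_(X in Omega n k) h X <=
  #|Omega n k|%:R * (N + 1) * \sum_(X in Omega n k) pw X * h X.
Proof.
move=> h0; have [p0 p1] := andP p01.
have kE' : k%:R = N * p by rewrite card_edge.
have kN : (k <= Nn)%N by rewrite -(ler_nat R) kE' ler_piMr// ltW.
have mode := binom_pmf_mode p01 kE'.
pose q := p ^+ k * (1 - p) ^+ (Nn - k).
have q0 : 0 < q by rewrite mulr_gt0// exprn_gt0//; lra.
have -> : \sum_(X in Omega n k) pw X * h X = q * \sum_(X in Omega n k) h X.
  by rewrite mulr_sumr; apply: eq_bigr => X XO; rewrite pw_Omega.
rewrite mulrA -[leLHS]mul1r; apply: ler_wpM2r; first exact: sumr_ge0.
rewrite card_Omega; have -> : 'C(Nn, k)%:R * (N + 1) * q = binom_pmf Nn p k * Nn.+1%:R.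
  by rewrite /binom_pmf /q natr1 mulrAC mulrA.
by rewrite -ler_pdivrMr ?ltr0Sn// mul1r.
Qed.

(** Since beta >= 0, every weight is at least 1, so the partition function dominates |Omega| and
    cancels it in [sum_Omega_le_pw]. Conditioning on the edge count costs only the factor N + 1. *)
Lemma Mean_le_pw (h : graph n -> R) : (forall X, 0 <= h X) ->
  gibbs_mean k beta h <=
  (N + 1) * \sum_(X in Omega n k) pw X * (expR (beta / nR * f2 X) * h X).
Proof.
move=> h0; have n0 : (0 < n)%N by rewrite ltnW.
rewrite (MeanE beta kE n0) ler_pdivrMr ?(partition_fn_gt0 beta kE p01)//.
have w0 X : 0 <= weight p beta X * h X by rewrite mulr_ge0// expR_ge0.
apply: (le_trans (sum_Omega_le_pw w0)); rewrite -mulrA mulrC.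
have s0 : 0 <= (N + 1) * \sum_(X in Omega n k) pw X * (weight p beta X * h X).
  rewrite mulr_ge0 ?addr_ge0//; apply: sumr_ge0 => X _; rewrite mulr_ge0 ?pw_ge0//.
apply: ler_wpM2l => //; rewrite /partition_fn -sum1_card natr_sum.
apply: ler_sum => X _; rewrite -expR0 ler_expR mulr_ge0 ?f2_ge0// divr_ge0//.
Qed.

(** Subtracting the mean of [l] changes nothing on [Omega n k], where the D_v sum to 0. It removes
    the all-ones part of the Gram matrix, which could double the exponent, before the sum is
    extended to all graphs. *)
Lemma sum_pw_degree_le (l : 'I_n -> R) :
  \sum_(X in Omega n k) pw X * expR (\sum_v l v * Dv X v) <=
  expR ((4 * c)^-1 * (nR * \sum_v l v ^+ 2)).
Proof.
have n2 := nR_ge2 R n1; have n0 : 0 < nR by lra.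
pose m := (\sum_v l v) / nR; pose l' v := l v - m.
have sc (a : R) : \sum_(v < n) a = nR * a by rewrite sumr_const card_ord mulr_natl.
have sl' : \sum_v l' v = 0 by rewrite sumrB sc /m mulrCA divff ?mulr1 ?subrr// gt_eqF.
have sl2 : \sum_v l' v ^+ 2 <= \sum_v l v ^+ 2.
  have -> : \sum_v l v ^+ 2 = \sum_v l' v ^+ 2 + (\sum_v (2 * m) * l' v + nR * m ^+ 2).
    rewrite -(sc (m ^+ 2)) -!big_split /=; apply: eq_bigr => v _.
    by rewrite /l'; ring.
  by rewrite -mulr_sumr sl' mulr0 add0r lerDl mulr_ge0// sqr_ge0.
pose q e : R := \sum_v chi e v * l' v.
have h1 : \sum_(X in Omega n k) pw X * expR (\sum_v l v * Dv X v) <=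
    \sum_X pw X * expR (\sum_e q e * Y X e).
  rewrite [leRHS](bigID (fun X => X \in Omega n k)) /=.
  rewrite -[leLHS]addr0; apply: lerD; last first.
    by apply: sumr_ge0 => X _; rewrite mulr_ge0 ?pw_ge0 ?expR_ge0.
  apply: ler_sum => X XO; rewrite le_eqVlt; apply/orP; left; apply/eqP.
  congr (_ * expR _); transitivity (\sum_v l' v * Dv X v).
    rewrite /l'; under [RHS]eq_bigr do rewrite mulrBl.
    by rewrite sumrB -mulr_sumr (sum_Dv kE XO) mulr0 subr0.
  rewrite /q; under [RHS]eq_bigr do rewrite mulr_suml.
  rewrite exchange_big; apply: eq_bigr => v _.
  by rewrite /Dv mulr_sumr; apply: eq_bigr => e _; ring.
apply: (le_trans h1); apply: (le_trans (sum_pw_expR_le q)).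
rewrite ler_expR ler_wpM2l ?invr_ge0 ?mulr_ge0 ?(ltW c0)//.
have -> : \sum_e q e ^+ 2 = (nR - 2) * \sum_v l' v ^+ 2.
  under eq_bigr do rewrite expr2.
  by rewrite sum_chi_lin_mul sl' mulr0 addr0.
apply: ler_pM => //; [lra|by apply: sumr_ge0 => v _; exact: sqr_ge0|lra].
Qed.

End ProductMeasure.

(** * Integer lattice sums in place of Gaussian integrals *)

Section Lattice.
Variables (R : realType) (J : nat).

(** Sign bit and magnitude; zero is represented twice, which accounts for the factor 2 in
    [sum_gauss_le]. *)
Definition zval (j : bool * 'I_J) : R := (-1) ^+ j.1 * (j.2 : nat)%:R.

Lemma zval_sq j : zval j ^+ 2 = (j.2 : nat)%:R ^+ 2.
Proof. by rewrite /zval exprMn sqrr_sign mul1r. Qed.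

(** Rounding is towards zero, so that it also does not increase the norm of a vector. *)
Lemma zval_round (x : R) : `|x| < J%:R ->
  exists j, `|x - zval j| <= 1 /\ `|zval j| <= `|x|.
Proof.
move=> xJ; have /andP[h1 h2] := truncn_itv (normr_ge0 x).
have tJ : (Num.truncn `|x| < J)%N by rewrite -(ltr_nat R) (le_lt_trans h1).
exists (x < 0, Ordinal tJ); rewrite /zval /=.
rewrite -natr1 in h2.
rewrite normrM normr_sign mul1r normr_nat; split=> //.
rewrite {1}[x]realEsign ?num_real// -mulrBr normrM normr_sign mul1r.
by rewrite ger0_norm; lra.
Qed.

Lemma expR_sqr_le_sum (x : R) : `|x| < J%:R ->
  expR (x ^+ 2) <= \sum_j expR (1 + (2 * zval j * x - zval j ^+ 2)).
Proof.
move=> /zval_round [j [h _]]; rewrite (bigD1 j)//=.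
apply: ler_wpDr; first by apply: sumr_ge0 => i _; exact: expR_ge0.
rewrite ler_expR; have : (x - zval j) ^+ 2 <= 1.
  by rewrite -real_normK ?num_real// expr_le1.
by nra.
Qed.

(** Since i^2 >= i, a geometric series dominates, with a bound independent of [J]. *)
Lemma sum_gauss_le (rho : R) : 0 < rho ->
  \sum_j expR (- rho * zval j ^+ 2) <= 2 / (1 - expR (- rho)).
Proof.
move=> r0; set q := expR (- rho).
have q1 : q < 1 by rewrite /q expR_lt1; lra.
have q0 : 0 <= q := expR_ge0 _.
have -> : \sum_j expR (- rho * zval j ^+ 2) =
    2 * \sum_(i < J) expR (- rho * (i : nat)%:R ^+ 2).
  rewrite -(pair_bigA _ (fun (b : bool) (i : 'I_J) => expR (- rho * zval (b, i) ^+ 2))).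
  rewrite big_bool /= mulr2n mulrDl mul1r.
  by congr (_ + _); apply: eq_bigr => i _; rewrite zval_sq.
rewrite ler_wpM2l//.
apply: (@le_trans _ _ (\sum_(i < J) q ^+ i)).
  apply: ler_sum => i _; rewrite /q -expRM_natl ler_expR mulrC ler_wnM2r//; first lra.
  by rewrite -natrX ler_nat; case: (nat_of_ord i) => // m; rewrite -{1}[m.+1]expn1 leq_pexp2l.
rewrite -[leRHS]mul1r ler_pdivlMr ?subr_gt0//.
have := subrX1 q J; move=> h.
have -> : (\sum_(i < J) q ^+ i) * (1 - q) = 1 - q ^+ J by rewrite -[RHS]opprB h; ring.
by have := exprn_ge0 J q0; lra.
Qed.

End Lattice.

Section GaussianBound.
Variables (R : realType) (n k : nat) (p beta c : R).
Implicit Types (X : graph n) (e : edge n) (u v w : 'I_n).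

Local Notation Y := (Y p).
Local Notation Dv := (Dv p).
Local Notation f2 := (f2 p).
Local Notation nR := (n%:R : R).
Local Notation pw := (pw p).
Local Notation bil := (bil p).

Hypothesis kE : k%:R = 'C(n, 2)%:R * p.
Hypothesis n1 : (1 < n)%N.
Hypothesis p01 : 0 < p < 1.
Hypothesis c0 : 0 < c.
Hypothesis subgauss : forall t : R,
  p * expR ((1 - p) * t) + (1 - p) * expR (- p * t) <= expR (t ^+ 2 / (4 * c)).

(* A finite substitute for the Gaussian linearisation of [expR (x ^+ 2)]: the
   lattice point nearest to [x] already dominates, up to a constant. *)
Lemma sum_pw_expR_f2_le (b : R) : 0 <= b < c ->
  \sum_(X in Omega n k) pw X * expR (b / nR * f2 X) <=
  (expR 1 * (2 / (1 - expR (- (1 - b / c))))) ^+ n.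
Proof.
move=> /andP[b0 bc]; have n2 := nR_ge2 R n1; have n0 : 0 < nR by lra.
(* A lattice value z has the prefactor exp (- z^2); averaging over the graph returns exp ((b / c)
   z^2), so the sum keeps the Gaussian decay [rho]. *)
set rho := 1 - b / c; have r0 : 0 < rho by rewrite subr_gt0 ltr_pdivrMr ?mul1r.
set s := Num.sqrt (b / nR).
have s0 : 0 <= s := sqrtr_ge0 _.
have s2 : s ^+ 2 = b / nR by rewrite sqr_sqrtr// divr_ge0// ltW.
pose J := (Num.truncn (s * nR)).+1.
pose G := (bool * 'I_J)%type.
have step1 X : expR (b / nR * f2 X) <=
    \sum_(j : {ffun 'I_n -> G}) expR (\sum_v (1 - zval R (j v) ^+ 2)) *
       expR (\sum_v (2 * s * zval R (j v)) * Dv X v).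
  have -> : expR (b / nR * f2 X) = \prod_v expR ((s * Dv X v) ^+ 2).
    rewrite -expR_sum; congr expR; rewrite /f2 mulr_sumr; apply: eq_bigr => v _.
    by rewrite exprMn s2.
  apply: (@le_trans _ _ (\prod_v \sum_(j : G)
      expR (1 + (2 * zval R j * (s * Dv X v) - zval R j ^+ 2)))).
    apply: ler_prod => v _; rewrite expR_ge0 /=; apply: expR_sqr_le_sum.
    rewrite normrM ger0_norm//; apply: le_lt_trans (truncnS_gt _).
    by rewrite ler_wpM2l// normr_Dv_le.
  rewrite bigA_distr_bigA; apply: ler_sum => j _ /=.
  rewrite -expR_sum -expRD ler_expR -big_split /= le_eqVlt; apply/orP; left.
  by apply/eqP/eq_bigr => v _; ring.
apply: (@le_trans _ _ (\sum_(j : {ffun 'I_n -> G})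
    \prod_v (expR 1 * expR (- rho * zval R (j v) ^+ 2)))).
  apply: (@le_trans _ _ (\sum_(j : {ffun 'I_n -> G})
      expR (\sum_v (1 - zval R (j v) ^+ 2)) * \sum_(X in Omega n k)
      pw X * expR (\sum_v (2 * s * zval R (j v)) * Dv X v))).
    under [leRHS]eq_bigr do rewrite mulr_sumr.
    rewrite [leRHS]exchange_big; apply: ler_sum => X XO /=.
    apply: (le_trans (ler_wpM2l (pw_ge0 p01 X) (step1 X))).
    rewrite mulr_sumr; apply: ler_sum => j _; rewrite le_eqVlt; apply/orP; left.
    by apply/eqP; ring.
  apply: ler_sum => j _.
  have h := sum_pw_degree_le kE n1 p01 c0 subgauss (fun v => 2 * s * zval R (j v)).
  apply: (le_trans (ler_wpM2l (expR_ge0 _) h)).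
  under [leRHS]eq_bigr do rewrite -expRD; rewrite -expR_sum -expRD ler_expR.
  rewrite !mulr_sumr -big_split /= le_eqVlt; apply/orP; left; apply/eqP.
  apply: eq_bigr => v _; rewrite !exprMn s2 /rho; field.
  by rewrite !gt_eqF.
rewrite -(bigA_distr_bigA (fun (v : 'I_n) (j : G) => expR 1 * expR (- rho * zval R j ^+ 2))).
rewrite prodr_const card_ord lerXn2r ?nnegrE//.
- by apply: sumr_ge0 => j _; rewrite mulr_ge0 ?expR_ge0.
- rewrite mulr_ge0 ?expR_ge0// divr_ge0// subr_ge0 -expR0 ler_expR; lra.
by rewrite -mulr_sumr ler_wpM2l ?expR_ge0// sum_gauss_le.
Qed.

Local Notation J := (2 * n).+1.
Local Notation net := {ffun 'I_n -> bool * 'I_J}.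

Definition netvec (j : net) (v : 'I_n) : R := zval R (j v).
(** Doubling a vector of squared norm at most n and rounding it towards zero lands here; its
    coordinates are at most 2 n, hence the range [J]. *)
Definition in_net (j : net) : bool := \sum_v netvec j v ^+ 2 <= 4 * nR.

Definition net_bad (K1 : R) X : bool :=
  [exists j : net, exists j' : net, [&& in_net j, in_net j' &
     K1 * nR * Num.sqrt nR < bil X (netvec j) (netvec j')]].

(** A net vector satisfies 1 <= exp (4 n - |j|^2), and the sum of this over all lattice vectors
    factorises over the coordinates. *)
Lemma card_net_le : \sum_(j : net | in_net j) 1 <=
  (expR 4 * (2 / (1 - expR (- 1)))) ^+ n :> R.
Proof.
apply: (@le_trans _ _ (\sum_(j : net) expR (4 * nR - \sum_v netvec j v ^+ 2))).
  rewrite [leRHS](bigID in_net) /= -[leLHS]addr0; apply: lerD; last first.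
    by apply: sumr_ge0 => j _; exact: expR_ge0.
  by apply: ler_sum => j jn; rewrite -[leLHS]expR0 ler_expR subr_ge0.
have -> : \sum_(j : net) expR (4 * nR - \sum_v netvec j v ^+ 2) =
   \sum_(j : net) \prod_v (expR 4 * expR (- 1 * zval R (j v) ^+ 2)).
  apply: eq_bigr => j _; under [RHS]eq_bigr do rewrite -expRD; rewrite -expR_sum.
  have s4 : \sum_(v < n) 4 = 4 * nR by rewrite sumr_const card_ord mulr_natr.
  congr expR; rewrite big_split /= s4 -sumrN; congr (_ + _).
  by apply: eq_bigr => v _; rewrite mulN1r.
rewrite -(bigA_distr_bigA (fun (v : 'I_n) (j : bool * 'I_J) => expR 4 * expR (- 1 * zval R j ^+ 2))).
rewrite prodr_const card_ord lerXn2r ?nnegrE//.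
by apply: sumr_ge0 => j _; rewrite mulr_ge0 ?expR_ge0.
by rewrite -mulr_sumr ler_wpM2l ?expR_ge0// sum_gauss_le.
Qed.

Lemma bilE X (x z : 'I_n -> R) :
  bil X x z = \sum_e (\sum_u \sum_v M e u v * (x u * z v)) * Y X e.
Proof.
rewrite /bil; under [RHS]eq_bigr do rewrite mulr_suml.
rewrite [RHS]exchange_big; apply: eq_bigr => u _ /=.
under [RHS]eq_bigr do rewrite mulr_suml.
rewrite [RHS]exchange_big mulr_sumr; apply: eq_bigr => v _ /=.
rewrite /ym mulr_suml mulr_sumr; apply: eq_bigr => e _; ring.
Qed.

(** Exponential Markov inequality with parameter 1 / sqrt n. The coefficients of the linear form
    have square sum at most 2 (4 n)^2 = 32 n^2, which produces the exponent 8 n / c. *)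
Lemma sum_pw_bil_gt (K1 : R) (x z : 'I_n -> R) :
  \sum_u x u ^+ 2 <= 4 * nR -> \sum_u z u ^+ 2 <= 4 * nR ->
  \sum_(X in Omega n k) pw X * (K1 * nR * Num.sqrt nR < bil X x z)%R%:R <=
  expR (- (K1 - 8 / c) * nR).
Proof.
move=> xn zn; have n2 := nR_ge2 R n1; have n0 : 0 < nR by lra.
set s := Num.sqrt nR; have s0 : 0 < s by rewrite sqrtr_gt0.
have s2 : s ^+ 2 = nR by rewrite sqr_sqrtr// ltW.
pose q e : R := \sum_u \sum_v M e u v * (x u * z v).
have q2 : \sum_e q e ^+ 2 <= 32 * nR ^+ 2.
  have h e : q e ^+ 2 <= 2 * \sum_(i : 'I_n * 'I_n) M e i.1 i.2 * (x i.1 * z i.2) ^+ 2.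
    rewrite /q pair_bigA /=; apply: (le_trans (sqr_weighted_sum_le _ _)).
      by move=> i; exact: M_ge0.
    apply: ler_wpM2r; first by apply: sumr_ge0 => i _; rewrite mulr_ge0 ?M_ge0 ?sqr_ge0.
    rewrite -(pair_bigA _ (fun u w => M e u w)) /=.
    by under eq_bigr do rewrite sum_M_row; rewrite sum_chi.
  apply: (le_trans (ler_sum _ (fun e _ => h e))).
  rewrite -mulr_sumr exchange_big /=.
  apply: (@le_trans _ _ (2 * \sum_(i : 'I_n * 'I_n) (x i.1 ^+ 2 * z i.2 ^+ 2))).
    rewrite ler_wpM2l//; apply: ler_sum => i _.
    rewrite -mulr_suml sum_M_edge exprMn; apply: ler_piMl; first by nonneg.
    by rewrite lern1 leq_b1.
  rewrite -(pair_bigA _ (fun u w => x u ^+ 2 * z w ^+ 2)) /=.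
  under eq_bigr do rewrite -mulr_sumr; rewrite -mulr_suml.
  have -> : 32 * nR ^+ 2 = 2 * ((4 * nR) * (4 * nR)) by ring.
  by rewrite ler_wpM2l// ler_pM// sumr_ge0// => u _; exact: sqr_ge0.
apply: (@le_trans _ _ (\sum_X pw X * (expR (- K1 * nR) * expR (\sum_e (s^-1 * q e) * Y X e)))).
  rewrite [leRHS](bigID (fun X => X \in Omega n k)) /= -[leLHS]addr0; apply: lerD; last first.
    by apply: sumr_ge0 => X _; rewrite !mulr_ge0 ?(pw_ge0 p01) ?expR_ge0.
  apply: ler_sum => X _; rewrite ler_wpM2l ?(pw_ge0 p01)// -expRD.
  case: ltP => [h|_] /=; last exact: expR_ge0.
  rewrite -[leLHS]expR0 ler_expR.
  have -> : \sum_e s^-1 * q e * Y X e = s^-1 * bil X x z.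
    by rewrite bilE mulr_sumr; apply: eq_bigr => e _; rewrite mulrA.
  have : K1 * nR <= s^-1 * bil X x z by rewrite ler_pdivlMl// mulrC ltW.
  by lra.
have -> : \sum_X pw X * (expR (- K1 * nR) * expR (\sum_e (s^-1 * q e) * Y X e)) =
   expR (- K1 * nR) * \sum_X pw X * expR (\sum_e (s^-1 * q e) * Y X e).
  by rewrite mulr_sumr; apply: eq_bigr => X _; rewrite mulrCA.
have h := sum_pw_expR_le p01 subgauss (fun e => s^-1 * q e).
apply: (le_trans (ler_wpM2l (expR_ge0 _) h)); rewrite -expRD ler_expR.
have -> : \sum_e (s^-1 * q e) ^+ 2 = (\sum_e q e ^+ 2) / nR.
  by rewrite -s2 mulr_suml; apply: eq_bigr => e _; rewrite exprMn exprVn mulrC.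
have : (4 * c)^-1 * ((\sum_e q e ^+ 2) / nR) <= (4 * c)^-1 * (32 * nR ^+ 2 / nR).
  by rewrite ler_wpM2l ?invr_ge0 ?mulr_ge0 ?(ltW c0)// ler_wpM2r// invr_ge0 ltW.
have -> : (4 * c)^-1 * (32 * nR ^+ 2 / nR) = 8 / c * nR by field; rewrite !gt_eqF.
by lra.
Qed.

Lemma sum_pw_net_bad_le (K1 : R) :
  \sum_(X in Omega n k) pw X * (net_bad K1 X)%:R <=
  ((expR 4 * (2 / (1 - expR (- 1)))) ^+ n) ^+ 2 * expR (- (K1 - 8 / c) * nR).
Proof.
have ub X : (net_bad K1 X)%:R <= \sum_(j : net | in_net j) \sum_(j' : net | in_net j')
    (K1 * nR * Num.sqrt nR < bil X (netvec j) (netvec j'))%R%:R :> R.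
  have s0 (P : pred net) (F : net -> bool) : 0 <= \sum_(j | P j) (F j)%:R :> R.
    by apply: sumr_ge0 => j _.
  case: (boolP (net_bad K1 X)) => [/existsP[j /existsP[j' /and3P[h1 h2 h3]]]|_]; last first.
    by apply: sumr_ge0 => j _.
  rewrite (bigD1 j)//= ler_wpDr ?sumr_ge0// (bigD1 j')//= ler_wpDr ?sumr_ge0//.
  by rewrite h3.
apply: (@le_trans _ _ (\sum_(j : net | in_net j) \sum_(j' : net | in_net j')
    \sum_(X in Omega n k) pw X *
     (K1 * nR * Num.sqrt nR < bil X (netvec j) (netvec j'))%R%:R)).
  under [leRHS]eq_bigr do rewrite exchange_big; rewrite [leRHS]exchange_big /=.
  apply: ler_sum => X _; apply: (le_trans (ler_wpM2l (pw_ge0 p01 X) (ub X))).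
  rewrite mulr_sumr; apply: ler_sum => j _; rewrite mulr_sumr; exact: ler_sum.
apply: (@le_trans _ _ (\sum_(j : net | in_net j) \sum_(j' : net | in_net j')
    1 * (1 * expR (- (K1 - 8 / c) * nR)))).
  apply: ler_sum => j jn; apply: ler_sum => j' jn'; rewrite !mul1r.
  exact: sum_pw_bil_gt.
under eq_bigr do rewrite -mulr_sumr -mulr_suml.
rewrite -mulr_suml mulrA expr2; apply: ler_wpM2r; first exact: expR_ge0.
have n0 : 0 <= \sum_(j : net | in_net j) 1 :> R by apply: sumr_ge0.
by apply: ler_pM => //; exact: card_net_le.
Qed.

End GaussianBound.

(** * Operator norm from a lattice net *)

Section OperatorNorm.
Variables (R : realType) (n : nat) (p : R).
Implicit Types (X : graph n) (u v w : 'I_n) (x z : 'I_n -> R).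

Local Notation nR := (n%:R : R).
Local Notation bil := (bil p).

Hypothesis n1 : (1 < n)%N.
Hypothesis p01 : 0 < p < 1.

Definition in_ball x : Prop := \sum_u x u ^+ 2 <= nR.

(** The supremum S over the ball satisfies S <= b/2 + S/2, hence S <= b; [U] only guarantees that S
    is finite. *)
Lemma ball_fixpoint_le (phi : ('I_n -> R) -> R) (U b : R) :
  (forall x, in_ball x -> phi x <= U) ->
  (forall x, in_ball x -> exists2 x', in_ball x' & phi x <= b / 2 + phi x' / 2) ->
  forall x, in_ball x -> phi x <= b.
Proof.
move=> ub rec x xb; pose S : set R := [set phi z | z in [set z | in_ball z]].
have Sub : has_ubound S by exists U => _ [z zb <-]; exact: ub.
have S0 : S !=set0 by exists (phi x), x.
have le_sup z : in_ball z -> phi z <= sup S.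
  by move=> zb; apply: ub_le_sup => //; exists z.
apply: (le_trans (le_sup x xb)).
have : sup S <= b / 2 + sup S / 2.
  apply: ge_sup => // _ [z zb <-]; have [z' zb' h] := rec z zb.
  by have := le_sup z' zb'; lra.
by lra.
Qed.

Lemma in_ball_coord x u : in_ball x -> `|x u| <= nR.
Proof.
have n2 := nR_ge2 R n1; move=> xb; have : x u ^+ 2 <= nR.
  apply: le_trans xb; rewrite (bigD1 u)//= lerDl; apply: sumr_ge0 => v _.
  exact: sqr_ge0.
rewrite -(real_normK (num_real (x u))); have := normr_ge0 (x u) => h0 h1.
rewrite -(ler_pXn2r (n := 2))// ?nnegrE//.
by apply: (le_trans h1); rewrite expr2; nra.
Qed.

(** The rounding error of 2 x is at most 1 in each coordinate, so its squared norm is at most n and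
    it lies in the ball again. *)
Lemma in_ball_round x : in_ball x -> exists2 j : {ffun 'I_n -> bool * 'I_(2 * n).+1},
  in_net R j & in_ball (fun v => 2 * x v - netvec R j v).
Proof.
move=> xb.
have h v : exists j : bool * 'I_(2 * n).+1,
    `|2 * x v - zval R j| <= 1 /\ `|zval R j| <= `|2 * x v|.
  apply: zval_round; have := in_ball_coord v xb.
  by rewrite normrM ger0_norm// -[(2 * n).+1%:R]natr1 natrM; lra.
have [f fP] := fin_all_exists h.
exists [ffun v => f v].
  rewrite /in_net; apply: (@le_trans _ _ (\sum_v 4 * x v ^+ 2)).
    apply: ler_sum => v _; rewrite /netvec ffunE.
    have -> : 4 * x v ^+ 2 = (2 * x v) ^+ 2 by ring.
    rewrite -[leLHS]real_normK ?num_real// -[leRHS]real_normK ?num_real//.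
    by rewrite lerXn2r ?nnegrE//; have [] := fP v.
  by rewrite -mulr_sumr ler_wpM2l.
rewrite /in_ball; apply: (@le_trans _ _ (\sum_(v < n) 1)).
  apply: ler_sum => v _; rewrite /netvec ffunE -[leLHS]real_normK ?num_real//.
  by rewrite expr_le1//; have [] := fP v.
by rewrite sumr_const card_ord.
Qed.

Lemma bil_half_l X x a b z : (forall v, x v = (a v + b v) / 2) ->
  bil X x z = bil X a z / 2 + bil X b z / 2.
Proof.
move=> xE; rewrite /bil !mulr_suml -big_split; apply: eq_bigr => v _ /=.
by rewrite xE; set s := \sum_w _; ring.
Qed.

Lemma bil_half_r X x z a b : (forall v, z v = (a v + b v) / 2) ->
  bil X x z = bil X x a / 2 + bil X x b / 2.
Proof.
move=> zE; rewrite /bil !mulr_suml -big_split; apply: eq_bigr => u _ /=.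
rewrite -!mulrA -mulrDr; congr (_ * _); rewrite !mulr_suml -big_split.
by apply: eq_bigr => v _ /=; rewrite zE; set s := ym _ _ _ _; ring.
Qed.

Lemma bilZ X x z a b : bil X (fun v => a * x v) (fun v => b * z v) = a * b * bil X x z.
Proof.
rewrite /bil mulr_sumr; apply: eq_bigr => u _.
rewrite -!mulrA; congr (_ * _); rewrite !mulrA [b * x u]mulrC -mulrA; congr (_ * _).
by rewrite mulr_sumr; apply: eq_bigr => v _; rewrite mulrCA.
Qed.

Lemma bil_crude X x z : in_ball x -> in_ball z -> bil X x z <= nR ^+ 4.
Proof.
move=> xb zb; apply: (le_trans (ler_norm _)).
apply: (@le_trans _ _ (\sum_(u < n) nR * \sum_(v < n) (1 * nR))).
  apply: (le_trans (ler_norm_sum _ _ _)); apply: ler_sum => u _.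
  rewrite normrM; apply: ler_pM => //; first exact: in_ball_coord.
  apply: (le_trans (ler_norm_sum _ _ _)); apply: ler_sum => v _.
  by rewrite normrM; apply: ler_pM => //; [exact: normr_ym_le1|exact: in_ball_coord].
have sc (a : R) : \sum_(v < n) a = nR * a by rewrite sumr_const card_ord mulr_natl.
by rewrite !sc le_eqVlt; apply/orP; left; apply/eqP; ring.
Qed.

(* Each point of the ball is half a net vector plus half another point of the
   ball, so a bound on the net extends to the ball without loss. *)
Lemma bil_ball_le K1 X x z : ~~ net_bad p K1 X -> in_ball x -> in_ball z ->
  bil X x z <= K1 * nR * Num.sqrt nR.
Proof.
move=> nb xb zb; set b := K1 * nR * _.
have netb j j' : in_net R j -> in_net R j' -> bil X (netvec R j) (netvec R j') <= b.
  move=> h1 h2; rewrite leNgt; apply: contra nb => h3.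
  by apply/existsP; exists j; apply/existsP; exists j'; rewrite h1 h2.
have netball j y : in_net R j -> in_ball y -> bil X (netvec R j) y <= b.
  move=> jn yb.
  have hU y' : in_ball y' -> bil X (netvec R j) y' <= 16 * nR ^+ 4.
    move=> yb'; have hb : in_ball (fun v => 2^-1 * netvec R j v).
      rewrite /in_ball; under eq_bigr do rewrite exprMn.
      rewrite -mulr_sumr; move: jn; rewrite /in_net => h.
      by have := ler_wpM2l (sqr_ge0 (2^-1 : R)) h; lra.
    have := bil_crude X hb yb'.
    have -> : bil X (fun v => 2^-1 * netvec R j v) y' = 2^-1 * 1 * bil X (netvec R j) y'.
      by rewrite -bilZ; congr (bil X _ _); apply: funext => v; rewrite mul1r.
    by have := exprn_ge0 4 (ler0n R n); lra.
  apply: (ball_fixpoint_le hU) => // y' yb'; have [j' jn' hb] := in_ball_round yb'.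
  exists (fun v => 2 * y' v - netvec R j' v) => //.
  rewrite (@bil_half_r X _ y' (netvec R j') (fun v => 2 * y' v - netvec R j' v)).
    by have := netb _ _ jn jn'; lra.
  by move=> v; field.
apply: (@ball_fixpoint_le (fun y => bil X y z) (nR ^+ 4)) => //.
  by move=> y yb; exact: bil_crude.
move=> y yb; have [j jn hb] := in_ball_round yb.
exists (fun v => 2 * y v - netvec R j v) => //.
rewrite (@bil_half_l X y (netvec R j) (fun v => 2 * y v - netvec R j v)).
  by have := netball _ _ jn zb; lra.
by move=> v; field.
Qed.

(** Both vectors are rescaled to norm sqrt n, and both signs of the first are used. A value K1 n
    sqrt n on such vectors means operator norm K1 sqrt n, hence [K1 ^+ 2]. *)
Lemma net_good_opnorm K1 X : 0 <= K1 -> ~~ net_bad p K1 X ->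
  opnorm_le p (K1 ^+ 2) X.
Proof.
move=> K0 nb x z; have n2 := nR_ge2 R n1; have n0 : 0 < nR by lra.
have s0 (a : 'I_n -> R) : 0 <= \sum_u a u ^+ 2 by apply: sumr_ge0 => u _; exact: sqr_ge0.
have z0 (a : 'I_n -> R) : \sum_u a u ^+ 2 = 0 -> forall u, a u = 0.
  move=> /eqP; rewrite psumr_eq0; last by move=> u _; exact: sqr_ge0.
  by move=> /allP h u; have := h u (mem_index_enum _); rewrite sqrf_eq0 => /eqP.
have [/z0 x0|x0] := eqVneq (\sum_u x u ^+ 2) 0.
  rewrite /bil big1 ?expr0n/=; first by rewrite !mulr_ge0 ?sqr_ge0.
  by move=> u _; rewrite x0 mul0r.
have [/z0 zz0|zz0] := eqVneq (\sum_u z u ^+ 2) 0.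
  rewrite /bil big1 ?expr0n/=; first by rewrite !mulr_ge0 ?sqr_ge0.
  by move=> u _; rewrite big1 ?mulr0// => v _; rewrite zz0 mulr0.
have xs : 0 < \sum_u x u ^+ 2 by rewrite lt_neqAle eq_sym x0 s0.
have zs : 0 < \sum_u z u ^+ 2 by rewrite lt_neqAle eq_sym zz0 s0.
set A := \sum_u x u ^+ 2 in xs *; set B := \sum_u z u ^+ 2 in zs *.
pose a := Num.sqrt (nR / A); pose b := Num.sqrt (nR / B).
have a2 : a ^+ 2 = nR / A by rewrite sqr_sqrtr// divr_ge0// ltW.
have b2 : b ^+ 2 = nR / B by rewrite sqr_sqrtr// divr_ge0// ltW.
have ab : in_ball (fun v => a * x v).
  rewrite /in_ball; under eq_bigr do rewrite exprMn.
  by rewrite -mulr_sumr a2 divfK// gt_eqF.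
have abN : in_ball (fun v => - a * x v).
  rewrite /in_ball; under eq_bigr do rewrite exprMn sqrrN.
  by rewrite -mulr_sumr a2 divfK// gt_eqF.
have bb : in_ball (fun v => b * z v).
  rewrite /in_ball; under eq_bigr do rewrite exprMn.
  by rewrite -mulr_sumr b2 divfK// gt_eqF.
have h1 := bil_ball_le nb ab bb; have h2 := bil_ball_le nb abN bb.
rewrite !bilZ in h1 h2.
have hs : (a * b * bil X x z) ^+ 2 <= (K1 * nR * Num.sqrt nR) ^+ 2.
  rewrite -[leLHS]real_normK ?num_real// lerXn2r ?nnegrE ?mulr_ge0 ?sqrtr_ge0//.
  by rewrite ler_norml h1 andbT; lra.
have sn : Num.sqrt nR ^+ 2 = nR by rewrite sqr_sqrtr// ltW.
rewrite !exprMn a2 b2 sn in hs.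
have -> : K1 ^+ 2 * nR * A * B = (K1 ^+ 2 * nR ^+ 2 * nR) * (A * B / nR ^+ 2).
  by field; rewrite gt_eqF.
have -> : bil X x z ^+ 2 = (nR / A * (nR / B) * bil X x z ^+ 2) * (A * B / nR ^+ 2).
  by field; rewrite !gt_eqF.
apply: ler_wpM2r => //; apply: divr_ge0; last exact: sqr_ge0.
by rewrite mulr_ge0// ltW.
Qed.

End OperatorNorm.

(** * Probability of the bad event *)

Section BadEvent.
Variable R : realType.

Definition good (n : nat) (p K : R) (X : graph n) : bool :=
  `[< f2 p X <= K * n%:R ^+ 2 /\ opnorm_le p K X >].

(** A large [f2] is excluded by raising beta to beta + eta/2, still below the Gaussian threshold.
    Where f2 <= K2 n^2, the Gibbs density is at most exp (b0 K2 n), and [K1] is taken large enough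
    for the net bound to beat this. *)
Lemma bad_event_le (eta b0 : R) : 0 < eta -> 0 <= b0 -> exists2 K : R, 0 <= K &
  forall (n k : nat) (p beta : R), k%:R = 'C(n, 2)%:R * p -> (1 < n)%N ->
  0 < p < 1 -> 0 <= beta <= b0 ->
  (forall t, p * expR ((1 - p) * t) + (1 - p) * expR (- p * t) <=
     expR (t ^+ 2 / (4 * (beta + eta)))) ->
  gibbs_mean k beta (fun X : graph n => (~~ good p K X)%:R) <= 4 * expR (- n%:R).
Proof.
move=> eta0 b00.
pose rho := (eta / 2) / (b0 + eta).
have rho0 : 0 < rho by rewrite !divr_gt0//; lra.
pose Ch := expR 1 * (2 / (1 - expR (- rho))).
pose Cn := expR 4 * (2 / (1 - expR (- 1))) : R.
have Chpos r : 0 < r -> 0 < expR 1 * (2 / (1 - expR (- r))) :> R.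
  by move=> r0; rewrite mulr_gt0 ?expR_gt0// divr_gt0// subr_gt0 expR_lt1; lra.
have Ch0 : 0 < Ch by exact: Chpos.
have Cn0 : 0 < Cn by rewrite /Cn mulr_gt0 ?expR_gt0// divr_gt0// subr_gt0 expR_lt1; lra.
(* Makes (eta/2) K2 = |ln Ch| + 2: this pays for Ch^n, for N + 1 <= 2 e^n, and leaves e^-n. *)
pose K2 := 2 / eta * (`|ln Ch| + 2).
have K20 : 0 <= K2 by rewrite mulr_ge0 ?divr_ge0 ?addr_ge0 ?(ltW eta0).
(* The summands pay for N + 1 and the final e^-n, for the Gibbs density, for the two nets, and for
   the exponent 8 / (beta + eta) of [sum_pw_bil_gt]. *)
pose K1 := 2 + b0 * K2 + 2 * `|ln Cn| + 8 / eta.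
have K10 : 0 <= K1.
  have h1 : 0 <= b0 * K2 by rewrite mulr_ge0.
  have h2 : 0 <= 8 / eta by rewrite divr_ge0 ?(ltW eta0).
  by have := normr_ge0 (ln Cn); rewrite /K1; lra.
exists (K2 + K1 ^+ 2); first by rewrite addr_ge0 ?sqr_ge0.
move=> n k p beta kE n1 p01 /andP[be0 be1] sg.
have n2 := nR_ge2 R n1; have n0 : 0 < n%:R :> R by lra.
set nR := n%:R : R in n2 n0 *.
have c0 : 0 < beta + eta by lra.
set N1 : R := #|{: edge n}|%:R + 1.
have N1le : N1 <= 2 * expR nR.
  have h := N_le R n1; have : nR ^+ 2 / 2 <= expR nR.
    have := expR_ge1Dxn 1 (ltW n0); rewrite /= => hh.
    by rewrite (_ : nR ^+ 2 / 2 = nR ^+ 2 / 2`!%:R)//; lra.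
  have : 1 <= expR nR by rewrite -[leLHS]expR0 ler_expR ltW.
  by rewrite /N1; lra.
have N10 : 0 <= N1 by rewrite addr_ge0.
have ind (X : graph n) : (~~ good p (K2 + K1 ^+ 2) X)%:R <=
    (K2 * nR ^+ 2 < f2 p X)%R%:R +
    ((f2 p X <= K2 * nR ^+ 2) && net_bad p K1 X)%:R :> R.
  case: (boolP (good _ _ _)) => [_|gX] /=; first by rewrite addr_ge0.
  case: ltP => hf /=; first by rewrite lerDl.
  case: (boolP (net_bad p K1 X)) => hb /=; first by rewrite lerDr.
  exfalso; move/negP: gX; apply; apply/asboolP; split.
    apply: (le_trans hf); apply: ler_wpM2r; first exact: sqr_ge0.
    by rewrite lerDl sqr_ge0.
  have op := net_good_opnorm n1 p01 K10 hb; move=> x z.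
  apply: (le_trans (op x z)).
  have s0 (a : 'I_n -> R) : 0 <= \sum_u a u ^+ 2 by apply: sumr_ge0 => u _; exact: sqr_ge0.
  by do 3 rewrite ler_wpM2r//; rewrite lerDr.
apply: le_trans; first by apply: ler_Mean => X _; exact: ind.
rewrite MeanD; have -> : 4 * expR (- nR) = 2 * expR (- nR) + 2 * expR (- nR) by ring.
apply: lerD.
- apply: (le_trans (Mean_le_pw kE n1 p01 be0 _)) => //.
  pose b := beta + eta / 2.
  have h1 : \sum_(X in Omega n k) pw p X * (expR (beta / nR * f2 p X) *
      (K2 * nR ^+ 2 < f2 p X)%R%:R) <=
      expR (- (eta / 2 * K2) * nR) * \sum_(X in Omega n k) pw p X * expR (b / nR * f2 p X).
    rewrite mulr_sumr; apply: ler_sum => X _; rewrite [leRHS]mulrCA.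
    apply: ler_wpM2l; first exact: pw_ge0.
    rewrite -expRD; case: ltP => [h|_]; last by rewrite mulr0 expR_ge0.
    rewrite mulr1 ler_expR.
    have -> : b / nR * f2 p X = beta / nR * f2 p X + eta / 2 / nR * f2 p X.
      by rewrite /b; ring.
    have : eta / 2 / nR * (K2 * nR ^+ 2) <= eta / 2 / nR * f2 p X.
      by rewrite ler_wpM2l ?(ltW h)// !divr_ge0// ltW.
    have -> : eta / 2 / nR * (K2 * nR ^+ 2) = eta / 2 * K2 * nR by field; rewrite gt_eqF.
    by lra.
  have bc : 0 <= b < beta + eta by rewrite /b; apply/andP; split; lra.
  have h2 := sum_pw_expR_f2_le kE n1 p01 c0 sg bc.
  have h3 : (expR 1 * (2 / (1 - expR (- (1 - b / (beta + eta)))))) ^+ n <= Ch ^+ n.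
    have rr : rho <= 1 - b / (beta + eta).
      have -> : 1 - b / (beta + eta) = (eta / 2) / (beta + eta).
        by rewrite /b; field; rewrite gt_eqF.
      rewrite /rho ler_wpM2l ?divr_ge0 ?(ltW eta0)// lef_pV2 ?posrE//; lra.
    have r0 : 0 < 1 - b / (beta + eta) by apply: lt_le_trans rr.
    rewrite lerXn2r ?nnegrE ?(ltW (Chpos _ _))//.
    rewrite ler_wpM2l ?expR_ge0// ler_wpM2l// lef_pV2 ?posrE ?subr_gt0 ?expR_lt1; try lra.
    by rewrite lerB// ler_expR lerN2.
  have ChE : Ch ^+ n = expR (ln Ch * nR) by rewrite expRM_natr lnK// posrE.
  apply: (le_trans (ler_wpM2l N10 h1)).
  apply: (@le_trans _ _ (2 * expR nR * (expR (- (eta / 2 * K2) * nR) * expR (ln Ch * nR)))).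
    apply: ler_pM => //.
      rewrite mulr_ge0 ?expR_ge0//; apply: sumr_ge0 => X _.
      by rewrite mulr_ge0 ?pw_ge0 ?expR_ge0.
    by rewrite ler_wpM2l ?expR_ge0// -ChE (le_trans h2).
  have -> : eta / 2 * K2 = `|ln Ch| + 2 by rewrite /K2; field; rewrite gt_eqF.
  rewrite -[leLHS]mulrA ler_wpM2l// -!expRD ler_expR.
  have : ln Ch * nR <= `|ln Ch| * nR by rewrite ler_wpM2r ?(ltW n0)// ler_norm.
  by lra.
- apply: (le_trans (Mean_le_pw kE n1 p01 be0 _)) => //.
  have h1 : \sum_(X in Omega n k) pw p X * (expR (beta / nR * f2 p X) *
      ((f2 p X <= K2 * nR ^+ 2) && net_bad p K1 X)%:R) <=
      expR (b0 * K2 * nR) * \sum_(X in Omega n k) pw p X * (net_bad p K1 X)%:R.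
    rewrite mulr_sumr; apply: ler_sum => X _.
    rewrite [leRHS]mulrCA; apply: ler_wpM2l; first exact: pw_ge0.
    case: (leP (f2 p X) (K2 * nR ^+ 2)) => [h|_] /=; last first.
      by rewrite mulr0 mulr_ge0 ?expR_ge0.
    apply: ler_wpM2r => //; rewrite ler_expR.
    apply: (@le_trans _ _ (b0 / nR * (K2 * nR ^+ 2))).
      apply: ler_pM => //; [by rewrite divr_ge0// ltW|exact: f2_ge0|].
      by rewrite ler_wpM2r// invr_ge0 ltW.
    rewrite le_eqVlt; apply/orP; left; apply/eqP; field; rewrite gt_eqF//.
  have h2 := sum_pw_net_bad_le k n1 p01 c0 sg K1.
  rewrite -/Cn in h2.
  have CnE : Cn ^+ n = expR (ln Cn * nR) by rewrite expRM_natr lnK// posrE.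
  apply: (le_trans (ler_wpM2l N10 h1)).
  apply: (@le_trans _ _ (2 * expR nR * (expR (b0 * K2 * nR) *
      (expR (ln Cn * nR) ^+ 2 * expR (- (K1 - 8 / (beta + eta)) * nR))))).
    apply: ler_pM => //.
      rewrite mulr_ge0 ?expR_ge0//; apply: sumr_ge0 => X _.
      by rewrite mulr_ge0 ?pw_ge0.
    by rewrite ler_wpM2l ?expR_ge0// -CnE.
  rewrite expr2 -[leLHS]mulrA ler_wpM2l// -!expRD ler_expR.
  have h4 : ln Cn * nR <= `|ln Cn| * nR by rewrite ler_wpM2r ?(ltW n0)// ler_norm.
  have h5 : 8 / (beta + eta) * nR <= 8 / eta * nR.
    by rewrite ler_wpM2r ?(ltW n0)// ler_wpM2l// lef_pV2 ?posrE//; lra.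
  move: h4 h5; rewrite /K1; set a := 8 / (beta + eta); set a' := 8 / eta.
  by set l := ln Cn; set l' := `|l|; set q := b0 * K2; lra.
Qed.

End BadEvent.

(** * Tail of a single degree *)

Section DegreeMoves.
Variables (R : realType) (n k : nat) (p beta b0 eta K : R) (v : 'I_n).
Implicit Types (X : graph n) (e f : edge n) (u w : 'I_n).

Local Notation N := (#|{: edge n}|%:R : R).
Local Notation Dv := (Dv p).
Local Notation Se := (Se p).
Local Notation f2 := (f2 p).
Local Notation weight := (weight p beta).
Local Notation nR := (n%:R : R).
Local Notation M := (@M R n).
Local Notation chi := (@chi R n).

Hypothesis kE : k%:R = 'C(n, 2)%:R * p.
Hypothesis n3 : (2 < n)%N.
Hypothesis eta0 : 0 < eta.
Hypothesis petaL : eta <= p.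
Hypothesis petaR : eta <= 1 - p.
Hypothesis beta01 : 0 <= beta <= b0.
Hypothesis K0 : 0 <= K.

Let n1 : (1 < n)%N := ltnW n3.

Lemma eta_p01 : 0 < p < 1. Proof. by move: eta0 petaL petaR => *; apply/andP; split; lra. Qed.

Definition xe X e : R := (X e)%:R.

Lemma xe01 X e : xe X e = 0 \/ xe X e = 1.
Proof. by rewrite /xe; case: (X e); [right|left]. Qed.

Lemma chi01 e : chi e v = 0 \/ chi e v = 1.
Proof. by rewrite /chi; case: (_ \in _); [right|left]. Qed.

Lemma natr_deg X : (deg X v)%:R = \sum_e chi e v * xe X e.
Proof.
rewrite /deg natr_sum big_mkcond /=; apply: eq_bigr => e _.
by rewrite /chi; case: (_ \in _); rewrite ?mul1r ?mul0r.
Qed.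

Lemma Dv_deg X : Dv X v = (deg X v)%:R - p * (nR - 1).
Proof.
rewrite natr_deg -(sum_chi_edge R v) mulr_sumr -sumrB; apply: eq_bigr => e _.
by rewrite /Y /xe; ring.
Qed.

(** Indicator of the swaps that lower the degree of [v] by one. *)
Definition move e f X : R := chi e v * xe X e * ((1 - chi f v) * (1 - xe X f)).

Lemma move_ge0 e f X : 0 <= move e f X.
Proof.
rewrite /move; case: (chi01 e) => ->; case: (xe01 X e) => ->;
  case: (chi01 f) => ->; case: (xe01 X f) => ->; lra.
Qed.

Definition outside X : R := N - (nR - 1) - (k%:R - (deg X v)%:R).

Lemma sum_xe X : X \in Omega n k -> \sum_e xe X e = k%:R.
Proof. by rewrite inE => /eqP <-; rewrite natr_sum. Qed.

Lemma sum_outside X : X \in Omega n k ->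
  \sum_f (1 - chi f v) * (1 - xe X f) = outside X.
Proof.
move=> XO; transitivity (\sum_f (1 + (- chi f v + (- xe X f + chi f v * xe X f)))).
  by apply: eq_bigr => f _; ring.
rewrite !big_split /= sum_edge_const !sumrN sum_chi_edge (sum_xe XO) -natr_deg.
by rewrite /outside; ring.
Qed.

Lemma sum_move X : X \in Omega n k ->
  \sum_e \sum_f move e f X = (deg X v)%:R * outside X.
Proof.
move=> XO; rewrite -(sum_outside XO) natr_deg mulr_suml; apply: eq_bigr => e _.
by rewrite mulr_sumr.
Qed.

(** The self-field D_v, common to all edges of the star, is taken out: it may be of order n, whereas
    the rest averages to O(sqrt n). *)
Lemma sum_move_Se X : X \in Omega n k ->
  \sum_e \sum_f move e f X * (Se X e - Dv X v - Se X f) =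
  outside X * (\sum_e chi e v * xe X e * \sum_u M e v u * Dv X u) -
  (deg X v)%:R * (\sum_f (1 - chi f v) * (1 - xe X f) * Se X f).
Proof.
move=> XO; rewrite -(sum_outside XO) natr_deg.
rewrite mulr_suml [in X in _ = _ - X]mulr_suml.
have hM e : chi e v * (Se X e - Dv X v) = chi e v * \sum_u M e v u * Dv X u.
  case: (chi01 e) => h; first by rewrite h !mul0r.
  rewrite h !mul1r /Se (bigD1 v)//= h mul1r [LHS]addrAC subrr add0r [RHS](bigD1 v)//=.
  rewrite M_diag mul0r add0r; apply: eq_bigr => u uv.
  by rewrite -chi_mul 1?eq_sym// h mul1r.
transitivity (\sum_e \sum_f ((1 - chi f v) * (1 - xe X f) * (xe X e * (chi e v * (Se X e - Dv X v)))
    - chi e v * xe X e * ((1 - chi f v) * (1 - xe X f) * Se X f))).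
  by apply: eq_bigr => e _; apply: eq_bigr => f _; rewrite /move; ring.
transitivity ((\sum_e \sum_f ((1 - chi f v) * (1 - xe X f) * (xe X e * (chi e v * (Se X e - Dv X v)))))
   - \sum_e \sum_f chi e v * xe X e * ((1 - chi f v) * (1 - xe X f) * Se X f)).
  by rewrite -sumrB; apply: eq_bigr => e _; rewrite sumrB.
congr (_ - _).
  rewrite exchange_big; apply: eq_bigr => f _ /=; rewrite mulr_sumr.
  by apply: eq_bigr => e _; rewrite hM; ring.
by apply: eq_bigr => e _; rewrite mulr_sumr.
Qed.

Lemma sum_star_field_le X :
  (\sum_e chi e v * xe X e * \sum_u M e v u * Dv X u) ^+ 2 <= nR * f2 X.
Proof.
have n2 := nR_ge2 R n1.
apply: (le_trans (cauchy_schwarz _ _)); apply: ler_pM.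
- by apply: sumr_ge0 => e _; exact: sqr_ge0.
- by apply: sumr_ge0 => e _; exact: sqr_ge0.
- apply: (@le_trans _ _ (\sum_e chi e v)); last by rewrite sum_chi_edge; lra.
  apply: ler_sum => e _; case: (chi01 e) => ->; case: (xe01 X e) => ->; lra.
apply: (@le_trans _ _ (\sum_e \sum_u M e v u * Dv X u ^+ 2)).
  apply: ler_sum => e _; apply: (le_trans (sqr_weighted_sum_le _ _)).
    by move=> u; exact: M_ge0.
  rewrite sum_M_row; apply: ler_piMl.
    by apply: sumr_ge0 => u _; rewrite mulr_ge0 ?M_ge0 ?sqr_ge0.
  by case: (chi01 e) => ->.
rewrite exchange_big; apply: ler_sum => u _ /=; rewrite -mulr_suml sum_M_edge.
by apply: ler_piMl; [exact: sqr_ge0|rewrite lern1 leq_b1].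
Qed.

Lemma sum_outside_Se_le X : X \in Omega n k ->
  (\sum_f (1 - chi f v) * (1 - xe X f) * Se X f) ^+ 2 <= nR ^+ 3 * f2 X.
Proof.
move=> XO; have n2 := nR_ge2 R n1; have f0 := f2_ge0 p X.
apply: (le_trans (cauchy_schwarz _ _)).
have -> : nR ^+ 3 * f2 X = nR ^+ 2 * (nR * f2 X) by ring.
apply: ler_pM.
- by apply: sumr_ge0 => e _; exact: sqr_ge0.
- by apply: sumr_ge0 => e _; exact: sqr_ge0.
- apply: (@le_trans _ _ (\sum_(e : edge n) 1)).
    apply: ler_sum => e _; case: (chi01 e) => ->; case: (xe01 X e) => ->; lra.
  by rewrite sum_edge_const; have := N_le R n1; have := sqr_ge0 nR; lra.
by rewrite (sum_Se_sq kE XO); apply: ler_wpM2r => //; lra.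
Qed.

Lemma outside_ge X : p * (nR - 1) <= (deg X v)%:R -> eta / 12 * nR ^+ 2 <= outside X.
Proof.
move: eta0 petaL petaR => e0 eL eR da; have n3' : (3 : R) <= nR by rewrite ler_nat.
rewrite /outside kE natr_bin2 N_eq.
have h : nR ^+ 2 / 12 <= (nR - 1) * (nR - 2) / 2 by nra.
have h2 : eta * (nR ^+ 2 / 12) <= (1 - p) * ((nR - 1) * (nR - 2) / 2).
  by apply: ler_pM => //; exact: ltW.
lra.
Qed.

Definition C_move : R := 28 * b0 * (K + 13) / eta.

(** By Cauchy-Schwarz the remaining field, averaged over all admissible moves, is O(sqrt n), so the
    factor beta / n leaves a relative error O(1 / sqrt n). *)
Lemma sum_move_expR_ge X : X \in Omega n k -> f2 X <= (K + 12) * nR ^+ 2 ->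
  p * (nR - 1) <= (deg X v)%:R ->
  (deg X v)%:R * outside X * (expR (- (2 * beta / nR * Dv X v)) * (1 - C_move / Num.sqrt nR))
  <= \sum_e \sum_f move e f X * expR (beta / nR * (f2 (swap e f X) - f2 X)).
Proof.
move: eta0 petaL petaR K0 => e0 eL eR K0' XO fK da.
have n2 := nR_ge2 R n1; have nn0 : 0 < nR by lra.
have [be0 be1] := andP beta01.
set s := Num.sqrt nR; have s0 : 0 < s by rewrite sqrtr_gt0.
have s2 : s ^+ 2 = nR by rewrite sqr_sqrtr// ltW.
set A := (deg X v)%:R; set B := outside X.
have Age : eta / 2 * nR <= A.
  apply: le_trans da; have : eta * (nR / 2) <= p * (nR - 1) by apply: ler_pM; lra.
  lra.
have Bge := outside_ge da; rewrite -/B in Bge.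
set E := expR (- (2 * beta / nR * Dv X v)).
have step : \sum_e \sum_f move e f X * (E * (1 - 2 * beta / nR * (Se X e - Dv X v - Se X f)))
   <= \sum_e \sum_f move e f X * expR (beta / nR * (f2 (swap e f X) - f2 X)).
  apply: ler_sum => e _; apply: ler_sum => f _.
  have [->|mE] : move e f X = 0 \/ (chi e v = 1 /\ xe X e = 1 /\ chi f v = 0 /\ xe X f = 0).
    rewrite /move; case: (chi01 e) => ->; case: (xe01 X e) => ->;
    case: (chi01 f) => ->; case: (xe01 X f) => ->; (try by left; ring); by right.
  by rewrite !mul0r.
  apply: ler_wpM2l; first exact: move_ge0.
  have [h1 [h2 [h3 h4]]] := mE.
  have dE : delta p e f X = 1 by rewrite /delta /Y -/(xe X e) -/(xe X f) h2 h4; ring.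
  rewrite f2_swap dE.
  (* The term with 4 - 2 overlap >= 0 only helps and is dropped. Then 1 + x <= exp x linearises the
     remaining field, while D_v stays in the exponential [E]. *)
  apply: (@le_trans _ _ (E * expR (- (2 * beta / nR * (Se X e - Dv X v - Se X f))))).
    by apply: ler_wpM2l; [exact: expR_ge0|exact: expR_ge1Dx].
  rewrite -expRD ler_expR.
  have o2 := overlap_le2 R e f.
  have : 0 <= beta / nR * (4 - 2 * overlap R e f).
    by apply: mulr_ge0; [rewrite divr_ge0// ltW|lra].
  by rewrite expr1n; lra.
apply: le_trans step.
have -> : \sum_e \sum_f move e f X * (E * (1 - 2 * beta / nR * (Se X e - Dv X v - Se X f))) =
   E * (A * B - 2 * beta / nR * (\sum_e \sum_f move e f X * (Se X e - Dv X v - Se X f))).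
  rewrite -(sum_move XO) mulr_sumr -sumrB mulr_sumr; apply: eq_bigr => e _.
  rewrite mulr_sumr -sumrB mulr_sumr; apply: eq_bigr => f _; ring.
rewrite (sum_move_Se XO) -/A -/B.
set S1 := \sum_e _; set S2 := \sum_f _.
rewrite mulrCA; apply: ler_wpM2l; first exact: expR_ge0.
(* [K + 13] stands in for the square root of [K + 12], since K + 12 <= (K + 13)^2. *)
have L0 : 0 <= K + 13 by lra.
have S1le : S1 <= (K + 13) * nR * s.
  apply: (le_trans (ler_norm _)); rewrite -(ler_pXn2r (n := 2))// ?nnegrE; [|by nonneg].
  rewrite real_normK ?num_real//; apply: (le_trans (sum_star_field_le X)).
  rewrite !exprMn s2.
  apply: (@le_trans _ _ (nR * ((K + 12) * nR ^+ 2))); first by rewrite ler_wpM2l ?(ltW nn0).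
  have -> : nR * ((K + 12) * nR ^+ 2) = (K + 12) * (nR ^+ 2 * nR) by ring.
  rewrite -[leRHS]mulrA; apply: ler_wpM2r; first by nonneg.
  by nra.
have S2le : - S2 <= (K + 13) * nR ^+ 2 * s.
  apply: (le_trans (ler_norm _)); rewrite normrN -(ler_pXn2r (n := 2))// ?nnegrE; [|by nonneg].
  rewrite real_normK ?num_real//; apply: (le_trans (sum_outside_Se_le XO)).
  rewrite !exprMn s2.
  apply: (@le_trans _ _ (nR ^+ 3 * ((K + 12) * nR ^+ 2))); first by rewrite ler_wpM2l ?exprn_ge0 ?(ltW nn0).
  have -> : nR ^+ 3 * ((K + 12) * nR ^+ 2) = (K + 12) * ((nR ^+ 2) ^+ 2 * nR) by ring.
  rewrite -[leRHS]mulrA; apply: ler_wpM2r; first by nonneg.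
  by nra.
have A0 : 0 < A by apply: lt_le_trans Age; rewrite mulr_gt0// divr_gt0.
have B0 : 0 < B by apply: lt_le_trans Bge; rewrite mulr_gt0 ?divr_gt0 ?exprn_gt0.
have T1 : B * S1 <= A * B * (2 * (K + 13) / eta * s).
  apply: (@le_trans _ _ (B * ((K + 13) * nR * s))); first by rewrite ler_pM2l.
  have -> : B * ((K + 13) * nR * s) = (eta / 2 * nR) * (B * (2 * (K + 13) / eta * s)).
    by field; rewrite gt_eqF.
  rewrite -[leRHS]mulrA; apply: ler_wpM2r => //.
  by apply: mulr_ge0; [exact: ltW|apply: mulr_ge0; [rewrite divr_ge0 ?mulr_ge0 ?(ltW eta0)|exact: ltW]].
have T2 : A * (- S2) <= A * B * (12 * (K + 13) / eta * s).
  apply: (@le_trans _ _ (A * ((K + 13) * nR ^+ 2 * s))); first by rewrite ler_pM2l.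
  have -> : A * ((K + 13) * nR ^+ 2 * s) = (eta / 12 * nR ^+ 2) * (A * (12 * (K + 13) / eta * s)).
    by field; rewrite gt_eqF.
  rewrite [A * B]mulrC -[leRHS]mulrA; apply: ler_wpM2r => //.
  by apply: mulr_ge0; [exact: ltW|apply: mulr_ge0; [rewrite divr_ge0 ?mulr_ge0 ?(ltW eta0)|exact: ltW]].
have T3 : B * S1 - A * S2 <= A * B * (14 * (K + 13) / eta * s).
  have -> : 14 * (K + 13) / eta * s = 2 * (K + 13) / eta * s + 12 * (K + 13) / eta * s by ring.
  by rewrite mulrDr; lra.
have T4 : 2 * beta / nR * (B * S1 - A * S2) <= A * B * (C_move / s).
  apply: (@le_trans _ _ (2 * beta / nR * (A * B * (14 * (K + 13) / eta * s)))).
    by apply: ler_wpM2l => //; rewrite divr_ge0 ?mulr_ge0 ?(ltW nn0).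
  apply: (@le_trans _ _ (2 * b0 / nR * (A * B * (14 * (K + 13) / eta * s)))).
    apply: ler_wpM2r; last by rewrite ler_wpM2r ?invr_ge0 ?(ltW nn0)//; lra.
    apply: mulr_ge0; first by rewrite mulr_ge0// ltW.
    by apply: mulr_ge0; [rewrite divr_ge0 ?mulr_ge0 ?(ltW eta0)|exact: ltW].
  rewrite le_eqVlt; apply/orP; left; apply/eqP; rewrite /C_move -s2; field.
  by rewrite !gt_eqF.
by rewrite mulrBr mulr1 lerD2l lerN2.
Qed.

(* A swap changes [f2] by at most [12 n], so the truncation level must grow as the
   degree goes down for the slices to be linked by single moves. *)
Definition theta (a : nat) : R := K * nR ^+ 2 + 12 * nR * (nR - a%:R).

Definition slice a X : bool := [&& X \in Omega n k, deg X v == a & f2 X <= theta a].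

Definition slice_weight a : R := \sum_(X | slice a X) weight X.

(** The move is made at the swapped graph and lands at [X], one degree lower and within the larger
    truncation level. *)
Lemma slice_swap a e f X : (0 < a)%N -> slice a (swap e f X) -> 0 < move e f (swap e f X) ->
  slice a.-1 X /\ move e f (swap e f X) = chi e v * (1 - xe X e) * ((1 - chi f v) * xe X f).
Proof.
move: K0 => K0' a0 /and3P[XO /eqP da fa]; rewrite /move.
have x1 : xe (swap e f X) e = xe X f by rewrite /xe ffunE tpermL.
have x2 : xe (swap e f X) f = xe X e by rewrite /xe ffunE tpermR.
rewrite x1 x2.
case: (chi01 e) => h1; case: (xe01 X f) => h2; case: (chi01 f) => h3;
  case: (xe01 X e) => h4; rewrite h1 h2 h3 h4 ?mul0r ?mulr0 ?subrr ?mul0r ?mulr0 ?ltxx// => _.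
split; last by ring.
rewrite swap_Omega in XO.
have dE : delta p e f X = -1 by rewrite /delta /Y -/(xe X e) -/(xe X f) h2 h4; ring.
have dX : (deg X v).+1 = a.
  apply/eqP; rewrite -(eqr_nat R) -natr1 -da.
  have := Dv_swap p e f X v; rewrite !Dv_deg dE h1 h3 => h; apply/eqP; lra.
rewrite /slice XO -dX /= eqxx /=.
have := f2_swap p e f X; rewrite dE => fE.
have n2 := nR_ge2 R n1.
have o0 := overlap_ge0 R e f; have o2 := overlap_le2 R e f.
have := normr_Se_le eta_p01 X e; have := normr_Se_le eta_p01 X f.
rewrite !ler_norml => /andP[q1 q2] /andP[q3 q4].
move: fa; rewrite fE /theta -dX -natr1; lra.
Qed.

(** Double counting by the target: a graph in which [v] has degree a - 1 is reached through n - 1 -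
    (a - 1) absent star edges and k - (a - 1) present edges off the star. *)
Lemma sum_slice_move_le a : (0 < a)%N ->
  \sum_(X | slice a X) \sum_e \sum_f move e f X * weight (swap e f X) <=
  slice_weight a.-1 * ((nR - a%:R) * (k%:R - a%:R + 1)).
Proof.
move=> a0.
have -> : \sum_(X | slice a X) \sum_e \sum_f move e f X * weight (swap e f X) =
   \sum_e \sum_f \sum_(X | slice a (swap e f X)) move e f (swap e f X) * weight X.
  rewrite exchange_big; apply: eq_bigr => e _ /=.
  rewrite exchange_big; apply: eq_bigr => f _ /=.
  rewrite (reindex_inj (can_inj (swapK e f))) /=.
  by apply: eq_bigr => X _; rewrite swapK.
apply: (@le_trans _ _ (\sum_e \sum_f \sum_(X | slice a.-1 X)
    (chi e v * (1 - xe X e) * ((1 - chi f v) * xe X f)) * weight X)).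
  apply: ler_sum => e _; apply: ler_sum => f _.
  rewrite big_mkcond [leRHS]big_mkcond /=; apply: ler_sum => X _.
  have w0 : 0 <= weight X := expR_ge0 _.
  have g0 : 0 <= chi e v * (1 - xe X e) * ((1 - chi f v) * xe X f).
    case: (chi01 e) => ->; case: (xe01 X e) => ->;
    case: (chi01 f) => ->; case: (xe01 X f) => ->; lra.
  case: ifPn => [sa|_]; last by case: ifP => // _; rewrite mulr_ge0.
  have := move_ge0 e f (swap e f X); rewrite le_eqVlt => /orP[/eqP <-|mp].
    by rewrite mul0r; case: ifP => // _; rewrite mulr_ge0.
  by have [-> ->] := slice_swap a0 sa mp.
rewrite /slice_weight mulr_suml.
under eq_bigr do rewrite exchange_big; rewrite exchange_big /=.
apply: ler_sum => X /and3P[XO /eqP da _]; rewrite le_eqVlt; apply/orP; left; apply/eqP.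
have E1 : \sum_e chi e v * (1 - xe X e) = nR - a%:R.
  transitivity (\sum_e (chi e v - chi e v * xe X e)).
    by apply: eq_bigr => e _; ring.
  rewrite sumrB sum_chi_edge -natr_deg da -[in RHS](prednK a0) -natr1; ring.
have E2 : \sum_f (1 - chi f v) * xe X f = k%:R - a%:R + 1.
  transitivity (\sum_f (xe X f - chi f v * xe X f)).
    by apply: eq_bigr => f _; ring.
  rewrite sumrB (sum_xe XO) -natr_deg da -[in RHS](prednK a0) -natr1; ring.
rewrite -E1 -E2 mulrC mulr_suml mulr_suml; apply: eq_bigr => e _.
by rewrite mulr_sumr mulr_suml.
Qed.

Lemma slice_step a : (0 < a)%N -> (a <= n)%N -> p * (nR - 1) <= a%:R ->
  slice_weight a * (a%:R * (N - (nR - 1) - (k%:R - a%:R)) *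
    (expR (- (2 * beta / nR * (a%:R - p * (nR - 1)))) * (1 - C_move / Num.sqrt nR))) <=
  slice_weight a.-1 * ((nR - a%:R) * (k%:R - a%:R + 1)).
Proof.
move: K0 => K0' a0 an pa; apply: le_trans (sum_slice_move_le a0).
rewrite /slice_weight mulr_suml; apply: ler_sum => X /and3P[XO /eqP da fa].
have n2 := nR_ge2 R n1.
have fK : f2 X <= (K + 12) * nR ^+ 2.
  apply: (le_trans fa); rewrite /theta.
  have : 0 <= a%:R :> R by []. nra.
have h := sum_move_expR_ge XO fK; rewrite Dv_deg /outside da in h.
apply: (le_trans (ler_wpM2l (expR_ge0 _) (h pa))).
rewrite mulr_sumr; apply: ler_sum => e _; rewrite mulr_sumr; apply: ler_sum => f _.
rewrite mulrCA; apply: ler_wpM2l; first exact: move_ge0.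
by rewrite -expRD -[weight _]/(expR _) ler_expR mulrBr addrC subrK.
Qed.

End DegreeMoves.

(** * Relative entropy of Bernoulli laws *)

Section Entropy.
Variable R : realType.
Implicit Types x y a c p t m : R.

Lemma ln_le_sub1 x : 0 < x -> ln x <= x - 1.
Proof.
move=> x0; have := @le_ln1Dx R (x - 1).
have -> : 1 + (x - 1) = x by ring.
by apply; lra.
Qed.

Lemma xlnx_tangent x y : 0 < x -> 0 < y -> y * ln x + y - x <= y * ln y.
Proof.
move=> x0 y0; have := ln_le_sub1 (divr_gt0 x0 y0).
rewrite ln_div ?posrE// => /(ler_wpM2l (ltW y0)).
by rewrite !mulrBr mulrCA divff ?gt_eqF//; lra.
Qed.

(* [m] times the relative entropy of Bernoulli(a / m) to Bernoulli(p). *)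
Definition entropy m p a : R :=
  a * ln a + (m - a) * ln (m - a) - a * (ln m + ln p) - (m - a) * (ln m + ln (1 - p)).

(** The right side is the derivative of the convex function [entropy m p] at [a], the right end of
    the step. *)
Lemma entropy_step m p a : 0 < p < 1 -> 1 < a -> a < m ->
  entropy m p a - entropy m p (a - 1) <= ln (a * (1 - p) / ((m - a) * p)).
Proof.
move=> /andP[p0 p1] a1 am.
rewrite ln_div ?posrE ?mulr_gt0 ?subr_gt0//; try lra.
rewrite !lnM ?posrE ?subr_gt0//; try lra.
have h1 : (a - 1) * ln a + (a - 1) - a <= (a - 1) * ln (a - 1) by apply: xlnx_tangent; lra.
have h2 : (m - (a - 1)) * ln (m - a) + (m - (a - 1)) - (m - a) <=
   (m - (a - 1)) * ln (m - (a - 1)) by apply: xlnx_tangent; lra.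
rewrite /entropy; lra.
Qed.

(** Gibbs' inequality against the law tilted by [t] gives t (a - m p) - m ln (P + Q) as a lower
    bound; [t] maximises it once ln (P + Q) is replaced by t^2 / (4 c). *)
Lemma entropy_ge c m p a : 0 < c -> 0 < p < 1 -> 0 < a -> a < m ->
  (forall t, p * expR ((1 - p) * t) + (1 - p) * expR (- p * t) <= expR (t ^+ 2 / (4 * c))) ->
  c * (a - m * p) ^+ 2 / m <= entropy m p a.
Proof.
move=> c0 /andP[p0 p1] a0 am sg; have m0 : 0 < m by lra.
pose t := 2 * c * (a - m * p) / m.
set P := p * expR ((1 - p) * t); set Q := (1 - p) * expR (- p * t).
have P0 : 0 < P by rewrite mulr_gt0 ?expR_gt0.
have Q0 : 0 < Q by rewrite mulr_gt0 ?expR_gt0 ?subr_gt0.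
have S0 : 0 < P + Q by lra.
have lS : ln (P + Q) <= t ^+ 2 / (4 * c).
  by rewrite -[leRHS]expRK ler_ln ?posrE ?expR_gt0//; exact: sg.
have lP : ln P = ln p + (1 - p) * t by rewrite lnM ?posrE ?expR_gt0// expRK.
have lQ : ln Q = ln (1 - p) + - p * t.
  by rewrite lnM ?posrE ?expR_gt0 ?subr_gt0// expRK.
have h1 := @xlnx_tangent (m * P / (P + Q)) a (divr_gt0 (mulr_gt0 m0 P0) S0) a0.
have ma : 0 < m - a by lra.
have h2 := @xlnx_tangent (m * Q / (P + Q)) (m - a) (divr_gt0 (mulr_gt0 m0 Q0) S0) ma.
have lmP : ln (m * P) = ln m + (ln p + (1 - p) * t) by rewrite -lP lnM ?posrE.
have lmQ : ln (m * Q) = ln m + (ln (1 - p) + - p * t) by rewrite -lQ lnM ?posrE.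
have mP0 : 0 < m * P by exact: mulr_gt0.
have mQ0 : 0 < m * Q by exact: mulr_gt0.
have dP : ln (m * P / (P + Q)) = ln m + (ln p + (1 - p) * t) - ln (P + Q).
  by rewrite -lmP ln_div ?posrE.
have dQ : ln (m * Q / (P + Q)) = ln m + (ln (1 - p) + - p * t) - ln (P + Q).
  by rewrite -lmQ ln_div ?posrE.
rewrite dP in h1; rewrite dQ in h2.
have h3 : m * P / (P + Q) + m * Q / (P + Q) = m by field; rewrite gt_eqF.
have h4 : m * ln (P + Q) <= m * (t ^+ 2 / (4 * c)) by rewrite ler_pM2l.
have -> : c * (a - m * p) ^+ 2 / m = t * (a - m * p) - m * (t ^+ 2 / (4 * c)).
  by rewrite /t; field; rewrite !gt_eqF.
rewrite /entropy; lra.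
Qed.

(** Relative entropy is at most the chi-square divergence, by ln x <= x - 1. *)
Lemma entropy_le m p a : 0 < p < 1 -> 0 < a -> a < m ->
  entropy m p a <= (a - m * p) ^+ 2 / (m * (p * (1 - p))).
Proof.
move=> /andP[p0 p1] a0 am; have m0 : 0 < m by lra.
have q0 : 0 < 1 - p by lra.
have ma : 0 < m - a by lra.
have h1 := ler_wpM2l (ltW a0) (ln_le_sub1 (divr_gt0 a0 (mulr_gt0 m0 p0))).
have h2 := ler_wpM2l (ltW ma) (ln_le_sub1 (divr_gt0 ma (mulr_gt0 m0 q0))).
have l1 : ln (m * p) = ln m + ln p by rewrite lnM ?posrE.
have l2 : ln (m * (1 - p)) = ln m + ln (1 - p) by rewrite lnM ?posrE.
have mp0 : 0 < m * p by exact: mulr_gt0.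
have mq0 : 0 < m * (1 - p) by exact: mulr_gt0.
have d1 : ln (a / (m * p)) = ln a - (ln m + ln p) by rewrite -l1 ln_div ?posrE.
have d2 : ln ((m - a) / (m * (1 - p))) = ln (m - a) - (ln m + ln (1 - p)).
  by rewrite -l2 ln_div ?posrE.
rewrite d1 in h1; rewrite d2 in h2.
have -> : (a - m * p) ^+ 2 / (m * (p * (1 - p))) =
   a * (a / (m * p) - 1) + (m - a) * ((m - a) / (m * (1 - p)) - 1).
  by field; rewrite !gt_eqF.
rewrite /entropy; lra.
Qed.

End Entropy.

(** * Gaussian tail of a degree above its mean *)

Section DegreeTail.
Variables (R : realType) (n k : nat) (p beta b0 eta K : R) (v : 'I_n).
Implicit Types (X : graph n).

Local Notation N := (#|{: edge n}|%:R : R).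
Local Notation nR := (n%:R : R).
Local Notation U := (slice_weight k p beta K v).
Local Notation C_move := (C_move b0 eta K).
Local Notation f2 := (f2 p).
Local Notation Dv := (Dv p).
Local Notation Z := (partition_fn n k p beta).

Hypothesis kE : k%:R = 'C(n, 2)%:R * p.
Hypothesis n3 : (2 < n)%N.
Hypothesis eta0 : 0 < eta.
Hypothesis petaL : eta <= p.
Hypothesis petaR : eta <= 1 - p.
Hypothesis beta01 : 0 <= beta <= b0.
Hypothesis K0 : 0 <= K.
Hypothesis n_large : 2 * C_move <= Num.sqrt nR.
Hypothesis subgauss : forall t, p * expR ((1 - p) * t) + (1 - p) * expR (- p * t) <=
  expR (t ^+ 2 / (4 * (beta + eta))).

Let n1 : (1 < n)%N := ltnW n3.
Let p01 : 0 < p < 1 := eta_p01 eta0 petaL petaR.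

Definition C_step : R := 2 * C_move + 12 / eta + 3 * b0.

Lemma C_move_ge0 : 0 <= C_move.
Proof.
move: K0 beta01 => h /andP[h1 h2]; apply: divr_ge0; last exact: ltW.
by apply: mulr_ge0; lra.
Qed.

Lemma C_step_ge0 : 0 <= C_step.
Proof.
have h := C_move_ge0; move: beta01 => /andP[h1 h2].
by have : 0 <= 12 / eta; [rewrite divr_ge0// ltW|rewrite /C_step; lra].
Qed.

Lemma slice_weight_ge0 a : 0 <= U a.
Proof. by apply: sumr_ge0 => X _; exact: expR_ge0. Qed.

Let s := Num.sqrt nR.

Lemma sqrt_n_facts : [/\ 0 < s, s ^+ 2 = nR, 1 <= s & s <= nR].
Proof.
have n2 := nR_ge2 R n1; have n0 : 0 < nR by lra.
have s0 : 0 < s by rewrite sqrtr_gt0.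
have s2 : s ^+ 2 = nR by rewrite sqr_sqrtr// ltW.
have s1 : 1 <= s by nra.
by split=> //; nra.
Qed.

(** The move counts give the ratio (n - a) p / (a (1 - p)), whose logarithm is minus the derivative
    of the entropy. The count n - a of absent star edges at degree a - 1 makes n the size parameter;
    the field factor is a difference of squares up to O(1/n). *)
Lemma slice_weight_step (a : nat) : (1 < a)%N -> (a < n)%N -> nR * p <= a%:R ->
  U a <= U a.-1 * expR (- (entropy nR p a%:R - entropy nR p (a%:R - 1)) +
    beta / nR * ((a%:R - nR * p) ^+ 2 - (a%:R - 1 - nR * p) ^+ 2) + C_step / s).
Proof.
move=> a1 an pa; have [s0 s2 s1 sn] := sqrt_n_facts.
have [p0 p1] := andP p01; have q0 : 0 < 1 - p by lra.
have [be0 be1] := andP beta01.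
have n2 := nR_ge2 R n1; have n0 : 0 < nR by lra.
have a1' : (1 : R) < a%:R by rewrite ltr1n.
have an' : (a%:R : R) < nR by rewrite ltr_nat.
have pa' : p * (nR - 1) <= a%:R by lra.
have st := slice_step v kE n3 eta0 petaL petaR beta01 K0 (ltnW a1) (ltnW an) pa'.
set N' := N - (nR - 1).
have N'ge : nR ^+ 2 / 12 <= N'.
  have n3' : (3 : R) <= nR by rewrite ler_nat.
  by rewrite /N' N_eq; nra.
have N'0 : 0 < N' by apply: lt_le_trans N'ge; rewrite divr_gt0// exprn_gt0.
have kN : k%:R = (N' + (nR - 1)) * p by rewrite /N' kE card_edge; ring.
set x := C_move / s.
have x0 : 0 <= x by rewrite divr_ge0 ?C_move_ge0// ltW.
have x2 : x <= 1 / 2 by rewrite ler_pdivrMr//; move: n_large; rewrite -/s; lra.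
(* For x <= 1/2, which is what [n_large] ensures, the factor 1 - x is at least exp (- 2 x), so that
   errors add up along the chain. *)
have xe2 : expR (- (2 * x)) <= 1 - x.
  rewrite -[leLHS]mul1r expRN ler_pdivrMr ?expR_gt0//.
  have := expR_ge1Dx (2 * x) => h; have h2 : 0 <= 1 - x by lra.
  by have := ler_wpM2l h2 h; nra.
set E := expR (- (2 * beta / nR * (a%:R - p * (nR - 1)))).
(* Since a >= n p, the edges off the star have density at most p: at least (1 - p) N' of them are
   absent and at most p N' present. *)
pose L := a%:R * ((1 - p) * N') * (E * expR (- (2 * x))).
have L0 : 0 < L by rewrite !mulr_gt0 ?expR_gt0//; lra.
have Lle : L <= a%:R * (N - (nR - 1) - (k%:R - a%:R)) * (E * (1 - x)).
  apply: ler_pM.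
  - by rewrite !mulr_ge0 ?(ltW N'0) ?(ltW q0).
  - by rewrite mulr_ge0 ?expR_ge0.
  - by rewrite ler_wpM2l// -/N' kN; lra.
  - by rewrite ler_wpM2l ?expR_ge0.
have Rle : U a.-1 * ((nR - a%:R) * (k%:R - a%:R + 1)) <=
   U a.-1 * ((nR - a%:R) * (p * N' * expR ((p * N')^-1))).
  apply: ler_wpM2l; first exact: slice_weight_ge0.
  apply: ler_wpM2l; first by lra.
  have pN0 : 0 < p * N' by rewrite mulr_gt0.
  apply: (@le_trans _ _ (p * N' * (1 + (p * N')^-1))).
    by rewrite mulrDr mulr1 divff ?gt_eqF// kN; lra.
  by rewrite ler_wpM2l ?(ltW pN0)// expR_ge1Dx.
have h1 : U a * L <= U a.-1 * ((nR - a%:R) * (p * N' * expR ((p * N')^-1))).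
  apply: le_trans Rle; apply: le_trans st; apply: ler_wpM2l Lle.
  exact: slice_weight_ge0.
have {h1} h2 : U a <= U a.-1 * (((nR - a%:R) * p) / (a%:R * (1 - p)) *
    expR ((p * N')^-1 + 2 * beta / nR * (a%:R - p * (nR - 1)) + 2 * x)).
  rewrite -(ler_pM2r L0); apply: (le_trans h1); rewrite -[leRHS]mulrA.
  apply: ler_wpM2l; first exact: slice_weight_ge0.
  rewrite /L /E !expRD !expRN le_eqVlt; apply/orP; left; apply/eqP.
  by field; rewrite !gt_eqF ?expR_gt0//; lra.
apply: (le_trans h2); apply: ler_wpM2l; first exact: slice_weight_ge0.
have -> : ((nR - a%:R) * p) / (a%:R * (1 - p)) =
   expR (- ln (a%:R * (1 - p) / ((nR - a%:R) * p))).
  have h : 0 < a%:R * (1 - p) / ((nR - a%:R) * p).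
    by rewrite divr_gt0 ?mulr_gt0//; lra.
  by rewrite expRN lnK ?posrE// invf_div.
rewrite -expRD ler_expR.
have ent := entropy_step p01 a1' an'.
have e1 : (p * N')^-1 <= 12 / eta / s.
  rewrite -[leRHS]invrK lef_pV2 ?posrE ?mulr_gt0//; last first.
    by rewrite invr_gt0 !divr_gt0.
  rewrite !invf_div.
  apply: (@le_trans _ _ (eta * (nR ^+ 2 / 12))).
    have -> : s * (eta / 12) = eta * (s / 12) by ring.
    rewrite ler_wpM2l ?(ltW eta0)// ler_wpM2r//.
    by apply: (le_trans sn); rewrite expr2; nra.
  by apply: ler_pM => //; exact: ltW.
have e2 : 2 * beta / nR * (a%:R - p * (nR - 1)) =
    beta / nR * ((a%:R - nR * p) ^+ 2 - (a%:R - 1 - nR * p) ^+ 2) + beta * (2 * p + 1) / nR.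
  by field; rewrite gt_eqF.
have e3 : beta * (2 * p + 1) / nR <= 3 * b0 / s.
  apply: ler_pM; [by apply: mulr_ge0; lra|by rewrite invr_ge0 ltW| by nra|].
  by rewrite lef_pV2 ?posrE.
have e4 : C_step / s = 2 * x + 12 / eta / s + 3 * b0 / s by rewrite /C_step /x; ring.
by rewrite e2 e4; lra.
Qed.

Lemma slice_weight_chain (a0 d : nat) : (0 < a0)%N -> (a0 + d < n)%N -> nR * p <= a0%:R ->
  U (a0 + d)%N <= U a0 * expR (- (entropy nR p (a0 + d)%:R - entropy nR p a0%:R) +
    beta / nR * (((a0 + d)%:R - nR * p) ^+ 2 - (a0%:R - nR * p) ^+ 2) + C_step / s * d%:R).
Proof.
move=> a00; elim: d => [|d IH] dn pa.
  by rewrite addn0 !subrr !mulr0 !oppr0 !addr0 expR0 mulr1.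
rewrite addnS in dn *.
have pad : nR * p <= (a0 + d).+1%:R by apply: (le_trans pa); rewrite ler_nat leqW ?leq_addr.
have ad1 : (1 < (a0 + d).+1)%N by rewrite ltnS (leq_trans a00)// leq_addr.
apply: (le_trans (slice_weight_step ad1 dn pad)).
apply: (le_trans (ler_wpM2r (expR_ge0 _) (IH (ltnW dn) pa))).
rewrite -[leLHS]mulrA -expRD; apply: ler_wpM2l; first exact: slice_weight_ge0.
rewrite ler_expR le_eqVlt; apply/orP; left; apply/eqP.
by rewrite -[(a0 + d).+1%:R]natr1 addrK -[d.+1%:R]natr1; ring.
Qed.

Definition C_tail : R := 48 / eta ^+ 3 * expR (4 / eta ^+ 2 + C_step ^+ 2 / (2 * eta)).

Lemma C_tail_ge0 : 0 <= C_tail.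
Proof. by rewrite mulr_ge0 ?expR_ge0// divr_ge0// exprn_ge0// ltW. Qed.

(** The entropy exceeds the field by eta y^2 / n. Half of this absorbs the accumulated error C_step
    y / sqrt n; the other half is a Gaussian tail, weakened to a power sufficient for fourth
    moments. The reference degree lies within 2 sqrt n of n p, so its entropy is O(1). *)
Lemma slice_weight_tail (a0 a : nat) : (0 < a0)%N -> (a0 <= a)%N -> (a < n)%N ->
  nR * p <= a0%:R -> a0%:R - nR * p <= 2 * s -> nR * p < a%:R ->
  U a <= U a0 * (C_tail * nR ^+ 3 / (a%:R - nR * p) ^+ 6).
Proof.
move=> a00 a0a an pa0 a0s pa; have [s0 s2 s1 sn] := sqrt_n_facts.
have [p0 p1] := andP p01; have q0 : 0 < 1 - p by lra.
have [be0 be1] := andP beta01; have e0 := eta0.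
have n2 := nR_ge2 R n1; have n0 : 0 < nR by lra.
have := @slice_weight_chain a0 (a - a0); rewrite subnKC// => /(_ a00 an pa0) h.
apply: (le_trans h); apply: ler_wpM2l; first exact: slice_weight_ge0.
rewrite natrB//; set y := a%:R - nR * p; set y0 := a0%:R - nR * p in a0s *.
have y_gt0 : 0 < y by rewrite subr_gt0.
have y0_ge0 : 0 <= y0 by rewrite subr_ge0.
have a0R : (0 : R) < a0%:R by rewrite ltr0n.
have aR : (0 : R) < a%:R by rewrite ltr0n (leq_trans a00).
have an' : (a%:R : R) < nR by rewrite ltr_nat.
have a0n' : (a0%:R : R) < nR by rewrite ltr_nat (leq_ltn_trans a0a).
have c0 : 0 < beta + eta by lra.
have ent1 := entropy_ge c0 p01 aR an' subgauss.
have ent2 := entropy_le p01 a0R a0n'.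
rewrite -/y in ent1; rewrite -/y0 in ent2.
have ent3 : y0 ^+ 2 / (nR * (p * (1 - p))) <= 4 / eta ^+ 2.
  rewrite ler_pdivrMr ?mulr_gt0//.
  have h1 : y0 ^+ 2 <= 4 * nR by rewrite -s2; nra.
  apply: (le_trans h1).
  have -> : 4 / eta ^+ 2 * (nR * (p * (1 - p))) = 4 * nR * (p * (1 - p) / eta ^+ 2) by ring.
  rewrite ler_peMr ?mulr_ge0 ?(ltW n0)// ler_pdivlMr ?exprn_gt0// mul1r expr2.
  by apply: ler_pM => //; exact: ltW.
pose z := eta / 2 * (y / s) ^+ 2.
have z0 : 0 < z by rewrite mulr_gt0 ?divr_gt0// exprn_gt0// divr_gt0.
have key : - (entropy nR p a%:R - entropy nR p a0%:R) + beta / nR * (y ^+ 2 - y0 ^+ 2) +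
    C_step / s * (a%:R - a0%:R) <= 4 / eta ^+ 2 + C_step ^+ 2 / (2 * eta) - z.
  have t1 : C_step / s * (a%:R - a0%:R) <= C_step * (y / s).
    have -> : C_step * (y / s) = C_step / s * y by ring.
    apply: ler_wpM2l; first by rewrite divr_ge0 ?C_step_ge0// ltW.
    by rewrite /y /y0 in y0_ge0 *; lra.
  have t2 : 0 <= beta / nR * y0 ^+ 2 by rewrite mulr_ge0 ?sqr_ge0// divr_ge0// ltW.
  have t3 : (beta + eta) * y ^+ 2 / nR = beta / nR * y ^+ 2 + eta * (y / s) ^+ 2.
    by rewrite -s2; field; rewrite gt_eqF.
  have t4 : C_step * (y / s) - eta * (y / s) ^+ 2 <= C_step ^+ 2 / (2 * eta) - z.
    rewrite -subr_ge0; have -> : C_step ^+ 2 / (2 * eta) - z -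
       (C_step * (y / s) - eta * (y / s) ^+ 2) = eta / 2 * (y / s - C_step / eta) ^+ 2.
      by rewrite /z; field; rewrite !gt_eqF.
    by rewrite mulr_ge0 ?sqr_ge0// divr_ge0// ltW.
  by rewrite t3 in ent1; lra.
apply: (@le_trans _ _ (expR (4 / eta ^+ 2 + C_step ^+ 2 / (2 * eta) - z))).
  by rewrite ler_expR.
rewrite expRD; set A := expR (_ + _).
(* From z^3 / 3! <= exp z; with z = eta y^2 / (2 n) this yields n^3 / y^6 and the constant 48 = 6 *
   8. *)
have ez : expR (- z) <= 6 / z ^+ 3.
  rewrite expRN -[leLHS]mul1r ler_pdivrMr ?expR_gt0//.
  have := expR_ge1Dxn 2 (ltW z0); rewrite /= => h3.
  have {}h3 : z ^+ 3 / 6 <= expR z.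
    have f6 : (3`!%:R : R) = 6 by [].
    by rewrite f6 in h3; lra.
  have := ler_wpM2l (ltW (divr_gt0 (ltr0n _ 6) (exprn_gt0 3 z0))) h3.
  by apply: le_trans; rewrite mulrA divfK ?gt_eqF ?exprn_gt0// divff.
apply: (le_trans (ler_wpM2l (expR_ge0 _) ez)).
rewrite /C_tail -/A /z -s2 le_eqVlt; apply/orP; left; apply/eqP.
by field; rewrite !gt_eqF.
Qed.

End DegreeTail.

(** * Fourth moment of the positive part of a degree *)

Section UpperMoment.
Variables (R : realType) (n k : nat) (p beta b0 eta K : R) (v : 'I_n).
Implicit Types (X : graph n).

Local Notation nR := (n%:R : R).
Local Notation U := (slice_weight k p beta K v).
Local Notation sl := (slice k p K v).
Local Notation f2 := (f2 p).
Local Notation Dv := (Dv p).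
Local Notation weight := (weight p beta).
Local Notation Z := (partition_fn n k p beta).
Local Notation C_tail := (C_tail b0 eta K).

Hypothesis kE : k%:R = 'C(n, 2)%:R * p.
Hypothesis n3 : (2 < n)%N.
Hypothesis eta0 : 0 < eta.
Hypothesis petaL : eta <= p.
Hypothesis petaR : eta <= 1 - p.
Hypothesis beta01 : 0 <= beta <= b0.
Hypothesis K0 : 0 <= K.
Hypothesis n_large : 2 * C_move b0 eta K <= Num.sqrt nR.
Hypothesis subgauss : forall t, p * expR ((1 - p) * t) + (1 - p) * expR (- p * t) <=
  expR (t ^+ 2 / (4 * (beta + eta))).

Let n1 : (1 < n)%N := ltnW n3.
Let p01 : 0 < p < 1 := eta_p01 eta0 petaL petaR.
Let s := Num.sqrt nR.

Lemma sum_slice_weight_le (a m : nat) : \sum_(i < m) U (a + i)%N <= Z.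
Proof.
rewrite /slice_weight /partition_fn.
under eq_bigr do rewrite big_mkcond; rewrite exchange_big [leRHS]big_mkcond /=.
apply: ler_sum => X _; have w0 : 0 <= weight X := expR_ge0 _.
case: (pickP (fun i : 'I_m => sl (a + i)%N X)) => [i si|none]; last first.
  by rewrite big1 => [|i _]; [case: ifP|rewrite (none i)].
have /and3P[XO /eqP da _] := si; rewrite XO (bigD1 i)//= si big1 ?addr0//.
move=> j ji; case: ifP => // /and3P[_ /eqP dj _].
by move: ji; rewrite -val_eqE /=; move: dj; rewrite da => /addnI ->; rewrite eqxx.
Qed.

Lemma deg_lt X : (deg X v < n)%N.
Proof.
have : (deg X v)%:R <= \sum_e chi e v :> R.
  rewrite natr_deg; apply: ler_sum => e _; rewrite ler_piMr ?chi_ge0//.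
  by rewrite /xe lern1 leq_b1.
rewrite sum_chi_edge -(ltr_nat R); lra.
Qed.

(** The [m] degrees from [a1] on form a window of width about sqrt n just above n p, all admissible
    as reference degrees for [slice_weight_tail]. *)
Let a1 := (Num.truncn (nR * p)).+1.
Let m := Num.truncn s.

Lemma a1_bounds : nR * p < a1%:R /\ a1%:R <= nR * p + 1.
Proof.
have [p0 _] := andP p01.
have np0 : 0 <= nR * p by rewrite mulr_ge0// ltW.
have /andP[h1 h2] := truncn_itv np0.
by rewrite /a1; split=> //; rewrite -natr1; lra.
Qed.

Lemma m_bounds : [/\ (0 < m)%N, m%:R <= s & nR <= 4 * m%:R ^+ 2].
Proof.
have [s0 s2 s1 sn] := sqrt_n_facts R n3.
have /andP[h1 h2] := truncn_itv (ltW s0).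
have m1 : (0 < m)%N by rewrite truncn_gt0.
have m1' : (1 : R) <= m%:R by rewrite ler1n.
split=> //; rewrite -s2; move: h2; rewrite -natr1 -/m -/s => h2.
have -> : 4 * m%:R ^+ 2 = (2 * m%:R) ^+ 2 :> R by ring.
rewrite lerXn2r ?nnegrE//; first exact: ltW.
by lra.
Qed.

(** Averaging the tail bound over the window gains a factor 1/m over comparison with a single slice:
    the mass at [a] is O(n^(5/2) / y^6). Multiplied by y^4 it decays like y^-2, which the difference
    of reciprocals dominates so that the sum telescopes. *)
Lemma slice_moment_le (a : nat) : (a1 + m <= a)%N -> (a < n)%N ->
  (a%:R - p * (nR - 1)) ^+ 4 * U a <=
  32 * Z * C_tail * nR ^+ 3 / m%:R * ((a%:R - a1%:R)^-1 - (a.+1%:R - a1%:R)^-1).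
Proof.
move=> am an; have [np1 np2] := a1_bounds; have [m0 ms nm] := m_bounds.
have [s0 s2 s1 sn] := sqrt_n_facts R n3.
have [p0 p1] := andP p01.
have n2 := nR_ge2 R n1; have n0 : 0 < nR by lra.
have Z0 := partition_fn_gt0 beta kE p01.
have C0 : 0 <= C_tail by exact: C_tail_ge0.
set y := a%:R - nR * p.
have m1' : (1 : R) <= m%:R by rewrite ler1n.
have am' : (a1%:R + m%:R : R) <= a%:R by rewrite -natrD ler_nat.
have y1 : m%:R <= y by rewrite /y; lra.
have mU : m%:R * U a <= Z * (C_tail * nR ^+ 3 / y ^+ 6).
  have -> : m%:R * U a = \sum_(i < m) U a by rewrite sumr_const card_ord mulr_natl.
  apply: (@le_trans _ _ (\sum_(i < m) U (a1 + i)%N * (C_tail * nR ^+ 3 / y ^+ 6))).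
    apply: ler_sum => i _.
    have im : (a1 + i < a)%N by apply: leq_trans am; rewrite ltn_add2l.
    have i0 : (0 : R) <= i%:R by [].
    have im' : (i%:R + 1 : R) <= m%:R by rewrite natr1 ler_nat.
    apply: (slice_weight_tail v kE n3 eta0 petaL petaR beta01 K0 n_large subgauss) => //.
    - exact: ltnW.
    - by rewrite natrD; lra.
    - by rewrite natrD; rewrite -/s; lra.
    - by lra.
  rewrite -mulr_suml; apply: ler_wpM2r; last exact: sum_slice_weight_le.
  apply: divr_ge0; last by rewrite exprn_even_ge0.
  by apply: mulr_ge0 => //; rewrite exprn_ge0 ?(ltW n0).
have y0 : 0 < y by lra.
have U0 : 0 <= U a by apply: slice_weight_ge0.
set x := a%:R - p * (nR - 1).
have xy : 0 <= x <= 2 * y by rewrite /x /y in y1 *; apply/andP; split; lra.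
have x4 : x ^+ 4 <= 16 * y ^+ 4.
  have -> : 16 * y ^+ 4 = (2 * y) ^+ 4 by ring.
  by case/andP: xy => x0 x2; rewrite lerXn2r ?nnegrE//; lra.
have mp : (0 : R) < m%:R by lra.
set i := a%:R - a1%:R.
have i1 : 1 <= i by rewrite /i; lra.
have -> : (a.+1%:R - a1%:R : R) = i + 1 by rewrite -natr1 /i; ring.
have -> : i^-1 - (i + 1)^-1 = (i * (i + 1))^-1.
  by field; rewrite !gt_eqF//; lra.
apply: (@le_trans _ _ (16 * y ^+ 4 * (Z * (C_tail * nR ^+ 3 / y ^+ 6) / m%:R))).
  apply: ler_pM => //; first by rewrite exprn_even_ge0.
  by rewrite ler_pdivlMr// mulrC.
have -> : 16 * y ^+ 4 * (Z * (C_tail * nR ^+ 3 / y ^+ 6) / m%:R) =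
   32 * Z * C_tail * nR ^+ 3 / m%:R * (2 * y ^+ 2)^-1 by field; rewrite !gt_eqF.
apply: ler_wpM2l.
  rewrite divr_ge0 ?(ltW mp)//; apply: mulr_ge0; last by rewrite exprn_ge0 ?(ltW n0).
  by apply: mulr_ge0 => //; rewrite mulr_ge0// ltW.
rewrite lef_pV2 ?posrE ?mulr_gt0 ?exprn_gt0//; try lra.
have : i <= y by rewrite /i /y; lra.
by move=> iy; nra.
Qed.

Lemma upper_pointwise X : X \in Omega n k ->
  (f2 X <= K * nR ^+ 2)%R%:R * ((0 <= Dv X v)%R%:R * Dv X v ^+ 4) <=
  16 * nR ^+ 2 + \sum_(a1 + m <= a < n) (a%:R - p * (nR - 1)) ^+ 4 * (sl a X)%:R.
Proof.
move=> XO; have [np1 np2] := a1_bounds; have [m0 ms nm] := m_bounds.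
have [s0 s2 s1 sn] := sqrt_n_facts R n3; rewrite -/s in s0 s2 s1 sn.
have [p0 p1] := andP p01.
have n2 := nR_ge2 R n1; have n0 : 0 < nR by lra.
have t0 a : 0 <= (a%:R - p * (nR - 1)) ^+ 4 * (sl a X)%:R.
  by rewrite mulr_ge0 ?exprn_even_ge0.
have S0 : 0 <= \sum_(a1 + m <= a < n) (a%:R - p * (nR - 1)) ^+ 4 * (sl a X)%:R.
  by apply: sumr_ge0 => a _.
have B0 : 0 <= 16 * nR ^+ 2 by rewrite mulr_ge0// sqr_ge0.
case: (leP (f2 X) _) => fK /=; last by rewrite mul0r addr_ge0.
rewrite mul1r; case: (leP 0 (Dv X v)) => D0 /=; last by rewrite mul0r addr_ge0.
rewrite mul1r; case: (leqP (a1 + m) (deg X v)) => da.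
  rewrite (bigD1_seq (deg X v)) ?iota_uniq//=; last first.
    by rewrite mem_index_iota da deg_lt.
  have -> : sl (deg X v) X.
    rewrite /slice XO eqxx /=; apply: (le_trans fK); rewrite /theta lerDl.
    apply: mulr_ge0; first by rewrite mulr_ge0// ltW.
    by rewrite subr_ge0 ler_nat ltnW// deg_lt.
  rewrite mulr1 -Dv_deg addrCA lerDl addr_ge0//.
  by apply: sumr_ge0 => a _.
rewrite -[leLHS]addr0; apply: lerD => //.
have dle : Dv X v <= 2 * s.
  rewrite Dv_deg; have : ((deg X v)%:R + 1 : R) <= a1%:R + m%:R.
    by rewrite natr1 -natrD ler_nat.
  by lra.
have -> : 16 * nR ^+ 2 = (2 * s) ^+ 4 by rewrite -s2; ring.
by rewrite lerXn2r ?nnegrE//; lra.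
Qed.

Lemma upper_moment_le :
  gibbs_mean k beta (fun X =>
    (f2 X <= K * nR ^+ 2)%R%:R * ((0 <= Dv X v)%R%:R * Dv X v ^+ 4)) <=
  (16 + 128 * C_tail) * nR ^+ 2.
Proof.
have [np1 np2] := a1_bounds; have [m0 ms nm] := m_bounds.
have n2 := nR_ge2 R n1; have n0 : 0 < nR by lra.
have Z0 := partition_fn_gt0 beta kE p01.
have C0 : 0 <= C_tail by exact: C_tail_ge0.
apply: le_trans; first by apply: ler_Mean => X XO; exact: upper_pointwise.
rewrite MeanD (Mean_cst beta kE (ltnW n1) p01) [leRHS]mulrDl lerD2l.
rewrite (MeanE beta kE (ltnW n1)) ler_pdivrMr//.
have -> : \sum_(X in Omega n k) weight X *
    (\sum_(a1 + m <= a < n) (a%:R - p * (nR - 1)) ^+ 4 * (sl a X)%:R) =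
    \sum_(a1 + m <= a < n) (a%:R - p * (nR - 1)) ^+ 4 * U a.
  under eq_bigr do rewrite mulr_sumr.
  rewrite exchange_big; apply: eq_bigr => a _ /=.
  rewrite /slice_weight mulr_sumr [RHS]big_mkcond [LHS]big_mkcond /=.
  apply: eq_bigr => X _; rewrite /slice.
  by case: (X \in _); case: (_ == _); case: (_ <= _); rewrite /= ?mulr1 ?mulr0//; ring.
case: (leqP n (a1 + m)) => nam.
  by rewrite big_geq// mulr_ge0 ?(ltW Z0)// mulr_ge0 ?sqr_ge0// mulr_ge0.
pose g (a : nat) : R := - (a%:R - a1%:R)^-1.
apply: (@le_trans _ _ (\sum_(a1 + m <= a < n)
    32 * Z * C_tail * nR ^+ 3 / m%:R * (g a.+1 - g a))).
  rewrite !big_nat; apply: ler_sum => a /andP[h1 h2].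
  apply: (le_trans (slice_moment_le h1 h2)); rewrite /g opprK.
  by rewrite [X in _ * X <= _]addrC.
have mp : (0 : R) < m%:R by rewrite ltr0n.
have Q0 : 0 <= 32 * Z * C_tail * nR ^+ 3 / m%:R.
  rewrite divr_ge0 ?(ltW mp)//; apply: mulr_ge0; last by rewrite exprn_ge0 ?(ltW n0).
  by apply: mulr_ge0 => //; rewrite mulr_ge0// ltW.
rewrite -mulr_sumr telescope_sumr ?(ltnW nam)//.
apply: (@le_trans _ _ (32 * Z * C_tail * nR ^+ 3 / m%:R * m%:R^-1)).
  apply: ler_wpM2l => //; rewrite /g natrD.
  have -> : a1%:R + m%:R - a1%:R = m%:R :> R by ring.
  rewrite opprK addrC gerDl oppr_le0 invr_ge0.
  have : (a1%:R + m%:R : R) <= nR by rewrite -natrD ler_nat ltnW.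
  by lra.
have -> : 32 * Z * C_tail * nR ^+ 3 / m%:R * m%:R^-1 =
   32 * (Z * C_tail * nR ^+ 2) * nR / m%:R ^+ 2 by field; rewrite gt_eqF.
rewrite ler_pdivrMr ?exprn_gt0//.
have -> : 128 * C_tail * nR ^+ 2 * Z * m%:R ^+ 2 =
   32 * (Z * C_tail * nR ^+ 2) * (4 * m%:R ^+ 2) by ring.
apply: ler_wpM2l => //; apply: mulr_ge0 => //.
by apply: mulr_ge0; [apply: mulr_ge0 => //; exact: ltW|exact: sqr_ge0].
Qed.

End UpperMoment.

(** * Variance bounds *)

Section Complement.
Variables (R : realType) (n k : nat) (p beta : R).
Implicit Types (X : graph n).

Hypothesis kE : k%:R = 'C(n, 2)%:R * p.
Hypothesis n0 : (0 < n)%N.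
Hypothesis p01 : 0 < p < 1.

(** Exchanges p with 1 - p and D_v with - D_v at equal weight, so that degrees below the mean are
    covered by the bounds for degrees above it. *)
Definition compl X : graph n := [ffun e => ~~ X e].

Lemma complK : involutive compl.
Proof. by move=> X; apply/ffunP => e; rewrite !ffunE negbK. Qed.

Lemma Dv_compl X v : Dv (1 - p) (compl X) v = - Dv p X v.
Proof.
rewrite /Dv -sumrN; apply: eq_bigr => e _; rewrite /Y ffunE.
by case: (X e) => /=; ring.
Qed.

Lemma f2_compl X : f2 (1 - p) (compl X) = f2 p X.
Proof. by apply: eq_bigr => v _; rewrite Dv_compl sqrrN. Qed.

Lemma le_k : (k <= 'C(n, 2))%N.
Proof. by rewrite -(ler_nat R) kE ler_piMr//; case/andP: p01 => _ /ltW. Qed.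

Lemma Omega_compl X : (compl X \in Omega n ('C(n, 2) - k)) = (X \in Omega n k).
Proof.
have kn := le_k.
have h : ((\sum_(e : edge n) compl X e) + (\sum_(e : edge n) X e) = 'C(n, 2))%N.
  rewrite -big_split /= -card_edge -sum1_card; apply: eq_bigr => e _.
  by rewrite ffunE; case: (X e).
rewrite !inE; apply/eqP/eqP => e; lia.
Qed.

Lemma compl_kE : ('C(n, 2) - k)%:R = 'C(n, 2)%:R * (1 - p) :> R.
Proof. by rewrite natrB ?le_k// kE; ring. Qed.

Lemma Mean_compl (h : graph n -> R) :
  gibbs_mean ('C(n, 2) - k) beta h = gibbs_mean k beta (fun X => h (compl X)).
Proof.
have q01 : 0 < 1 - p < 1 by case/andP: p01 => p0 p1; apply/andP; split; lra.
have wE X : weight (1 - p) beta (compl X) = weight p beta X by rewrite /weight f2_compl.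
rewrite (MeanE beta compl_kE n0) (MeanE beta kE n0); congr (_ / _).
  rewrite (reindex_inj (can_inj complK)) /=.
  by apply: eq_big => X; [rewrite Omega_compl|rewrite wE].
rewrite /partition_fn (reindex_inj (can_inj complK)) /=.
by apply: eq_big => X; [rewrite Omega_compl|rewrite wE].
Qed.

End Complement.

(** * Assembly of the variance bounds *)

Section Assembly.
Variables (R : realType) (n k : nat) (p beta b0 eta K : R).
Implicit Types (X : graph n).

Local Notation N := (#|{: edge n}|%:R : R).
Local Notation nR := (n%:R : R).
Local Notation Mean := (@gibbs_mean R n k beta).
Local Notation Var := (@gibbs_var R n k beta).
Local Notation Ab := (Ab b0).

Hypothesis kE : k%:R = 'C(n, 2)%:R * p.
Hypothesis n3 : (2 < n)%N.
Hypothesis eta0 : 0 < eta.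
Hypothesis petaL : eta <= p.
Hypothesis petaR : eta <= 1 - p.
Hypothesis beta01 : 0 <= beta <= b0.
Hypothesis beta_small : 4 * beta * p * (1 - p) < 2^-1.
Hypothesis K0 : 0 <= K.
Hypothesis n_large : 2 * C_move b0 eta K <= Num.sqrt nR.
Hypothesis subgauss : forall t, p * expR ((1 - p) * t) + (1 - p) * expR (- p * t) <=
  expR (t ^+ 2 / (4 * (beta + eta))).
Hypothesis bad_le : Mean (fun X => (~~ good p K X)%:R) <= 4 * expR (- nR).

Let n1 : (1 < n)%N := ltnW n3.
Let n0 : (0 < n)%N := ltnW n1.
Let p01 : 0 < p < 1 := eta_p01 eta0 petaL petaR.

Definition C_deg : R := 2 * (16 + 128 * C_tail b0 eta K).

(** The upper moment bound is applied to the graph and to its complement; the sub-Gaussian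
    hypothesis for 1 - p is the one for p at - t. *)
Lemma Dv_moment_le v :
  Mean (fun X => (f2 p X <= K * nR ^+ 2)%R%:R * Dv p X v ^+ 4) <= C_deg * nR ^+ 2.
Proof.
have [p0 p1] := andP p01.
have h1 := upper_moment_le v kE n3 eta0 petaL petaR beta01 K0 n_large subgauss.
have sgN t : (1 - p) * expR ((1 - (1 - p)) * t) + (1 - (1 - p)) * expR (- (1 - p) * t)
    <= expR (t ^+ 2 / (4 * (beta + eta))).
  have := subgauss (- t); rewrite sqrrN.
  have -> : (1 - p) * - t = - (1 - p) * t by ring.
  have -> : - p * - t = (1 - (1 - p)) * t by ring.
  have -> : 1 - (1 - p) = p by ring.
  by rewrite addrC.
have petaR' : eta <= 1 - (1 - p) by move: petaL; lra.
have kE' := compl_kE kE p01.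
have h2 := upper_moment_le v kE' n3 eta0 petaR petaR' beta01 K0 n_large sgN.
rewrite (Mean_compl beta kE n0 p01) in h2.
have -> : C_deg * nR ^+ 2 = (16 + 128 * C_tail b0 eta K) * nR ^+ 2 +
   (16 + 128 * C_tail b0 eta K) * nR ^+ 2 by rewrite /C_deg; ring.
apply: le_trans (lerD h1 h2); rewrite -MeanD; apply: ler_Mean => X _.
rewrite f2_compl Dv_compl -mulrDr; apply: ler_wpM2l => //.
have d4 : (- Dv p X v) ^+ 4 = Dv p X v ^+ 4 by ring.
have q0 : 0 <= Dv p X v ^+ 4 by rewrite exprn_even_ge0.
rewrite d4; case: (leP 0 (Dv p X v)) => hd /=.
  by rewrite mul1r lerDl mulr_ge0.
by rewrite oppr_ge0 (ltW hd) mul1r mul0r add0r.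
Qed.

(** From e^n >= (n/7)^7. The power 7 takes the crude bound n^10 for squared errors down to n^3. *)
Definition C_bad : R := 4 * 7 ^+ 7.

Lemma nR_facts : 3 <= nR /\ 0 < nR.
Proof. by have h : (3 : R) <= nR by [rewrite ler_nat|]; split=> //; lra. Qed.

Lemma Mean_bad_le : Mean (fun X => (~~ good p K X)%:R) <= C_bad / nR ^+ 7.
Proof.
have [n3' nn0] := nR_facts.
apply: (le_trans bad_le); rewrite /C_bad -mulrA ler_pM2l//.
rewrite expRN -[leRHS]invrK lef_pV2 ?posrE ?expR_gt0//; last first.
  by rewrite invr_gt0 divr_gt0 ?exprn_gt0.
rewrite invf_div; have -> : expR nR = expR (nR / 7) ^+ 7.
  by rewrite -expRM_natl; congr expR; field.
rewrite -expr_div_n lerXn2r ?nnegrE ?expR_ge0//.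
by have := expR_ge1Dx (nR / 7); lra.
Qed.

Lemma Mean_le_good_bad (F : graph n -> R) a b : 0 <= a -> 0 <= b ->
  (forall X, X \in Omega n k -> good p K X -> F X <= a) -> (forall X, F X <= b) ->
  Mean F <= a + b * (C_bad / nR ^+ 7).
Proof.
move=> a0 b_ge0 Fa Fb.
apply: (@le_trans _ _ (Mean (fun X => a + b * (~~ good p K X)%:R))).
  apply: ler_Mean => X XO; case: (boolP (good p K X)) => gX /=.
    by rewrite mulr0 addr0 Fa.
  by rewrite mulr1; apply: (le_trans (Fb X)); rewrite lerDr.
rewrite MeanD (Mean_cst beta kE n0 p01) MeanZ lerD2l.
by apply: ler_wpM2l => //; exact: Mean_bad_le.
Qed.

Lemma C_bad_ge0 : 0 <= C_bad. Proof. by rewrite mulr_ge0 ?exprn_ge0. Qed.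

Lemma bad_term_le (c : R) (i j : nat) : 0 <= c -> (i <= 7 + j)%N ->
  c * nR ^+ i * (C_bad / nR ^+ 7) <= c * C_bad * nR ^+ j.
Proof.
move=> c0 ij; have [n3' nn0] := nR_facts.
have -> : c * nR ^+ i * (C_bad / nR ^+ 7) = c * C_bad * (nR ^+ i / nR ^+ 7) by ring.
apply: ler_wpM2l; first by rewrite mulr_ge0 ?C_bad_ge0.
rewrite ler_pdivrMr ?exprn_gt0// -exprD addnC ler_weXn2l//; lra.
Qed.

Lemma Mean_f2_le : Mean (f2 p (n := n)) <= (K + C_bad) * nR ^+ 2.
Proof.
have [n3' nn0] := nR_facts.
have h := @Mean_le_good_bad (f2 p (n := n)) (K * nR ^+ 2) (1 * nR ^+ 3).
apply: (le_trans (h _ _ _ _)).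
- by rewrite mulr_ge0 ?sqr_ge0.
- by rewrite mul1r exprn_ge0 ?(ltW nn0).
- by move=> X _ /asboolP[].
- by move=> X; rewrite mul1r f2_le_cube.
by rewrite mulrDl lerD2l; have := @bad_term_le 1 3 2 ler01 isT; rewrite !mul1r.
Qed.

Lemma Mean_C2_le :
  Mean (fun X => \sum_e C2 p X e ^+ 2) <= (2 * K + 2 * C_bad) * nR ^+ 3.
Proof.
have [n3' nn0] := nR_facts.
have h := @Mean_le_good_bad (fun X => \sum_e C2 p X e ^+ 2) (2 * K * nR ^+ 3) (2 * nR ^+ 4).
apply: (le_trans (h _ _ _ _)).
- by rewrite mulr_ge0 ?exprn_ge0 ?mulr_ge0 ?(ltW nn0).
- by rewrite mulr_ge0 ?exprn_ge0 ?(ltW nn0).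
- by move=> X _ /asboolP[_ op]; exact: (sum_C2_sq_le n1 p01).
- by move=> X; exact: (sum_C2_sq_crude n1 p01).
by rewrite [leRHS]mulrDl lerD2l; exact: bad_term_le.
Qed.

(** The indicator of f2 <= K n^2 equals 1 on the good event and puts [D4] in the form bounded by
    [Dv_moment_le]; the crude bound is paid only on the bad event. *)
Lemma Mean_err_le (Err : graph n -> R) (c c' : R) : 0 <= c -> 0 <= c' ->
  (forall X, X \in Omega n k -> f2 p X <= K * nR ^+ 2 -> opnorm_le p K X ->
     Err X ^+ 2 <= c * (nR ^+ 3 + D4 p X)) ->
  (forall X, X \in Omega n k -> Err X ^+ 2 <= c' * nR ^+ 10) ->
  Mean (fun X => Err X ^+ 2) <= (c * (1 + C_deg) + c' * C_bad) * nR ^+ 3.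
Proof.
move=> c0 c'0 hg hb; have [n3' nn0] := nR_facts.
apply: (@le_trans _ _ (Mean (fun X => (c * nR ^+ 3 +
    c * \sum_v ((f2 p X <= K * nR ^+ 2)%R%:R * Dv p X v ^+ 4)) +
    c' * nR ^+ 10 * (~~ good p K X)%:R))).
  apply: ler_Mean => X XO; case: (boolP (good p K X)) => [/asboolP[fK op]|_] /=.
    rewrite mulr0 addr0 fK; apply: (le_trans (hg X XO fK op)).
    rewrite mulrDr lerD2l; apply: ler_wpM2l => //; apply: ler_sum => v _.
    by rewrite mul1r.
  rewrite mulr1; apply: (le_trans (hb X XO)); rewrite lerDr addr_ge0//.
    by rewrite mulr_ge0 ?exprn_ge0 ?(ltW nn0).
  by rewrite mulr_ge0//; apply: sumr_ge0 => v _; rewrite mulr_ge0 ?exprn_even_ge0.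
rewrite !MeanD (Mean_cst beta kE n0 p01) !MeanZ Mean_sum.
have h1 : \sum_v Mean (fun X => (f2 p X <= K * nR ^+ 2)%R%:R * Dv p X v ^+ 4) <=
    C_deg * nR ^+ 3.
  apply: (@le_trans _ _ (\sum_(v < n) C_deg * nR ^+ 2)).
    by apply: ler_sum => v _; exact: Dv_moment_le.
  rewrite sumr_const card_ord -[_ *+ n]mulr_natl.
  by rewrite le_eqVlt; apply/orP; left; apply/eqP; ring.
have h2 := ler_wpM2l c0 h1.
have h3 : c' * nR ^+ 10 * Mean (fun X => (~~ good p K X)%:R) <= c' * C_bad * nR ^+ 3.
  apply: (le_trans (ler_wpM2l _ Mean_bad_le)); last exact: bad_term_le.
  by rewrite mulr_ge0 ?exprn_ge0 ?(ltW nn0).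
by lra.
Qed.

Lemma Ab_facts : 1 <= Ab. Proof. exact: Ab_ge1 beta01. Qed.

Lemma err_f2_crude X : err_f2 p beta X ^+ 2 <= (Ab + 3) ^+ 2 * nR ^+ 10.
Proof.
have [n3' nn0] := nR_facts; have A1 := Ab_facts.
have [p0 p1] := andP p01; have [be0 be1] := andP beta01; have bs := beta_small.
have f0 := f2_ge0 p X; have fc := f2_le_cube p01 X.
have gl := @normr_generator_le R n p beta b0 n1 p01 beta01 (f2 p (n := n)) (nR ^+ 3) X.
have {}gl : `|generator p beta (f2 p (n := n)) X| <= Ab * nR ^+ 5.
  have -> : Ab * nR ^+ 5 = Ab * nR ^+ 3 * nR ^+ 2 by ring.
  by apply: gl => Z; rewrite ger0_norm ?f2_ge0 ?f2_le_cube.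
have cle : `|c_f2 n p beta| <= 2.
  have q : 0 <= 2 * beta * (p * (1 - p)) <= 1 / 4.
    have : 0 <= beta * (p * (1 - p)) by rewrite mulr_ge0 ?mulr_ge0//; lra.
    by lra.
  have r : 0 <= (nR - 2) / nR <= 1.
    by rewrite divr_ge0 ?(ltW nn0) ?ler_pdivrMr//=; lra.
  rewrite /c_f2 -mulrA ler_norml; case/andP: q => q1 q2; case/andP: r => r1 r2.
  by apply/andP; split; nra.
have n23 : nR ^+ 2 <= nR ^+ 5 by rewrite ler_weXn2l//; lra.
have n35 : nR ^+ 3 <= nR ^+ 5 by rewrite ler_weXn2l//; lra.
have N4 : `|4 * N * (p * (1 - p))| <= nR ^+ 2.
  have hN := N_le R n1; have N0 := N_gt0 R n1.
  rewrite ger0_norm; last by rewrite mulr_ge0 ?mulr_ge0//; lra.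
  have : 4 * (p * (1 - p)) <= 1 by have := sqr_ge0 (1 - 2 * p); nra.
  by nra.
have h : `|err_f2 p beta X| <= (Ab + 3) * nR ^+ 5.
  apply: (le_trans (ler_normB _ _)).
  apply: (le_trans (lerD (ler_normD _ _) N4)).
  have : `|c_f2 n p beta * f2 p X| <= 2 * nR ^+ 3.
    by rewrite normrM; apply: ler_pM => //; rewrite ger0_norm.
  by lra.
have -> : (Ab + 3) ^+ 2 * nR ^+ 10 = ((Ab + 3) * nR ^+ 5) ^+ 2 by ring.
rewrite -[leLHS]real_normK ?num_real// lerXn2r ?nnegrE//.
exact: (le_trans _ h).
Qed.

Lemma err_tr3_crude X : err_tr3 p beta X ^+ 2 <= (Ab + 3) ^+ 2 * nR ^+ 10.
Proof.
have [n3' nn0] := nR_facts; have A1 := Ab_facts.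
have gl := @normr_generator_le R n p beta b0 n1 p01 beta01 (tr3 p (n := n)) (nR ^+ 3) X.
have {}gl : `|generator p beta (tr3 p (n := n)) X| <= Ab * nR ^+ 5.
  have -> : Ab * nR ^+ 5 = Ab * nR ^+ 3 * nR ^+ 2 by ring.
  by apply: gl => Z; exact: normr_tr3_le.
have n35 : nR ^+ 3 <= nR ^+ 5 by rewrite ler_weXn2l//; lra.
have h : `|err_tr3 p beta X| <= (Ab + 3) * nR ^+ 5.
  apply: (le_trans (ler_normD _ _)).
  have : `|3 * tr3 p X| <= 3 * nR ^+ 3.
    by rewrite normrM ger0_norm// ler_pM2l// normr_tr3_le.
  by lra.
have -> : (Ab + 3) ^+ 2 * nR ^+ 10 = ((Ab + 3) * nR ^+ 5) ^+ 2 by ring.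
rewrite -[leLHS]real_normK ?num_real// lerXn2r ?nnegrE//.
exact: (le_trans _ h).
Qed.

Definition C_var_f2 : R := 2 * (8 * Ab * (K + C_bad) + 4 * Ab) +
  (C_f2 b0 K * (1 + C_deg) + (Ab + 3) ^+ 2 * C_bad).

Lemma C_f2_ge0 : 0 <= C_f2 b0 K.
Proof.
move: beta01 K0 => /andP[h1 h2] h3; have b00 : 0 <= b0 by lra.
by rewrite /C_f2; nonneg.
Qed.

Lemma C_tr3_ge0 : 0 <= C_tr3 b0 K.
Proof.
move: beta01 K0 => /andP[h1 h2] h3; have b00 : 0 <= b0 by lra.
by rewrite /C_tr3; nonneg.
Qed.

Lemma Var_f2_le : Var (f2 p (n := n)) <= C_var_f2 * nR ^+ 3.
Proof.
have [n3' nn0] := nR_facts; have A1 := Ab_facts.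
have [p0 p1] := andP p01; have [be0 be1] := andP beta01; have bs := beta_small.
(* Here 4 beta p (1-p) < 1/2 enters: it makes 2 beta p (1-p) at most 1/4. *)
have cge : 1 <= c_f2 n p beta.
  have q : 0 <= 2 * beta * (p * (1 - p)) <= 1 / 4.
    have : 0 <= beta * (p * (1 - p)) by rewrite mulr_ge0 ?mulr_ge0//; lra.
    by lra.
  have r : 0 <= (nR - 2) / nR <= 1.
    by rewrite divr_ge0 ?(ltW nn0) ?ler_pdivrMr//=; lra.
  rewrite /c_f2 -mulrA; case/andP: q => q1 q2; case/andP: r => r1 r2.
  by nra.
have c0 : 0 < c_f2 n p beta by lra.
have drift X : X \in Omega n k -> generator p beta (f2 p (n := n)) X =
   - c_f2 n p beta * f2 p X + 4 * N * (p * (1 - p)) + err_f2 p beta X.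
  by move=> _; rewrite /err_f2; ring.
apply: (le_trans (gibbs_var_le_dirichlet kE n0 p01 c0 drift)).
have dir : dirichlet k p beta (f2 p (n := n)) <= (8 * Ab * (K + C_bad) + 4 * Ab) * nR ^+ 3.
  have := dirichlet_le kE n1 p01 beta01 (fun X e f => f2_swap_sq_le p X e f).
  move/le_trans; apply; rewrite [leRHS]mulrDl; apply: lerD.
    have -> : 8 * Ab * (K + C_bad) * nR ^+ 3 = Ab / 2 * (16 * nR * ((K + C_bad) * nR ^+ 2)).
      by field.
    apply: ler_wpM2l; first by lra.
    apply: (@le_trans _ _ (Mean (fun X => 16 * nR * f2 p X))).
      apply: ler_Mean => X XO; rewrite -mulr_sumr (sum_Se_sq kE XO).
      have := f2_ge0 p X => f0; nra.
    rewrite MeanZ; apply: ler_wpM2l; first lra.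
    exact: Mean_f2_le.
  have hN := N_le R n1; have N0 := N_gt0 R n1.
  have n23 : nR ^+ 2 <= nR ^+ 3 by rewrite ler_weXn2l//; lra.
  by nra.
have er := Mean_err_le C_f2_ge0 (sqr_ge0 (Ab + 3))
  (fun X XO fK _ => err_f2_sq_le kE n1 p01 beta01 K0 XO fK) (fun X _ => err_f2_crude X).
have d0 : 0 <= dirichlet k p beta (f2 p (n := n)).
  apply: mulr_ge0; first by rewrite invr_ge0 mulr_ge0.
  apply: sumr_ge0 => e _; apply: sumr_ge0 => f _; apply: Mean_ge0 => X _.
  by rewrite mulr_ge0 ?rate_ge0 ?sqr_ge0.
have e0 : 0 <= Mean (fun X => err_f2 p beta X ^+ 2).
  by apply: Mean_ge0 => X _; exact: sqr_ge0.
rewrite /C_var_f2 [leRHS]mulrDl; apply: lerD.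
  rewrite -[leRHS]mulrA.
  apply: ler_pM => //; first by rewrite divr_ge0// ltW.
  by rewrite ler_pdivrMr//; lra.
apply: le_trans er; rewrite ler_piMl// invf_le1 ?exprn_gt0// expr2; nra.
Qed.

Definition C_var_tr3 : R := 18 * Ab * (2 * K + 2 * C_bad) + 36 * Ab +
  (C_tr3 b0 K * (1 + C_deg) + (Ab + 3) ^+ 2 * C_bad).

Lemma Var_tr3_le : Var (tr3 p (n := n)) <= C_var_tr3 * nR ^+ 3.
Proof.
have [n3' nn0] := nR_facts; have A1 := Ab_facts.
have drift X : X \in Omega n k -> generator p beta (tr3 p (n := n)) X =
   - 3 * tr3 p X + 0 + err_tr3 p beta X.
  by move=> _; rewrite /err_tr3; ring.
have c0 : (0 : R) < 3 by [].
apply: (le_trans (gibbs_var_le_dirichlet kE n0 p01 c0 drift)).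
have dir : dirichlet k p beta (tr3 p (n := n)) <=
    (18 * Ab * (2 * K + 2 * C_bad) + 36 * Ab) * nR ^+ 3.
  have := dirichlet_le kE n1 p01 beta01 (fun X e f => tr3_swap_sq_le p01 X e f).
  move/le_trans; apply; rewrite [leRHS]mulrDl; apply: lerD.
    have -> : 18 * Ab * (2 * K + 2 * C_bad) * nR ^+ 3 =
      Ab / 2 * (36 * ((2 * K + 2 * C_bad) * nR ^+ 3)) by field.
    apply: ler_wpM2l; first by lra.
    apply: (@le_trans _ _ (Mean (fun X => 36 * \sum_e C2 p X e ^+ 2))).
      by apply: ler_Mean => X XO; rewrite -mulr_sumr.
    by rewrite MeanZ; apply: ler_wpM2l => //; exact: Mean_C2_le.
  have hN := N_le R n1; have N0 := N_gt0 R n1.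
  have n23 : nR ^+ 2 <= nR ^+ 3 by rewrite ler_weXn2l//; lra.
  by nra.
have er := Mean_err_le C_tr3_ge0 (sqr_ge0 (Ab + 3))
  (fun X XO fK op => err_tr3_sq_le kE n1 p01 beta01 K0 XO fK op) (fun X _ => err_tr3_crude X).
have d0 : 0 <= dirichlet k p beta (tr3 p (n := n)).
  apply: mulr_ge0; first by rewrite invr_ge0 mulr_ge0.
  apply: sumr_ge0 => e _; apply: sumr_ge0 => f _; apply: Mean_ge0 => X _.
  by rewrite mulr_ge0 ?rate_ge0 ?sqr_ge0.
have e0 : 0 <= Mean (fun X => err_tr3 p beta X ^+ 2).
  by apply: Mean_ge0 => X _; exact: sqr_ge0.
rewrite /C_var_tr3 [leRHS]mulrDl; apply: lerD.
  by apply: le_trans dir; rewrite ler_piMl// ler_pdivrMr//; lra.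
by apply: le_trans er; rewrite ler_piMl// invf_le1 ?exprn_gt0// expr2; lra.
Qed.

Lemma Var_triangles_le :
  Var (fun X => (triangles X)%:R) <= (C_var_tr3 + C_var_f2) * nR ^+ 3.
Proof.
have [p0 p1] := andP p01.
rewrite (eq_gibbs_var beta kE n0 p01 (fun X XO => trianglesE kE n1 XO)).
apply: (le_trans (gibbs_varD beta kE n0 p01 _ _ _ _)); rewrite [leRHS]mulrDl.
have v1 := gibbs_var_ge0 k beta (tr3 p (n := n)).
have v2 := gibbs_var_ge0 k beta (f2 p (n := n)).
apply: lerD.
  by apply: le_trans Var_tr3_le; rewrite ler_piMl//; lra.
apply: le_trans Var_f2_le; rewrite ler_piMl//; nra.
Qed.

End Assembly.

Theorem corollary2p2 (R : realType) (B : set (R * R))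
    (Bcompact : compact B) (BsubR : B `<=` R_Kaw (R := R)) :
  exists (C : R) (n0 : nat), forall (p beta : R), B (p, beta) ->
    forall n k : nat, (n0 <= n)%N -> k%:R = 'C(n, 2)%:R * p ->
      gibbs_var k beta (fun X : graph n => (triangles X)%:R) <= C * n%:R ^+ 3.
Proof.
have [eta eta0 etaP] := compact_R_Kaw_uniform Bcompact BsubR.
(* On [B], p (1 - p) >= eta^2, so 4 beta p (1-p) < 1/2 forces beta <= 1 / (8 eta^2). *)
pose b0 : R := (8 * eta ^+ 2)^-1.
have b00 : 0 <= b0 by rewrite invr_ge0 mulr_ge0// sqr_ge0.
have [K K0 bad] := bad_event_le eta0 b00.
pose cm := 2 * C_move b0 eta K.
(* The threshold gives n >= 3 and n > cm^2, the latter being 2 C_move <= sqrt n. *)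
exists (C_var_tr3 b0 eta K + C_var_f2 b0 eta K), (maxn 3 (Num.truncn (cm ^+ 2)).+1).
move=> p beta Bpb n k; rewrite geq_max => /andP[n3 nc] kE.
have [e1 e2 e3] := etaP p beta Bpb.
have [/= p01 /andP[be0 _] bs] := BsubR _ Bpb.
have [p0 p1] := andP p01.
have beta01 : 0 <= beta <= b0.
  rewrite be0 /b0 -[_^-1]mul1r ler_pdivlMr ?mulr_gt0 ?exprn_gt0//.
  have : eta ^+ 2 <= p * (1 - p) by rewrite expr2; apply: ler_pM => //; exact: ltW.
  by move=> h; have := ler_wpM2l be0 h; lra.
have c0 : 0 < beta + eta by lra.
have sg t : p * expR ((1 - p) * t) + (1 - p) * expR (- p * t) <=
    expR (t ^+ 2 / (4 * (beta + eta))).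
  apply: (le_trans (kearns_saul t p01)); rewrite ler_expR ler_wpM2l ?sqr_ge0//.
  by rewrite lef_pV2 ?posrE ?ler_pM2l//; rewrite mulr_gt0// (lt_le_trans c0).
apply: (Var_triangles_le (k := k) kE n3 eta0 e1 e2 beta01 bs K0) => //.
  have cm0 : 0 <= cm by rewrite mulr_ge0// (C_move_ge0 eta0 beta01 K0).
  rewrite -[leLHS](ger0_norm cm0) -sqrtr_sqr ler_wsqrtr//.
  apply: ltW; apply: lt_le_trans (truncnS_gt _) _.
  by rewrite ler_nat.
by apply: bad => //; exact: ltnW.
Qed.
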